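(* Let $S$ be an effective toric divisor on $Y$ with fixed filtration $\mathcal O_S=[\mathcal O_{S_{d_1}}<\dots<\mathcal O_{S_{d_N}}]$, let $k_0\in\{1,\dots,N-1\}$, and let $0\to\mathcal O_R\to\mathcal O_S\to\mathcal O_{T'}\to0$ be the extension obtained by taking $\mathcal O_R$ to be the $k_0$-th step of the filtration and $\mathcal O_{T'}$ the quotient, so that $R$ and $T'$ are effective toric divisors with induced filtrations $\mathcal O_R=[\mathcal O_{S_{d_1}}<\dots<\mathcal O_{S_{d_{k_0}}}]$ and $\mathcal O_{T'}=[\mathcal O_{S_{d_{k_0+1}}}<\dots<\mathcal O_{S_{d_N}}]$. Then there is a canonical embedding of vertex algebras $$\mathbb V(Y,S)\to\mathbb V(Y,R)\otimes_K\mathbb V(Y,T')$$ whose image is the kernel of the (restriction of the) screening operator $$Q_{k_0}=\sum_s Q_{k_0,s}:\ \mathbb V(Y,R)\otimes_K\mathbb V(Y,T')\to\bigoplus_s\Pi(Y,S)_{\lambda_{k_0,s}},$$ where $s$ runs over the non-compact irreducible toric curves $C_s\subset S_{d_{k_0}}\cap S_{d_{k_0+1}}$.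
   Context: ''Vertex algebra'' allows vertex superalgebras. $Y\to X$ is a toric resolution of an affine toric Calabi–Yau threefold, with $Y$ Calabi–Yau and all fibres of dimension $\le1$ (i.e. a resolution $Y_{m,n}$ of $\{xy=z^mw^n\}$ or of $\mathbb C^3/(\mathbb Z_2\times\mathbb Z_2)$). $T\cong(\mathbb C^\times)^2\subset(\mathbb C^\times)^3$ is the subtorus preserving the Calabi–Yau form, and $K=\mathrm{Frac}\,H_T^\bullet(\mathrm{pt})=\mathbb C(\varepsilon_1,\varepsilon_2)$, $\varepsilon_3=-\varepsilon_1-\varepsilon_2$. Let $\{S_d\}$ be the irreducible toric surfaces in $Y$; $\mathfrak C_d$ indexes the compact irreducible toric curves $C_i\subset S_d$, $\mathfrak F_d$ is the set of torus fixed points in $S_d$; a non-compact irreducible toric curve $C_s\subset Y$ contains a unique fixed point $y_s$. $e_T$ is the $T$-equivariant Euler class and $N_{C,y}S_d$ is the fibre at $y$ of the normal bundle of $C$ in $S_d$. Let $S=\sum_d r_d[S_d]$ be an effective toric divisor, $N=\sum_d r_d$. Fix a filtration of $\mathcal O_S$ with successive subquotients $\mathcal O_{S_{d_1}},\dots,\mathcal O_{S_{d_N}}$ (each $d$ occurring $r_d$ times) whose induced consecutive extensions $\mathcal O_{S_{d_k}}\to E\to\mathcal O_{S_{d_{k+1}}}$ are non-trivial, written $\mathcal O_S=[\mathcal O_{S_{d_1}}<\dots<\mathcal O_{S_{d_N}}]$. - $\mathfrak F_S=\{(k,y):1\le k\le N,\ y\in\mathfrak F_{d_k}\}$, $\mathfrak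 C_S=\{(k,i):1\le k\le N,\ i\in\mathfrak C_{d_k}\}$; $\mathfrak h_S=\bigoplus_{a\in\mathfrak F_S}K1_a$ with orthogonal form $(1_{(k,y)},1_{(k,y)})=-1/e_T(T_yS_{d_k})$. - Heisenberg modes $b^a_n$ ($a\in\mathfrak F_S$, $n\in\mathbb Z$) satisfy $[b^a_n,b^{a'}_{n'}]=n\,\delta_{n+n',0}(1_a,1_{a'})$. For linear $\lambda:\mathfrak h_S\to K$, $\pi_{S,\lambda}=K[b^a_n]_{n\le-1}\mathbf 1_\lambda$ is the Fock module with $b^a_n\mathbf 1_\lambda=0$ for $n>0$, $b^a_0\mathbf 1_\lambda=(1_a,1_a)\lambda(1_a)\mathbf 1_\lambda$. The vertex operator $V_\lambda(z)=\,:\exp(\sum_a\lambda(1_a)\phi_a(z)):\ \in\mathrm{Hom}(\pi_{S,\nu},\pi_{S,\nu+\lambda})[[z^{\pm1}]]$ is $S_\lambda\prod_a z^{\lambda(1_a)b^a_0}\exp(-\lambda(1_a)\sum_{n<0}\tfrac{b^a_n}{n}z^{-n})\exp(-\lambda(1_a)\sum_{n>0}\tfrac{b^a_n}{n}z^{-n})$, with $S_\lambda\mathbf 1_\nu=\mathbf 1_{\nu+\lambda}$ commuting with $b^a_n$, $n\ne0$. - For $(k,i)\in\mathfrak C_S$: $\lambda_{(k,i)}(1_{(k,y)})=e_T(N_{C_i,y}S_{d_k})$ if $y\in C_i$, and $\lambda_{(k,i)}$ is $0$ on all other basis vectors. For $l\in\mathbb Z^{\mathfrak C_S}$, $\lambda_l=\sum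 l_{(k,i)}\lambda_{(k,i)}$. $\Pi(Y,S)=\bigoplus_{l\in\mathbb Z^{\mathfrak C_S}}\pi_{S,\lambda_l}$ is the lattice-type vertex algebra generated by the Heisenberg fields and the $V_{\lambda_l}(z)$ (with usual cocycle signs), and $\Pi(Y,S)_\lambda=\bigoplus_l\pi_{S,\lambda_l+\lambda}$ is its module. - For $1\le k\le N-1$ and each non-compact irreducible toric curve $C_s\subset S_{d_k}\cap S_{d_{k+1}}$ (with $S_d\cap S_d=S_d$), $\lambda_{k,s}$ takes the value $e_T(N_{C_s,y_s}S_{d_k})$ on $1_{(k,y_s)}$, $-e_T(N_{C_s,y_s}S_{d_{k+1}})$ on $1_{(k+1,y_s)}$, and $0$ otherwise. The screening operator is the residue $Q_{k,s}=\int V_{\lambda_{k,s}}(z)dz:\Pi(Y,S)\to\Pi(Y,S)_{\lambda_{k,s}}$. - $\mathbb V(Y,S)=\bigcap_{k,s}\ker Q_{k,s}\subset\Pi(Y,S)$; $\mathbb V(Y,R)$ and $\mathbb V(Y,T')$ are defined in the same way from the induced filtrations. There is a canonical isomorphism $\Pi(Y,S)=\Pi(Y,R)\otimes_K\Pi(Y,T')$. *)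

(* Defs.v *)
From HB Require Import structures.
From mathcomp Require Import all_boot all_order all_algebra.
From mathcomp Require Import finmap.
From mathcomp Require Import boolp classical_sets cardinality fsbigop.
From mathcomp Require Import reals complex.
(* mpoly and monalg declare clashing notations: only those of monalg are used. *)
From mathcomp Require Import -(notations) mpoly.
From mathcomp Require Import monalg.

Set Implicit Arguments.
Unset Strict Implicit.
Unset Printing Implicit Defensive.

Import Order.TTheory GRing.Theory Num.Theory.

Local Open Scope ring_scope.
Local Open Scope complex_scope.

Section VertexSuperalgebras.
Variable K : fieldType.

(* A superspace is given with a homogeneous basis, as the space {malg K[B]} of
   finitely supported functions on B.  [vprod u n v] is the n-th product u_(n) v,
   that is, Y(u, z) v = \sum_n (u_(n) v) z^(-n-1).  The axioms are stated in
   [vertex_superalgebra], for a subspace of the carrier. *)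
Record vertexData := VertexData {
  vbasis : choiceType;
  vpar : vbasis -> bool;
  vvac : {malg K[vbasis]};
  vprod : {malg K[vbasis]} -> int -> {malg K[vbasis]} -> {malg K[vbasis]}
}.

Definition carrier (A : vertexData) : lmodType K := {malg K[vbasis A]}.

Definition linext (B : choiceType) (V : lmodType K) (f : B -> V)
    (u : {malg K[B]}) : V :=
  \sum_(b <- msupp u) u@_b *: f b.

Definition homog (A : vertexData) (p : bool) (u : carrier A) : Prop :=
  forall b, b \in msupp u -> vpar b = p.

Definition hpart (A : vertexData) (p : bool) (u : carrier A) : carrier A :=
  linext (fun b : vbasis A => if vpar b == p then << b >> else 0) u.

Definition vtrans (A : vertexData) (u : carrier A) : carrier A :=
  vprod u (- 2) (vvac A).

Definition bracket (A : vertexData) (e : bool) (u : carrier A) (m : int)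
    (v : carrier A) (n : int) (w : carrier A) : carrier A :=
  vprod u m (vprod v n w) - (-1) ^+ e *: vprod v n (vprod u m w).

Record vertex_superalgebra (A : vertexData) (U : set (carrier A)) : Prop := {
  va_vac : U (vvac A);
  va_lin : forall c u v, U u -> U v -> U (c *: u + v);
  va_hpart : forall p u, U u -> U (hpart p u);
  va_prod : forall u n v, U u -> U v -> U (vprod u n v);
  va_linl : forall c u u' n v, U u -> U u' -> U v ->
    vprod (c *: u + u') n v = c *: vprod u n v + vprod u' n v;
  va_linr : forall c u n v v', U u -> U v -> U v' ->
    vprod u n (c *: v + v') = c *: vprod u n v + vprod u n v';
  va_vac_even : homog false (vvac A);
  va_par : forall p q u n v, U u -> U v -> homog p u -> homog q v ->
    homog (p (+) q) (vprod u n v);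
  va_trunc : forall u v, U u -> U v ->
    exists N : int, forall n : int, N <= n -> vprod u n v = 0;
  va_vacl : forall n v, U v -> vprod (vvac A) n v = if n == -1 then v else 0;
  va_vacr : forall u, U u -> vprod u (-1) (vvac A) = u;
  va_create : forall u (n : int), U u -> 0 <= n -> vprod u n (vvac A) = 0;
  va_trans : forall u n v, U u -> U v ->
    vtrans (vprod u n v) - vprod u n (vtrans v) = - n%:~R *: vprod u (n - 1) v;
  (* (z - w)^N [Y(u, z), Y(v, w)] = 0 for N large, [ , ] the supercommutator *)
  va_local : forall p q u v, U u -> U v -> homog p u -> homog q v ->
    exists N : nat, forall (m n : int) x, U x ->
      \sum_(j < N.+1) ((-1) ^+ j * 'C(N, j)%:R) *:
        bracket (p && q) u (m + (N - j)%N%:Z) v (n + j%:Z) x = 0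
}.

Record vertex_embedding (A B : vertexData) (U : set (carrier A))
    (W : set (carrier B)) (f : carrier A -> carrier B) : Prop := {
  ve_sub : forall u, U u -> W (f u);
  ve_lin : forall c u v, U u -> U v -> f (c *: u + v) = c *: f u + f v;
  ve_par : forall p u, U u -> homog p u -> homog p (f u);
  ve_vac : f (vvac A) = vvac B;
  ve_prod : forall u n v, U u -> U v -> f (vprod u n v) = vprod (f u) n (f v);
  ve_inj : forall u v, U u -> U v -> f u = f v -> u = v
}.

Definition vertex_isomorphism (A B : vertexData) (f : carrier A -> carrier B) :
    Prop :=
  vertex_embedding setT setT f /\ bijective f.

Definition tens (B1 B2 : choiceType) (u : {malg K[B1]}) (w : {malg K[B2]}) :
    {malg K[(B1 * B2)%type]} :=
  \sum_(b <- msupp u) \sum_(c <- msupp w) << u@_b * w@_c *g (b, c) >>.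

(* Y(u (x) w, z) = Y(u, z) (x) Y(w, z), with the Koszul sign; the sum over i is
   finitely supported as soon as both factors satisfy [va_trunc]. *)
Definition vtensor (A1 A2 : vertexData) : vertexData := {|
  vbasis := (vbasis A1 * vbasis A2)%type;
  vpar b := vpar b.1 (+) vpar b.2;
  vvac := tens (vvac A1) (vvac A2);
  vprod u n v := linext (fun b => linext (fun c =>
    (-1) ^+ (vpar b.2 && vpar c.1) *:
      \sum_(i \in [set: int]%classic)
        tens (vprod << b.1 >> i << c.1 >>) (vprod << b.2 >> (n - i - 1) << c.2 >>))
    v) u
|}.

(* The image of U (x) W in V1 (x) V2; K being a field, it is isomorphic to it. *)
Definition tens_set (A1 A2 : vertexData) (U : set (carrier A1))
    (W : set (carrier A2)) : set (carrier (vtensor A1 A2)) :=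
  [set x | exists s : seq (carrier A1 * carrier A2),
    (forall p, p \in s -> U p.1 /\ W p.2) /\ x = \sum_(p <- s) tens p.1 p.2]%classic.

End VertexSuperalgebras.

Section LatticeType.
Variables (K : fieldType) (I J : finType).
(* The form on the space with basis I is diagonal, with values [g]; the lattice
   is the free group on J, [lam c] being the functional attached to c : J; [ltJ]
   is a strict total order on J, which only enters the choice of cocycle. *)
Variables (g : I -> K) (lam : J -> I -> K) (ltJ : rel J).

Definition pairing (mu nu : I -> K) : K := \sum_a mu a * g a * nu a.

(* K has characteristic zero in the application, so that n is unique; the value
   at non-integral elements of K is irrelevant. *)
Definition intpart (x : K) : int := xget 0 [set n : int | n%:~R = x]%classic.

Definition momentum (l : {ffun J -> int}) : I -> K :=
  fun a => \sum_c (l c)%:~R * lam c a.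

(* (l, m) stands for the vector m 1_(lambda_l), the variable (a, k) of the
   monomial m being b^a_(-k-1). *)
Definition latbasis : choiceType :=
  ({ffun J -> int} * {cmonom (I * nat)%type})%type.

Definition latspace : lmodType K := {malg K[latbasis]}.

(* The sum of the pi_(lambda_l + mu): here (l, m) is m 1_(lambda_l + mu). *)
Definition latmodule (mu : I -> K) : lmodType K := {malg K[latbasis]}.

Definition heis (a : I) (n : int) : latspace -> latspace :=
  match n with
  | Negz k => linext (fun b : latbasis => << (b.1, mmul (ucm (a, k)) b.2) >>)
  | Posz 0 => linext (fun b : latbasis => (g a * momentum b.1 a) *: << b >>)
  | Posz k.+1 => linext (fun b : latbasis =>
      (k.+1%:R * g a * (b.2 (a, k))%:R) *: << (b.1, divcm b.2 (ucm (a, k))) >>)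
  end.

(* Coefficient of z^j in exp (\sum_(k >= 1) A k z^k). *)
Definition expcoef (A : nat -> latspace -> latspace) (j : nat) (v : latspace) :
    latspace :=
  \sum_(r < j.+1) (r`!%:R)^-1 *:
    \sum_(t : r.-tuple 'I_j.+1 |
          all (fun k : 'I_j.+1 => 0 < k)%N t && (\sum_(k <- t) k == j)%N)
      foldr (fun k : 'I_j.+1 => A k) v t.

(* Coefficients of z^k and of z^(-k), k >= 1, in the two exponents of V_mu(z). *)
Definition creation (mu : I -> K) (k : nat) (v : latspace) : latspace :=
  \sum_a (mu a / k%:R) *: heis a (- k%:Z) v.
Definition annihil (mu : I -> K) (k : nat) (v : latspace) : latspace :=
  \sum_a (- mu a / k%:R) *: heis a k%:Z v.

(* Coefficient of z^e in V_mu(z).  The factors z^(mu(1_a) b^a_0) act together on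
   pi_nu by z^(mu, nu), and S_mu maps the summand l to the summand l + s, so that
   the values are in latmodule (mu - momentum s). *)
Definition vertop (mu : I -> K) (s : {ffun J -> int}) (e : int) :
    latspace -> latspace :=
  linext (fun b : latbasis =>
    let d := e - intpart (pairing mu (momentum b.1)) in
    linext (fun c : latbasis => << (c.1 + s, c.2) >> : latspace)
      (\sum_(i \in [set: nat]%classic)
         if d + i%:Z is Posz j
         then expcoef (creation mu) j (expcoef (annihil mu) i << b >>)
         else 0)).

(* The bimultiplicative cocycle with
   eps(l, l') eps(l', l) = (-1)^((l, l') + (l, l) (l', l')). *)
Definition cocycle (l l' : {ffun J -> int}) : K :=
  \prod_c \prod_(c' | ltJ c' c)
    (-1) ^ (l c * l' c' *
      (intpart (pairing (lam c) (lam c'))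
       + intpart (pairing (lam c) (lam c)) * intpart (pairing (lam c') (lam c')))).

(* Fields are represented by their modes: X(z) = \sum_n X n z^(-n-1). *)
Definition lattice_field (l : {ffun J -> int}) (n : int) : latspace -> latspace :=
  linext (fun b : latbasis =>
    cocycle l b.1 *: vertop (momentum l) l (- n - 1) << b >>).

(* The normally ordered product : (1/k!) d^k b^a(z) X(z) : for x = (a, k). *)
Definition normal_prod (x : I * nat) (X : int -> latspace -> latspace)
    (n : int) (v : latspace) : latspace :=
  \sum_(j \in [set: nat]%classic) 'C(x.2 + j, x.2)%:R *:
    (heis x.1 (- (x.2 + j).+1%:Z) (X (n + j%:Z) v)
     + (-1) ^+ x.2 *: X (n - x.2%:Z - j%:Z - 1) (heis x.1 j%:Z v)).

Definition state_field (b : latbasis) : int -> latspace -> latspace :=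
  foldr normal_prod (lattice_field b.1)
    (flatten [seq nseq (b.2 x) x | x <- finsupp b.2]).

Definition latticeVA : vertexData K := {|
  vbasis := latbasis;
  vpar b := odd `|intpart (pairing (momentum b.1) (momentum b.1))|%N;
  vvac := << (0, mone) >>;
  vprod u n v := linext (fun b => state_field b n v) u
|}.

Definition screening (mu : I -> K) : carrier latticeVA -> latmodule mu :=
  vertop mu 0 (- 1).

End LatticeType.

Section Splitting.
Variables (K : fieldType) (I J I1 J1 I2 J2 : finType).
Variables (fI1 : I1 -> I) (fJ1 : J1 -> J) (fI2 : I2 -> I) (fJ2 : J2 -> J).

Definition restrict_basis (I' J' : finType) (fI : I' -> I) (fJ : J' -> J)
    (b : latbasis I J) : latbasis I' J' :=
  ([ffun c => b.1 (fJ c)],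
   [cmonom b.2 (fI x.1, x.2)
     | x in [fset (a, y.2) | a in enum I', y in finsupp b.2]%fset]%M).

Definition split_lattice (u : latspace K I J) :
    {malg K[(latbasis I1 J1 * latbasis I2 J2)%type]} :=
  linext (fun b => << (restrict_basis fI1 fJ1 b, restrict_basis fI2 fJ2 b) >>) u.

End Splitting.

Section Fans.
Variable R : realType.

Definition dot (m v : 'rV[int]_3) : int := \sum_j m 0 j * v 0 j.

(* For a set s of rays (the primitive generators of which are given by ray). *)
Definition cone (n : nat) (ray : 'I_n -> 'rV[int]_3) (s : {set 'I_n}) :
    set 'rV[R]_3 :=
  [set x | exists2 w : 'I_n -> R, (forall i, 0 <= w i) &
     x = \sum_(i in s) w i *: map_mx intr (ray i)]%classic.

Definition support (n : nat) (ray : 'I_n -> 'rV[int]_3)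
    (cones : {set {set 'I_n}}) : set 'rV[R]_3 :=
  [set x | exists2 s, s \in cones & cone ray s x]%classic.

Definition interior3 (A : set 'rV[R]_3) : set 'rV[R]_3 :=
  [set x | exists2 e : R, 0 < e &
     forall y : 'rV[R]_3, (forall j, `|y 0 j - x 0 j| < e) -> A y]%classic.

(* The fan in R^3 = N (x) R of Y, given by its rays and its maximal cones.  The
   Calabi-Yau form is invariant under the subtorus of N (x) Gm orthogonal to the
   character taking the value 1 on all rays; a basis of N is chosen for which that
   character is the last coordinate.  The affine variety X is the one of the
   cone |Fan|, and Y -> X is proper.  The fibre of Y -> X over the fixed point of
   X is the union of the orbits of the cones with relative interior in the
   interior of |Fan|, an orbit having the codimension of its cone as dimension;
   the fibres over the other points have dimension at most 1. *)
Record toricCY3 := ToricCY3 {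
  nrays : nat;
  ray : 'I_nrays -> 'rV[int]_3;
  maxcones : {set {set 'I_nrays}};
  calabi_yau : forall i, ray i 0 ord_max = 1;
  maxcones_neq0 : maxcones != finset.set0;
  rays_used : forall i, exists2 s, s \in maxcones & i \in s;
  smooth : forall s, s \in maxcones -> exists2 f : 'I_3 -> 'I_nrays,
    s = [set f r | r : 'I_3]%SET & (\matrix_r ray (f r)) \in unitmx;
  fan_inter : forall s t, s \in maxcones -> t \in maxcones ->
    (cone ray s `&` cone ray t = cone ray (s :&: t))%classic;
  affine_base : support ray maxcones = cone ray finset.setT;
  fibres_le1 : forall i,
    ~ interior3 (support ray maxcones) (map_mx intr (ray i))
}.

End Fans.

Section Geometry.
Variables (R : realType) (Y : toricCY3 R).

Definition surface : finType := 'I_(nrays Y).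
Definition fixedpt (y : {set surface}) : bool := y \in maxcones Y.

Definition is_cone (s : {set surface}) : bool :=
  [exists y in maxcones Y, s \subset y].

(* The closure of the orbit of a two-dimensional cone is the projective line if
   the cone is a face of two maximal cones, and the affine line if it is a face of
   a single one.  The curve lies on the surface p iff p \in s, and contains the
   fixed point y iff s \subset y. *)
Definition curve (s : {set surface}) : bool := (#|s| == 2%N) && is_cone s.
Definition compact_curve (s : {set surface}) : bool :=
  curve s && (#|[set y in maxcones Y | s \subset y]| == 2%N).
Definition noncompact_curve (s : {set surface}) : bool :=
  curve s && ~~ compact_curve s.

Definition baseField : fieldType := {fraction mpoly 2 R[i]}.

Definition eps (i : 'I_2) : baseField := tofrac (mpolyX R[i] (mnm1 i)).

(* The weight of T on the coordinate of the chart y vanishing on the surface p: this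
   coordinate is the character of the torus Gm^3 which is the vector of the dual basis
   of y attached to p.  T consists of the cocharacters with last coordinate 0. *)
Definition coord_char (y : {set surface}) (p : surface) : 'rV[int]_3 :=
  xget 0 [set m | forall q, q \in y -> dot m (ray q) = (p == q)%:R]%classic.
Definition weight (y : {set surface}) (p : surface) : baseField :=
  \sum_(i < 2) (coord_char y p 0 (widen_ord (leqnSn 2) i))%:~R * eps i.

Definition euler_tangent (y : {set surface}) (p : surface) : baseField :=
  \prod_(q in (y :\ p)%SET) weight y q.

(* e_T of the normal bundle in the surface p of the curve s, at y. *)
Definition euler_normal (s y : {set surface}) (p : surface) : baseField :=
  \prod_(q in (s :\ p)%SET) weight y q.

Definition ratfun : fieldType := {fraction mpoly 3 R[i]}.

Definition character (m : 'rV[int]_3) : ratfun :=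
  \prod_(j < 3) tofrac (mpolyX R[i] (mnm1 j)) ^ m 0 j.

(* The sections of O_Y(- \sum_p r_p [S_p]) over the chart of the cone s. *)
Definition divisor_sections (r : surface -> nat) (s : {set surface}) :
    set ratfun :=
  [set f | exists2 t : seq (R[i] * 'rV[int]_3),
     forall cm p, cm \in t -> p \in s -> (r p)%:Z <= dot cm.2 (ray p) &
     f = \sum_(cm <- t) tofrac (mpolyC 2.+1 cm.1) * character cm.2]%classic.

Definition regular_sections : {set surface} -> set ratfun :=
  divisor_sections (fun=> 0%N).

(* Families of ideals of the charts compatible with localization. *)
Definition ideal_sheaf (F : {set surface} -> set ratfun) : Prop :=
  forall s, is_cone s ->
    [/\ (F s `<=` regular_sections s)%classic,
        F s 0,
        (forall f g, F s f -> F s g -> F s (f + g)),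
        (forall f g, regular_sections s f -> F s g -> F s (f * g)) &
        forall s' : {set surface}, s' \subset s -> F s' =
          [set h | exists2 t : seq (ratfun * ratfun),
             forall fg, fg \in t -> regular_sections s' fg.1 /\ F s fg.2 &
             h = \sum_(fg <- t) fg.1 * fg.2]%classic].

Definition sub_sheaf (F G : {set surface} -> set ratfun) : Prop :=
  forall s, is_cone s -> (F s `<=` G s)%classic.

(* G / F is an invertible sheaf on the surface p. *)
Definition invertible_quotient (F G : {set surface} -> set ratfun)
    (p : surface) : Prop :=
  forall y, fixedpt y -> exists2 g, G y g &
    G y = [set h | exists2 f, regular_sections y f & F y (h - f * g)]%classic /\
    [set f | regular_sections y f /\ F y (f * g)]%classic
      = divisor_sections (fun q => q == p) y.

(* The extension G / F -> H / F -> H / G splits. *)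
Definition split_extension (F G H : {set surface} -> set ratfun) : Prop :=
  exists L, [/\ ideal_sheaf L, sub_sheaf F L, sub_sheaf L H &
    forall s, is_cone s ->
      (G s `&` L s = F s)%classic /\
      H s = [set h | exists2 f, G s f & L s (h - f)]%classic].

(* Subsheaves of O_S = O_Y / O_Y(- S) are represented by their preimages in O_Y:
   the k-th step of the filtration is [step k / O_Y(- S)].  The successive
   subquotients are O_{S_d} up to twist by a line bundle. *)
Record filtration (S : surface -> nat) (N : nat) (d : 'I_N -> surface) := {
  step : nat -> {set surface} -> set ratfun;
  multiplicity : forall p, S p = #|[set k | d k == p]|;
  step_sheaf : forall k, (k <= N)%N -> ideal_sheaf (step k);
  step0 : forall s, is_cone s -> step 0 s = divisor_sections S s;
  stepN : forall s, is_cone s -> step N s = regular_sections s;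
  step_sub : forall k, (k < N)%N -> sub_sheaf (step k) (step k.+1);
  step_quotient : forall k : 'I_N,
    invertible_quotient (step k) (step k.+1) (d k);
  step_nonsplit : forall k, (k.+1 < N)%N ->
    ~ split_extension (step k) (step k.+1) (step k.+2)
}.

Section VertexAlgebras.
Variables (N : nat) (d : 'I_N -> surface).

Definition fixS : finType :=
  {a : 'I_N * {set surface} | fixedpt a.2 && (d a.1 \in a.2)}.
Definition curveS : finType :=
  {c : 'I_N * {set surface} | compact_curve c.2 && (d c.1 \in c.2)}.

Definition formS (a : fixS) : baseField :=
  - (euler_tangent (val a).2 (d (val a).1))^-1.

Definition lambda_compact (c : curveS) (a : fixS) : baseField :=
  if ((val a).1 == (val c).1) && ((val c).2 \subset (val a).2)
  then euler_normal (val c).2 (val a).2 (d (val c).1) else 0.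

(* k' is meant to be the successor of k. *)
Definition lambda_screen (k k' : 'I_N) (s : {set surface}) (a : fixS) :
    baseField :=
  if s \subset (val a).2 then
    (if (val a).1 == k then euler_normal s (val a).2 (d k)
     else if (val a).1 == k' then - euler_normal s (val a).2 (d k')
     else 0)
  else 0.

Definition lt_curveS (c c' : curveS) : bool :=
  ((val c).1 < (val c').1)%N ||
  ((val c).1 == (val c').1) &&
    (enum_rank (val c).2 < enum_rank (val c').2)%N.

Definition Pi : vertexData baseField :=
  latticeVA formS lambda_compact lt_curveS.

Definition Pi_module (mu : fixS -> baseField) : lmodType baseField :=
  latmodule curveS mu.

(* The non-compact curves in the intersection of the surfaces d k and d k'. *)
Definition screen_curve (k k' : 'I_N) : finType :=
  {s : {set surface} | [&& noncompact_curve s, d k \in s & d k' \in s]}.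

Definition Q (k k' : 'I_N) (s : screen_curve k k') :
    carrier Pi -> Pi_module (lambda_screen k k' (val s)) :=
  @screening _ _ _ formS lambda_compact lt_curveS (lambda_screen k k' (val s)).

(* \sum_s Q k k' s, with values in the direct sum over s of the modules, the set
   of the curves s being finite. *)
Definition Qsum (k k' : 'I_N) (v : carrier Pi) :
    forall s : screen_curve k k', Pi_module (lambda_screen k k' (val s)) :=
  fun s => Q s v.

Definition VY : set (carrier Pi) :=
  [set v | forall (k k' : 'I_N) (s : screen_curve k k'),
     k' = k.+1 :> nat -> Q s v = 0]%classic.

End VertexAlgebras.

Section Canonical.
Variables (a b : nat) (d : 'I_(a + b) -> surface).

Definition d_sub : 'I_a -> surface := fun k => d (lshift b k).
Definition d_quo : 'I_b -> surface := fun k => d (rshift a k).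

Definition fix_sub (x : fixS d_sub) : fixS d :=
  exist _ (lshift b (val x).1, (val x).2) (valP x).
Definition fix_quo (x : fixS d_quo) : fixS d :=
  exist _ (rshift a (val x).1, (val x).2) (valP x).
Definition curve_sub (x : curveS d_sub) : curveS d :=
  exist _ (lshift b (val x).1, (val x).2) (valP x).
Definition curve_quo (x : curveS d_quo) : curveS d :=
  exist _ (rshift a (val x).1, (val x).2) (valP x).

(* Identifies b^(k, y)_n with b^(k, y)_n (x) 1 for k < a and with
   1 (x) b^(k - a, y)_n otherwise, and 1_(lambda_l) with the tensor product of the
   vectors of the two restrictions of l. *)
Definition canonical_iso :
    carrier (Pi d) -> carrier (vtensor (Pi d_sub) (Pi d_quo)) :=
  split_lattice fix_sub curve_sub fix_quo curve_quo.

End Canonical.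

(* The case k_0 = a + 1, N = a + b + 2, both k_0 and N - k_0 being positive. *)
Definition Q_tensor (a b : nat) (d : 'I_(a.+1 + b.+1) -> surface)
    (x : carrier (vtensor (Pi (d_sub d)) (Pi (d_quo d)))) :=
  Qsum (d := d) (k := lshift b.+1 ord_max) (k' := rshift a.+1 ord0)
    (xget 0 [set v | canonical_iso v = x]%classic).

End Geometry.

(* Main.v *)
(* The charge lattice of S is the orthogonal sum of those of R and T': a compact
   curve at level k only involves the fixed points at level k.  Hence a vertex
   operator of Pi(Y, S) is the product of vertex operators acting on the two
   factors, and Phi is an isomorphism onto the tensor product, the cocycle of S
   being the product of those of R and T' up to the Koszul sign.

   The weights of T at the two fixed points of a compact curve are related by the
   relation between the rays of the two adjacent cones, so that the curve has
   integral self-pairing; distinct curves on one surface meet in at most one point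
   and have pairing 0 or -1.  So the vertex operators of Pi(Y, S) are mutually local,
   and local with the screening currents.  Operators on a Fock space are determined
   by their commutators with the nonzero Heisenberg modes and their
   vacuum matrix coefficients; together with Dong's lemma this gives the axioms.
   The kernel of a screening operator Q is a subalgebra: if Q u = 0, the difference
   Q Y(u, z) - Y(u, z) Q (up to sign) is a field local to all the others and kills
   the vacuum, hence vanishes.

   For k <> k_0 the operator Q_(k, s) acts on a single factor, so that the
   intersection of these kernels is the tensor product of V(Y, R) and V(Y, T'), and
   V(Y, S) is the kernel in it of the remaining operators Q_(k_0, s). *)

Require Import Defs.
From mathcomp Require Import all_boot all_order all_algebra.
From mathcomp Require Import finmap.
From mathcomp Require Import boolp classical_sets fsbigop.
From mathcomp Require Import reals complex.
From mathcomp Require Import -(notations) mpoly.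
From mathcomp Require Import monalg.
From mathcomp Require Import zify ring.

Set Implicit Arguments.
Unset Strict Implicit.
Unset Printing Implicit Defensive.

Import Order.TTheory GRing.Theory Num.Theory.

Local Open Scope ring_scope.

(** * Fields, locality and normally ordered products *)

(** The pairing of a screening charge with itself need not be an integer, so that its vertex
    operator cannot be treated as one more field of a lattice algebra. For this reason vertex
    operators carry a weight, a function on the charges: it holds the cocycle signs, and in a
    lattice enlarged by one generator it confines the operator of the screening charge to the
    charges on which its exponents are integers. The same statements are then needed for four Fock
    spaces, those of $S$, $R$, $T'$ and the enlarged one, and are proved once from the axioms
    [fock_space].

    Series are handled through their modes. Multiplication by $z-w$ is a difference operator in the
    two indices, and locality, Dong's lemma and the comparison of the two expansions of $(z-w)^S$
    become identities between finite sums.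

    The field of a state depends a priori on the order in which its Heisenberg factors are listed,
    and splitting a state between the two tensor factors does not control that order. Fields with
    equal states are therefore identified by uniqueness, not by computation. *)

Section FiniteSupportSums.
Variable X : zmodType.
Implicit Types f g : nat -> X.

Definition fin f := exists J, forall j, (J <= j)%N -> f j = 0.
(** The form of the infinite sums in [vertop] and [normal_prod]. Such a sum is zero when the support
    is infinite, hence the conditions [fin] below. *)
Definition fsum f : X := \sum_(j \in [set: nat]%classic) f j.

Lemma fsumE J f : (forall j, (J <= j)%N -> f j = 0) -> fsum f = \sum_(j < J) f j.
Proof.
move=> fJ; rewrite fsbig_ord; apply/esym/fsbig_widen => // j /= [_].
by move=> /negP; rewrite -leqNgt => /fJ.
Qed.

Lemma eq_fsum f g : f =1 g -> fsum f = fsum g.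
Proof. by move=> fg; apply: eq_fsbigr => j _; apply: fg. Qed.

Lemma fsum0 f : (forall j, f j = 0) -> fsum f = 0.
Proof. by move=> f0; rewrite (@fsumE 0) ?big_ord0. Qed.

Lemma fin2 f g : fin f -> fin g ->
  exists J, forall j, (J <= j)%N -> f j = 0 /\ g j = 0.
Proof.
move=> [J1 f0] [J2 g0]; exists (maxn J1 J2) => j; rewrite geq_max => /andP[h1 h2].
by split; [apply: f0 | apply: g0].
Qed.

Lemma finB f g : fin f -> fin g -> fin (fun j => f j - g j).
Proof.
by move=> ff fg; have [J h] := fin2 ff fg; exists J => j /h[-> ->]; rewrite subr0.
Qed.

Lemma fsumB f g : fin f -> fin g -> fsum (fun j => f j - g j) = fsum f - fsum g.
Proof.
move=> ff fg; have [J h] := fin2 ff fg.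
rewrite !(@fsumE J) ?sumrB // => j /h [h1 h2]; by rewrite ?h1 ?h2 ?subr0.
Qed.

Lemma fsumD f g : fin f -> fin g -> fsum (fun j => f j + g j) = fsum f + fsum g.
Proof.
move=> ff fg; have [J h] := fin2 ff fg.
rewrite !(@fsumE J) ?big_split // => j /h [h1 h2]; by rewrite ?h1 ?h2 ?addr0.
Qed.

Lemma finS f : fin f -> fin (fun j => f j.+1).
Proof. by move=> [J h]; exists J => j jJ; apply: h; rewrite leqW. Qed.

Lemma fsumS f : fin f -> fsum f = f 0%N + fsum (fun j => f j.+1).
Proof.
move=> [J h]; rewrite (@fsumE J.+1) => [|j /ltnW/h //].
rewrite big_ord_recl (@fsumE J) // => j jJ; apply: h; exact: leqW.
Qed.

Lemma fsum_single f i : (forall j, j != i -> f j = 0) -> fsum f = f i.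
Proof.
move=> fi; rewrite (@fsumE i.+1) => [|j ij]; last by apply: fi; rewrite gtn_eqF.
rewrite big_ord_recr /= big1 ?add0r // => k _; apply: fi; by rewrite ltn_eqF.
Qed.

End FiniteSupportSums.

(** * Linear maps, locality and Dong's lemma *)

Section Modes.
Variable K : fieldType.

(** A predicate rather than a bundled structure: most operators below are closed terms with
    parameters, or come out of an existential statement. *)
Definition lin (X Z : lmodType K) (f : X -> Z) :=
  forall c u v, f (c *: u + v) = c *: f u + f v.

Section Lin.
Variables (X Z : lmodType K) (f : X -> Z).
Hypothesis fl : lin f.

Lemma linD u v : f (u + v) = f u + f v.
Proof. by rewrite -{1}[u]scale1r fl scale1r. Qed.

Lemma lin0 : f 0 = 0.
Proof. by apply: (addrI (f 0)); rewrite -linD !addr0. Qed.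

Lemma linZ c u : f (c *: u) = c *: f u.
Proof. by rewrite -[c *: u]addr0 fl lin0 addr0. Qed.

Lemma linN u : f (- u) = - f u.
Proof. by rewrite -scaleN1r linZ scaleN1r. Qed.

Lemma linB u v : f (u - v) = f u - f v.
Proof. by rewrite linD linN. Qed.

Lemma lin_sum (T : Type) (r : seq T) (P : pred T) (F : T -> X) :
  f (\sum_(i <- r | P i) F i) = \sum_(i <- r | P i) f (F i).
Proof.
elim: r => [|i r IH]; first by rewrite !big_nil lin0.
by rewrite !big_cons; case: (P i); rewrite ?linD IH.
Qed.

Lemma fin_lin g : fin g -> fin (fun j => f (g j)).
Proof. by move=> [J h]; exists J => j /h ->; rewrite lin0. Qed.

Lemma lin_fsum g : fin g -> f (fsum g) = fsum (fun j => f (g j)).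
Proof.
move=> [J h]; rewrite !(@fsumE _ J) ?lin_sum // => j /h // ->; by rewrite lin0.
Qed.
End Lin.

Lemma lin_comp (X Y Z : lmodType K) (f : Y -> Z) (h : X -> Y) :
  lin f -> lin h -> lin (fun x => f (h x)).
Proof. by move=> fl hl c u v; rewrite hl fl. Qed.

Lemma lin_id (X : lmodType K) : lin (fun x : X => x).
Proof. by []. Qed.

Lemma lin_zero (X Z : lmodType K) : lin (fun _ : X => 0 : Z).
Proof. by move=> c u v; rewrite scaler0 addr0. Qed.

Lemma lin_scale (X Z : lmodType K) (f : X -> Z) a :
  lin f -> lin (fun x => a *: f x).
Proof. by move=> fl c u v; rewrite fl scalerDr !scalerA mulrC. Qed.

Lemma lin_add (X Z : lmodType K) (f h : X -> Z) :
  lin f -> lin h -> lin (fun x => f x + h x).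
Proof. by move=> fl hl c u v; rewrite fl hl scalerDr addrACA. Qed.

Lemma lin_sub (X Z : lmodType K) (f h : X -> Z) :
  lin f -> lin h -> lin (fun x => f x - h x).
Proof. by move=> fl hl c u v; rewrite fl hl scalerBr opprD addrACA. Qed.

Lemma lin_bigsum (X Z : lmodType K) (T : Type) (r : seq T) (P : pred T)
    (F : T -> X -> Z) : (forall i, lin (F i)) ->
  lin (fun x => \sum_(i <- r | P i) F i x).
Proof.
move=> Fl c u v; rewrite scaler_sumr -big_split /=.
by apply: eq_bigr => i _; apply: Fl.
Qed.

Lemma lin_if (X Z : lmodType K) (b : bool) (f h : X -> Z) :
  lin f -> lin h -> lin (fun x => if b then f x else h x).
Proof. by case: b. Qed.

Lemma fin_scale (X : lmodType K) (c : nat -> K) (g : nat -> X) : fin g ->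
  fin (fun j => c j *: g j).
Proof. by move=> [J h]; exists J => j /h ->; rewrite scaler0. Qed.

Lemma fsumZ (X : lmodType K) (c : K) (g : nat -> X) : fin g ->
  fsum (fun j => c *: g j) = c *: fsum g.
Proof. by move=> fg; rewrite (lin_fsum (lin_scale c (@lin_id X))). Qed.

Variable X : lmodType K.
Implicit Types (A B C : int -> X -> X) (x : X) (e : K).

Lemma lin_fsum_fun (Z : lmodType K) (F : nat -> X -> Z) :
  (forall j, lin (F j)) -> (forall x, fin (F^~ x)) -> lin (fun x => fsum (F^~ x)).
Proof.
move=> Fl Ff c u v.
rewrite -fsumZ // -fsumD //; last exact: fin_scale.
by apply: eq_fsum => j; rewrite Fl.
Qed.

(** Vectors become powers of a formal variable, so that an identity between linear combinations is
    reduced to one between polynomials and can be left to [ring]. *)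
Lemma formal_comb (vs : seq X) : exists L : {poly K} -> X,
  [/\ {morph L : p q / p + q}, {morph L : p / - p},
      forall c p, c *: L p = L (c%:P * p) &
      forall i, (i < size vs)%N -> vs`_i = L 'X^i].
Proof.
exists (fun p => \sum_(i < size vs) p`_i *: vs`_i); split=> [p q|p|c p|i lti].
- by rewrite -big_split; apply: eq_bigr => i _; rewrite coefD scalerDl.
- by rewrite -sumrN; apply: eq_bigr => i _; rewrite coefN scaleNr.
- by rewrite scaler_sumr; apply: eq_bigr => i _; rewrite coefCM scalerA.
- rewrite (bigD1 (Ordinal lti)) //= coefXn eqxx scale1r big1 ?addr0 // => j ji.
  by rewrite coefXn -[(j == i :> nat)]/(j == Ordinal lti) (negPf ji) scale0r.
Qed.

Lemma subACA (Z : zmodType) (a b c d : Z) : a - b - (c - d) = a - c - (b - d).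
Proof. by rewrite !opprD addrACA. Qed.

(** Multiplication by $z-w$ of the series with coefficient $F(m,n)$ at $z^{-m-1}w^{-n-1}$. The next
    three are its analogues for two of three variables. *)
Definition diff2 (F : int -> int -> X) : int -> int -> X :=
  fun m n => F (m + 1) n - F m (n + 1).
Definition diff12 (F : int -> int -> int -> X) : int -> int -> int -> X :=
  fun p m s => F (p + 1) m s - F p (m + 1) s.
Definition diff13 (F : int -> int -> int -> X) : int -> int -> int -> X :=
  fun p m s => F (p + 1) m s - F p m (s + 1).
Definition diff23 (F : int -> int -> int -> X) : int -> int -> int -> X :=
  fun p m s => F p (m + 1) s - F p m (s + 1).

(** $z_2-z_3=(z_1-z_3)-(z_1-z_2)$, the identity on which Dong's lemma rests. *)
Lemma diff_23E F : diff23 F = fun p m s => diff13 F p m s - diff12 F p m s.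
Proof.
apply/funext => p; apply/funext => m; apply/funext => s.
by rewrite /diff23 /diff13 /diff12 opprB [RHS]addrC addrA subrK.
Qed.

Lemma diff12C13 F : diff12 (diff13 F) = diff13 (diff12 F).
Proof.
apply/funext => p; apply/funext => m; apply/funext => s.
by rewrite /diff12 /diff13 subACA.
Qed.

Lemma diff13C23 F : diff13 (diff23 F) = diff23 (diff13 F).
Proof.
apply/funext => p; apply/funext => m; apply/funext => s.
by rewrite /diff23 /diff13 subACA.
Qed.

Lemma diff12C23 F : diff12 (diff23 F) = diff23 (diff12 F).
Proof.
apply/funext => p; apply/funext => m; apply/funext => s.
by rewrite /diff23 /diff12 subACA.
Qed.

Lemma iter_comm (T : Type) (f h : T -> T) n (x : T) :
  (forall y, f (h y) = h (f y)) -> iter n f (h x) = h (iter n f x).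
Proof. by move=> fh; elim: n => //= n ->. Qed.

Lemma iter_comm2 (T : Type) (f h : T -> T) n m (x : T) :
  (forall y, f (h y) = h (f y)) -> iter n f (iter m h x) = iter m h (iter n f x).
Proof. by move=> fh; elim: m => //= m <-; rewrite (iter_comm _ _ fh). Qed.

Lemma iter_diff23 N F p : iter N diff23 F p = iter N diff2 (F p).
Proof.
elim: N F => // N IH F; rewrite !iterS; apply/funext => m; apply/funext => s.
by rewrite /diff23 IH.
Qed.

Lemma iter_diff13 N F p m s :
  iter N diff13 F p m s = iter N diff2 (fun p s => F p m s) p s.
Proof. by elim: N p s => // N IH p s; rewrite !iterS /diff13 !IH. Qed.

Lemma iter_diff12 N F p m s :
  iter N diff12 F p m s = iter N diff2 (fun p m => F p m s) p m.
Proof. by elim: N p m => // N IH p m; rewrite !iterS /diff12 !IH. Qed.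

Lemma iter_diff2_lin N f (F : int -> int -> X) : lin f ->
  iter N diff2 (fun m n => f (F m n)) = fun m n => f (iter N diff2 F m n).
Proof.
move=> fl; elim: N => // N IH; rewrite !iterS IH.
by apply/funext => m; apply/funext => n; rewrite /diff2 (linB fl).
Qed.

Lemma iter_diff2B N (F G : int -> int -> X) :
  iter N diff2 (fun m n => F m n - G m n)
    = fun m n => iter N diff2 F m n - iter N diff2 G m n.
Proof.
elim: N => // N IH; rewrite !iterS IH.
by apply/funext => m; apply/funext => n; rewrite /diff2 subACA.
Qed.

Lemma iter_diff2D N (F G : int -> int -> X) :
  iter N diff2 (fun m n => F m n + G m n)
    = fun m n => iter N diff2 F m n + iter N diff2 G m n.
Proof.
elim: N => // N IH; rewrite !iterS IH.
by apply/funext => m; apply/funext => n; rewrite /diff2 opprD addrACA.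
Qed.

Lemma iter_diff2_0 N : iter N diff2 (fun _ _ => 0) = fun _ _ => 0.
Proof.
elim: N => // N IH; rewrite iterS IH.
by apply/funext => m; apply/funext => n; rewrite /diff2 subr0.
Qed.

Definition zero3 : int -> int -> int -> X := fun _ _ _ => 0.

Lemma iter_zero3 N D : D zero3 = zero3 -> iter N D zero3 = zero3.
Proof. by move=> h; elim: N => // N IH; rewrite iterS IH. Qed.

Lemma diff_zero3 :
  [/\ diff12 zero3 = zero3, diff13 zero3 = zero3 & diff23 zero3 = zero3].
Proof.
by split; apply/funext => p; apply/funext => m; apply/funext => s;
  rewrite /diff12 /diff13 /diff23 /zero3 subr0.
Qed.

(* Supports on which the expansions of (z - w)^(-r) in |z| > |w| and in
   |w| > |z| may be applied. *)
Definition fin_up (F : int -> int -> int -> X) :=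
  forall p m s, fin (fun j : nat => F (p - j%:Z) (m + j%:Z) s).
Definition fin_down (F : int -> int -> int -> X) :=
  forall p m s, fin (fun j : nat => F (p + j%:Z) (m - j%:Z) s).

Lemma fin_up_diff F : fin_up F ->
  [/\ fin_up (diff12 F), fin_up (diff13 F) & fin_up (diff23 F)].
Proof.
move=> Ff; split=> p m s; apply: finB; rewrite -?addrAC; 
  first [exact: Ff | by under eq_fun do rewrite addrAC; exact: Ff].
Qed.

Lemma fin_down_diff F : fin_down F ->
  [/\ fin_down (diff12 F), fin_down (diff13 F) & fin_down (diff23 F)].
Proof.
move=> Ff; split=> p m s; apply: finB; rewrite -?addrAC; 
  first [exact: Ff | by under eq_fun do rewrite addrAC; exact: Ff].
Qed.

Lemma fin_up_iter N F : fin_up F -> fin_up (iter N diff23 F).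
Proof. by move=> Ff; elim: N => // N /fin_up_diff []. Qed.

Lemma fin_down_iter N F : fin_down F -> fin_down (iter N diff23 F).
Proof. by move=> Ff; elim: N => // N /fin_down_diff []. Qed.

(** The coefficient of $x^j$ in $(1-x)^{-r}$. The truncated predecessor makes this correct for $r=0$
    too: 1 at $j=0$ and 0 afterwards. *)
Definition nbin r j : K := 'C((r + j).-1, j)%:R.

(* The residues of the products with (z - w)^(-r), expanded in |z| > |w| and in
   |w| > |z|. *)
Definition res_up r (F : int -> int -> int -> X) (m s : int) : X :=
  fsum (fun j : nat => nbin r j *: F (- (r + j)%N%:Z) (m + j%:Z) s).
Definition res_down r (F : int -> int -> int -> X) (m s : int) : X :=
  (-1) ^+ r *: fsum (fun j : nat => nbin r j *: F j%:Z (m - (r + j)%N%:Z) s).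

Lemma nbinS r j : nbin r.+1 j.+1 = nbin r.+1 j + nbin r j.+1.
Proof.
by rewrite /nbin !addSn /= addnS /= binS natrD addrC.
Qed.

Lemma nbinr0 r : nbin r 0 = 1.
Proof. by rewrite /nbin bin0. Qed.

Lemma nbin0S j : nbin 0 j.+1 = 0.
Proof. by rewrite /nbin add0n /= bin_small. Qed.

Lemma fin_up_res r F m s : fin_up F ->
  fin (fun j : nat => nbin r j *: F (- (r + j)%N%:Z) (m + j%:Z) s).
Proof.
move=> /(_ (- r%:Z) m s) [J h]; exists J => j /h.
by rewrite PoszD opprD => ->; rewrite scaler0.
Qed.

Lemma fin_down_res r F m s : fin_down F ->
  fin (fun j : nat => nbin r j *: F j%:Z (m - (r + j)%N%:Z) s).
Proof.
move=> /(_ 0 (m - r%:Z) s) [J h]; exists J => j /h.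
by rewrite PoszD opprD add0r addrA => ->; rewrite scaler0.
Qed.

Lemma res_up0 F m s : fin_up F -> res_up 0 F m s = F 0 m s.
Proof.
move=> Ff; rewrite /res_up (@fsum_single _ _ 0%N).
  by rewrite nbinr0 scale1r addr0.
by case=> // j _; rewrite nbin0S scale0r.
Qed.

Lemma res_down0 F m s : fin_down F -> res_down 0 F m s = F 0 m s.
Proof.
move=> Ff; rewrite /res_down scale1r (@fsum_single _ _ 0%N).
  by rewrite nbinr0 scale1r subr0.
by case=> // j _; rewrite nbin0S scale0r.
Qed.

Lemma res_upB r F G m s : fin_up F -> fin_up G ->
  res_up r (fun p m s => F p m s - G p m s) m s = res_up r F m s - res_up r G m s.
Proof.
move=> Ff Gf; rewrite /res_up -fsumB; try exact: fin_up_res.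
by apply: eq_fsum => j; rewrite scalerBr.
Qed.

Lemma res_downB r F G m s : fin_down F -> fin_down G ->
  res_down r (fun p m s => F p m s - G p m s) m s
    = res_down r F m s - res_down r G m s.
Proof.
move=> Ff Gf; rewrite /res_down -scalerBr -fsumB; try exact: fin_down_res.
by congr (_ *: _); apply: eq_fsum => j; rewrite scalerBr.
Qed.

(** A factor $z-w$ lowers the pole order by one: after a shift of one of the two sums they are
    merged by Pascal's rule [nbinS]. *)
Lemma res_up_diff12 r F m s : fin_up F ->
  res_up r.+1 (diff12 F) m s = res_up r F m s.
Proof.
move=> Ff.
have f1 : fin (fun j : nat => nbin r.+1 j *: F (- (r + j)%N%:Z) (m + j%:Z) s).
  have [J h] := Ff (- r%:Z) m s; exists J => j /h.
  by rewrite PoszD opprD => ->; rewrite scaler0.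
have f2 : fin (fun j : nat => nbin r.+1 j *: F (- (r + j).+1%:Z) (m + j.+1%:Z) s).
  have [J h] := Ff (- r.+1%:Z) (m + 1) s; exists J => j /h E.
  by rewrite -{}[RHS](scaler0 _ (nbin r.+1 j)) -{}E; congr (_ *: F _ _ _); lia.
rewrite /res_up (@eq_fsum _ _ (fun j : nat =>
    nbin r.+1 j *: F (- (r + j)%N%:Z) (m + j%:Z) s
    - nbin r.+1 j *: F (- (r + j).+1%:Z) (m + j.+1%:Z) s)); last first.
  move=> j; rewrite /diff12 scalerBr; congr (_ *: F _ _ _ - _ *: F _ _ _); lia.
rewrite fsumB // fsumS // [in RHS]fsumS; last exact: fin_up_res.
rewrite -addrA !nbinr0; congr (_ + _).
rewrite -fsumB //; last exact: finS f1.
by apply: eq_fsum => j; rewrite nbinS scalerDl addrAC addnS subrr add0r.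
Qed.

Lemma res_down_diff12 r F m s : fin_down F ->
  res_down r.+1 (diff12 F) m s = res_down r F m s.
Proof.
move=> Ff.
have f1 : fin (fun j : nat => nbin r.+1 j *: F j%:Z (m - (r + j)%N%:Z) s).
  have [J h] := Ff 0 (m - r%:Z) s; exists J => j /h E.
  by rewrite -{}[RHS](scaler0 _ (nbin r.+1 j)) -{}E; congr (_ *: F _ _ _); lia.
have f2 : fin (fun j : nat => nbin r.+1 j *: F j.+1%:Z (m - (r + j).+1%:Z) s).
  have [J h] := Ff 1 (m - r.+1%:Z) s; exists J => j /h E.
  by rewrite -{}[RHS](scaler0 _ (nbin r.+1 j)) -{}E; congr (_ *: F _ _ _); lia.
rewrite /res_down exprS -scalerA scaleN1r -scalerN; congr (_ *: _).
rewrite (@eq_fsum _ _ (fun j : nat =>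
    nbin r.+1 j *: F j.+1%:Z (m - (r + j).+1%:Z) s
    - nbin r.+1 j *: F j%:Z (m - (r + j)%N%:Z) s)); last first.
  move=> j; rewrite /diff12 scalerBr; congr (_ *: F _ _ _ - _ *: F _ _ _); lia.
rewrite fsumB // opprB fsumS // [in RHS]fsumS; last exact: fin_down_res.
rewrite -addrA !nbinr0; congr (_ + _).
rewrite -fsumB //; last exact: finS f1.
by apply: eq_fsum => j; rewrite nbinS scalerDl addrAC addnS subrr add0r.
Qed.

Lemma diff23_step N F : iter N.+1 diff23 F =
  fun p m s => iter N diff23 (diff13 F) p m s - iter N diff23 (diff12 F) p m s.
Proof.
rewrite (iter_comm N F (fun y => esym (diff13C23 y))).
by rewrite (iter_comm N F (fun y => esym (diff12C23 y))) iterS diff_23E.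
Qed.

Lemma res_up_step N r F m s : fin_up F ->
  res_up r (iter N.+1 diff23 F) m s
    = res_up r (iter N diff23 (diff13 F)) m s
      - res_up r (iter N diff23 (diff12 F)) m s.
Proof.
move=> Ff; have [f12 f13 _] := fin_up_diff Ff.
by rewrite diff23_step; apply: res_upB; exact: fin_up_iter.
Qed.

Lemma res_down_step N r F m s : fin_down F ->
  res_down r (iter N.+1 diff23 F) m s
    = res_down r (iter N diff23 (diff13 F)) m s
      - res_down r (iter N diff23 (diff12 F)) m s.
Proof.
move=> Ff; have [f12 f13 _] := fin_down_diff Ff.
by rewrite diff23_step; apply: res_downB; exact: fin_down_iter.
Qed.

(* Since diff23 = diff13 - diff12, a high power of diff23 either contains a high
   power of diff13, or enough powers of diff12 to clear the pole at z = w, after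
   which both expansions agree. *)
Lemma res_up_down a c r F G : fin_up F -> fin_down G ->
  iter a diff13 F = zero3 -> iter a diff13 G = zero3 ->
  iter c diff12 F = iter c diff12 G ->
  forall m s, res_up r (iter (a + c + r) diff23 F) m s
            = res_down r (iter (a + c + r) diff23 G) m s.
Proof.
have [n] := ubnP (a + c + r)%N.
elim: n a c r F G => // n IH [|a] c r F G len Ff Gf F0 G0 FG m s.
  rewrite /= in F0 G0; rewrite F0 G0 iter_zero3; last by case: diff_zero3.
  rewrite /res_up /res_down !fsum0 ?scaler0 // => j; exact: scaler0.
have [fu12 fu13 _] := fin_up_diff Ff; have [fd12 fd13 _] := fin_down_diff Gf.
case: c => [|c] in FG len *.
  (* Both families are now [G]. Each [diff12] cancels one order of the pole, and at $r=0$ both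
     expansions read off the same coefficient. *)
  rewrite /= in FG; rewrite {}FG {F F0} in Ff fu12 fu13 *.
  case: r => [|r] in len *.
    by rewrite res_up0 ?res_down0; [| exact: fin_down_iter | exact: fin_up_iter].
  rewrite addnS res_up_step // res_down_step //.
  rewrite !(iter_comm (a.+1 + 0 + r) G (fun y => esym (diff12C23 y))).
  rewrite res_up_diff12 ?res_down_diff12; try by [exact: fin_up_iter|exact: fin_down_iter].
  rewrite (IH a.+1 0%N r G G) //; last by lia.
  congr (_ - _).
  have -> : (a.+1 + 0 + r = a + 0 + r.+1)%N by lia.
  by apply: IH; rewrite -?iterSr //; lia.
(* One [diff23] is spent: its [diff13] part lowers [a], its [diff12] part lowers [c]. *)
have -> : (a.+1 + c.+1 + r = (a + c.+1 + r).+1)%N by lia.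
rewrite res_up_step // res_down_step //; congr (_ - _).
  apply: IH; rewrite -?iterSr //; try lia.
  by rewrite !(iter_comm _ _ diff12C13) FG.
have -> : (a + c.+1 + r = a.+1 + c + r)%N by lia.
have [z12 _ _] := diff_zero3.
by apply: IH; rewrite -?iterSr //; first [lia |
  rewrite (iter_comm _ _ (fun y => esym (diff12C13 y))) ?F0 ?G0].
Qed.

Record is_field A : Prop := {
  field_lin : forall n, lin (A n);
  field_trunc : forall x, exists N : int, forall n : int, N <= n -> A n x = 0
}.

Definition scomm e A B x : int -> int -> X :=
  fun m n => A m (B n x) - e *: B n (A m x).

(** A single exponent [N] serves all vectors, as in [va_local]. *)
Definition local e A B := exists N, forall x,
  iter N diff2 (scomm e A B x) = fun _ _ => 0.

Lemma diff2_mono N M (F : int -> int -> X) : (N <= M)%N ->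
  iter N diff2 F = (fun _ _ => 0) -> iter M diff2 F = fun _ _ => 0.
Proof.
by move=> /subnK <- h; rewrite iterD h iter_diff2_0.
Qed.

Lemma local_sym e A B : e * e = 1 -> local e A B -> local e B A.
Proof.
move=> ee [N h]; exists N => x.
have swap M (F : int -> int -> X) m n :
    iter M diff2 (fun m n => F n m) m n = (-1) ^+ M *: iter M diff2 F n m.
  elim: M m n => [|M IH] m n; first by rewrite scale1r.
  by rewrite !iterS /diff2 !IH exprS -scalerBr mulN1r scaleNr -scalerN opprB.
have -> : scomm e B A x = fun m n => (- e) *: scomm e A B x n m.
  apply/funext => m; apply/funext => n.
  by rewrite /scomm scaleNr scalerBr scalerA ee scale1r opprB.
rewrite (iter_diff2_lin _ _ (lin_scale (- e) (@lin_id X))).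
apply/funext => m; apply/funext => n.
by rewrite (swap N (fun m n => scomm e A B x m n)) h !scaler0.
Qed.

Lemma local_comb e c A B C : is_field C -> local e A C -> local e B C ->
  local e (fun n x => c *: A n x + B n x) C.
Proof.
move=> Cf [N hN] [M hM]; exists (maxn N M) => x.
have -> : scomm e (fun n x => c *: A n x + B n x) C x =
    fun m n => c *: scomm e A C x m n + scomm e B C x m n.
  apply/funext => m; apply/funext => n.
  by rewrite /scomm (field_lin Cf) !scalerDr scalerN !scalerA [e * c]mulrC
    opprD addrACA.
rewrite iter_diff2D (iter_diff2_lin _ _ (lin_scale c (@lin_id X))).
rewrite (diff2_mono (leq_maxl N M) (hN x)) (diff2_mono (leq_maxr N M) (hM x)).
by apply/funext => m; apply/funext => n; rewrite scaler0 addr0.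
Qed.

Lemma local_zero e C : is_field C -> local e (fun _ _ => 0) C.
Proof.
move=> Cf; exists 0%N => x; apply/funext => m; apply/funext => n.
by rewrite /= /scomm (lin0 (field_lin Cf n)) scaler0 subr0.
Qed.

Lemma local_sum (T : eqType) e (r : seq T) (c : T -> K) (A : T -> int -> X -> X) C :
  is_field C -> (forall t, t \in r -> local e (A t) C) ->
  local e (fun n x => \sum_(t <- r) c t *: A t n x) C.
Proof.
move=> Cf; elim: r => [|t r IH] h.
  have -> : (fun n x => \sum_(t <- [::]) c t *: A t n x) = fun _ _ => 0.
    by apply/funext => n; apply/funext => x; rewrite big_nil.
  exact: local_zero.
have -> : (fun n x => \sum_(t <- t :: r) c t *: A t n x) =
    fun n x => c t *: A t n x + \sum_(t <- r) c t *: A t n x.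
  by apply/funext => n; apply/funext => x; rewrite big_cons.
apply: local_comb => //; first by apply: h; rewrite mem_head.
by apply: IH => u ur; apply: h; rewrite in_cons ur orbT.
Qed.

Lemma field_sum (T : Type) (r : seq T) (c : T -> K) (A : T -> int -> X -> X) :
  (forall t, is_field (A t)) -> is_field (fun n x => \sum_(t <- r) c t *: A t n x).
Proof.
move=> Af; split=> [n|x].
  by apply: lin_bigsum => t; apply: lin_scale; apply: (field_lin (Af t)).
elim: r => [|t r [N hN]]; first by exists 0 => n _; rewrite big_nil.
have [M hM] := field_trunc (Af t) x.
exists (Order.max N M) => n; rewrite ge_max => /andP[nN nM].
by rewrite big_cons hM // hN // scaler0 addr0.
Qed.

(* The modes of the (-r)-th product of A and B. *)
Definition nprod e r A B : int -> X -> X := fun m x =>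
  fsum (fun j : nat => nbin r j *: (A (- (r + j)%N%:Z) (B (m + j%:Z) x)
    - (e * (-1) ^+ r) *: B (m - (r + j)%N%:Z) (A j%:Z x))).

Lemma nprod_fin e r A B m x : is_field A -> is_field B ->
  fin (fun j : nat => A (- (r + j)%N%:Z) (B (m + j%:Z) x)) /\
  fin (fun j : nat => B (m - (r + j)%N%:Z) (A j%:Z x)).
Proof.
move=> Af Bf; have [N hN] := field_trunc Af x; have [M hM] := field_trunc Bf x.
split; [exists `|M - m|%N|exists `|N|%N] => j jN.
  by rewrite hM ?(lin0 (field_lin Af _)) //; lia.
by rewrite hN ?(lin0 (field_lin Bf _)) //; lia.
Qed.

Lemma nprod_fin_sub e r A B m x : is_field A -> is_field B ->
  fin (fun j : nat => nbin r j *: (A (- (r + j)%N%:Z) (B (m + j%:Z) x)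
    - (e * (-1) ^+ r) *: B (m - (r + j)%N%:Z) (A j%:Z x))).
Proof.
move=> Af Bf; have [h1 h2] := nprod_fin e r m x Af Bf.
by apply: fin_scale; apply: finB => //; apply: fin_scale.
Qed.

Lemma nprod_field e r A B : is_field A -> is_field B -> is_field (nprod e r A B).
Proof.
move=> Af Bf; split=> [n|x].
  apply: (lin_fsum_fun (F := fun (j : nat) x => nbin r j *:
    (A (- (r + j)%N%:Z) (B (n + j%:Z) x)
     - (e * (-1) ^+ r) *: B (n - (r + j)%N%:Z) (A j%:Z x)))) => [j|x];
    last exact: (nprod_fin_sub e r n x Af Bf).
  apply: lin_scale; apply: lin_sub; last apply: lin_scale.
    exact: (lin_comp (field_lin Af _) (field_lin Bf _)).
  exact: (lin_comp (field_lin Bf _) (field_lin Af _)).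
have [N hN] := field_trunc Af x; have [M hM] := field_trunc Bf x.
(* Only finitely many [j] have [A j x] nonzero, and the maximum of their truncation orders for [B]
   serves them all. *)
have [L hL] : exists L : int, forall n (j : nat), L <= n ->
    B (n - (r + j)%N%:Z) (A j%:Z x) = 0.
  suff [L hL] : exists L : int, forall n (j : nat), (j < `|N|)%N -> L <= n ->
      B (n - (r + j)%N%:Z) (A j%:Z x) = 0.
    exists L => n j Ln; have [jN|jN] := ltnP j `|N|; first exact: hL.
    by rewrite hN ?(lin0 (field_lin Bf _)) //; lia.
  elim: `|N|%N => [|k [L hL]]; first by exists 0.
  have [L' hL'] := field_trunc Bf (A k%:Z x).
  exists (Order.max L (L' + (r + k)%N%:Z)) => n j; rewrite ltnS ge_max.
  move=> jk /andP[Ln L'n]; move: jk; rewrite leq_eqVlt => /orP[/eqP->|]; last first.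
    by move=> jk; apply: hL.
  by apply: hL'; lia.
exists (Order.max L M) => n; rewrite ge_max => /andP[Ln Mn].
apply: fsum0 => j; rewrite hL // hM; last by lia.
by rewrite (lin0 (field_lin Af _)) scaler0 subr0 scaler0.
Qed.

(** Dong's lemma. The supercommutator of the product with [C] is the difference of the two residues
    [res_up] and [res_down], of [A B] and of [B A] commuted with [C], and [res_up_down] equates them
    after enough powers of [diff23]. *)
Lemma dong e12 e13 e23 r A B C : is_field A -> is_field B -> is_field C ->
  local e12 A B -> local e13 A C -> local e23 B C ->
  local (e13 * e23) (nprod e12 r A B) C.
Proof.
move=> Af Bf Cf [N12 h12] [N13 h13] [N23 h23].
pose N := maxn N12 (maxn N13 N23).
have {}h12 x := diff2_mono (leq_maxl N12 (maxn N13 N23)) (h12 x).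
have {}h13 x := diff2_mono (leq_trans (leq_maxl N13 N23) (leq_maxr N12 _)) (h13 x).
have {}h23 x := diff2_mono (leq_trans (leq_maxr N13 N23) (leq_maxr N12 _)) (h23 x).
rewrite -/N in h12 h13 h23.
(* The last [N] powers are used up by the locality of [B] and [C]; the other [N + N + r] are those
   of [res_up_down] with [a] and [c] equal to [N]. *)
exists ((N + N + r) + N)%N => x.
pose F p m s := A p (B m (C s x)) - (e13 * e23) *: C s (A p (B m x)).
pose G p m s := e12 *: (B m (A p (C s x)) - (e13 * e23) *: C s (B m (A p x))).
have Ff : fin_up F.
  move=> p m s; have [M1 k1] := field_trunc Bf (C s x).
  have [M2 k2] := field_trunc Bf x.
  exists (maxn `|M1 - m| `|M2 - m|)%N => j; rewrite geq_max => /andP[j1 j2].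
  rewrite /F k1; last by lia.
  rewrite k2; last by lia.
  by rewrite !(lin0 (field_lin Af _)) (lin0 (field_lin Cf _)) scaler0 subr0.
have Gf : fin_down G.
  move=> p m s; have [M1 k1] := field_trunc Af (C s x).
  have [M2 k2] := field_trunc Af x.
  exists (maxn `|M1 - p| `|M2 - p|)%N => j; rewrite geq_max => /andP[j1 j2].
  rewrite /G k1; last by lia.
  rewrite k2; last by lia.
  by rewrite !(lin0 (field_lin Bf _)) (lin0 (field_lin Cf _)) scaler0 subr0 scaler0.
have nfs m y := nprod_fin_sub e12 r m y Af Bf.
have -> : scomm (e13 * e23) (nprod e12 r A B) C x =
    fun m s => res_up r F m s - res_down r G m s.
  apply/funext => m; apply/funext => s.
  rewrite /scomm /nprod (lin_fsum (field_lin Cf s) (nfs m x)).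
  rewrite -fsumZ; last exact: (fin_lin (field_lin Cf s) (nfs m x)).
  rewrite /res_up /res_down -fsumZ; last exact: (fin_down_res r m s Gf).
  rewrite -(fsumB (nfs m (C s x)) (fin_scale _ (fin_lin (field_lin Cf s) (nfs m x)))).
  rewrite -(fsumB (fin_up_res r m s Ff) (fin_scale _ (fin_down_res r m s Gf))).
  apply: eq_fsum => j; rewrite (linZ (field_lin Cf s)) (linB (field_lin Cf s)).
  rewrite (linZ (field_lin Cf s)) /F /G !scalerBr !scalerA subACA.
  by congr (_ *: _ - _ *: _ - (_ *: _ - _ *: _)); ring.
rewrite iter_diff2B.
have upE M : iter M diff2 (fun m s => res_up r F m s) =
    fun m s => res_up r (iter M diff23 F) m s.
  elim: M => // M IH; rewrite iterS IH; apply/funext => m; apply/funext => s.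
  have fM := fin_up_iter M Ff.
  rewrite iterS /diff2 /res_up -fsumB; try exact: fin_up_res.
  by apply: eq_fsum => j; rewrite /diff23 -scalerBr addrAC.
have downE M : iter M diff2 (fun m s => res_down r G m s) =
    fun m s => res_down r (iter M diff23 G) m s.
  elim: M => // M IH; rewrite iterS IH; apply/funext => m; apply/funext => s.
  have fM := fin_down_iter M Gf.
  rewrite iterS /diff2 /res_down -scalerBr -fsumB; try exact: fin_down_res.
  by congr (_ *: _); apply: eq_fsum => j; rewrite /diff23 -scalerBr addrAC.
rewrite upE downE; apply/funext => m; apply/funext => s.
apply/eqP; rewrite subr_eq0; apply/eqP; rewrite !(iterD (N + N + r) N).
have iz M D : D zero3 = zero3 -> iter M D zero3 = zero3 by exact: iter_zero3.
have [z12 z13 z23] := diff_zero3.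
(* [H1] holds a supercommutator of [B] and [C], killed by powers of [diff23]; [H2] holds one of [A]
   and [C], killed by powers of [diff13]. *)
have split13 H (H1 H2 : int -> int -> int -> X) :
    H = (fun p m s => H1 p m s + H2 p m s) ->
    iter N diff23 H1 = zero3 -> iter N diff13 H2 = zero3 ->
    iter N diff13 (iter N diff23 H) = zero3.
  move=> -> E1 E2.
  have D23 : forall M, iter M diff23 (fun p m s => H1 p m s + H2 p m s) =
      fun p m s => iter M diff23 H1 p m s + iter M diff23 H2 p m s.
    by move=> M; apply/funext => p; rewrite !iter_diff23 iter_diff2D.
  rewrite D23 E1.
  have -> : (fun p m s => zero3 p m s + iter N diff23 H2 p m s) = iter N diff23 H2.
    by apply/funext => p; apply/funext => k; apply/funext => l; rewrite add0r.
  by rewrite (iter_comm2 _ _ _ diff13C23) E2 iz.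
apply: res_up_down.
- exact: fin_up_iter.
- exact: fin_down_iter.
- apply: (split13 F (fun p m s => A p (scomm e23 B C x m s))
    (fun p m s => e23 *: scomm e13 A C (B m x) p s)).
  + apply/funext => p; apply/funext => k; apply/funext => l.
    rewrite /F /scomm (linB (field_lin Af p)) (linZ (field_lin Af p)) scalerBr.
    by rewrite scalerA addrA subrK [e23 * _]mulrC.
  + apply/funext => p; rewrite iter_diff23 (iter_diff2_lin _ _ (field_lin Af p)) h23.
    by apply/funext => k; apply/funext => l; rewrite (lin0 (field_lin Af p)).
  + apply/funext => p; apply/funext => k; apply/funext => l.
    rewrite iter_diff13 (iter_diff2_lin _ _ (lin_scale e23 (@lin_id X))) h13.
    by rewrite scaler0.
- apply: (split13 G (fun p m s => (e12 * e13) *: scomm e23 B C (A p x) m s)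
    (fun p m s => e12 *: B m (scomm e13 A C x p s))).
  + apply/funext => p; apply/funext => k; apply/funext => l.
    rewrite /G /scomm (linB (field_lin Bf k)) (linZ (field_lin Bf k)) !scalerBr.
    by rewrite !scalerA !mulrA [RHS]addrC addrA subrK.
  + apply/funext => p.
    rewrite iter_diff23 (iter_diff2_lin _ _ (lin_scale (e12 * e13) (@lin_id X))) h23.
    by apply/funext => k; apply/funext => l; rewrite scaler0.
  + apply/funext => p; apply/funext => k; apply/funext => l.
    rewrite iter_diff13 (iter_diff2_lin _ _ (lin_scale e12 (field_lin Bf k))) h13.
    by rewrite (lin0 (field_lin Bf k)) scaler0.
(* The difference of [F] and [G] only involves supercommutators of [A] and [B]. *)
- rewrite !(iter_comm2 _ _ _ diff12C23); congr (iter N diff23 _).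
  apply/funext => p; apply/funext => k; apply/funext => l.
  rewrite !iter_diff12; apply/eqP; rewrite -subr_eq0; apply/eqP.
  pose H1 (p m : int) := F p m l; pose H2 (p m : int) := G p m l.
  rewrite -/H1 -/H2.
  have := congr1 (fun f => f p k) (iter_diff2B N H1 H2) => /= <-.
  have -> : (fun m n => H1 m n - H2 m n) = (fun p m => scomm e12 A B (C l x) p m
       - (e13 * e23) *: C l (scomm e12 A B x p m)).
    apply/funext => p'; apply/funext => m'.
    rewrite /H1 /H2 /F /G /scomm (linB (field_lin Cf l)) (linZ (field_lin Cf l)).
    rewrite !scalerBr !scalerA subACA [e12 * _]mulrC. by [].
  rewrite iter_diff2B h12.
  rewrite (iter_diff2_lin _ _ (lin_scale (e13 * e23) (field_lin Cf l))) h12.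
  by rewrite (lin0 (field_lin Cf l)) scaler0 subr0.
Qed.

Definition covariant (T : X -> X) A :=
  forall n x, T (A n x) = A n (T x) - n%:~R *: A (n - 1) x.

(** The derivatives of the two factors add up to the derivative of the product, up to a sum over [j]
    that telescopes. *)
Lemma nprod_covariant T e r A B : lin T -> is_field A -> is_field B ->
  covariant T A -> covariant T B -> covariant T (nprod e r A B).
Proof.
move=> Tl Af Bf TA TB m x.
pose c := e * (-1) ^+ r.
pose P j : X := nbin r j *: (A (- (r + j)%N%:Z) (B (m + j%:Z) (T x))
  - c *: B (m - (r + j)%N%:Z) (A j%:Z (T x))).
pose R j : X := nbin r j *: (A (- (r + j)%N%:Z) (B (m - 1 + j%:Z) x)
  - c *: B (m - 1 - (r + j)%N%:Z) (A j%:Z x)).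
(* The telescoping terms: [v] and [w] vanish at $j=0$ and for large $j$, and the identity [binrec]
   relates consecutive ones to the coefficients of the product. *)
pose v j : X := (j%:R * nbin r j) *: A (- (r + j)%N%:Z) (B (m - 1 + j%:Z) x).
pose w j : X := (j%:R * nbin r j) *: B (m - (r + j)%N%:Z) (A (j%:Z - 1) x).
have fP : fin P := nprod_fin_sub e r m (T x) Af Bf.
have fR : fin R := nprod_fin_sub e r (m - 1) x Af Bf.
have [[J1 u3] _] := nprod_fin e r (m - 1) x Af Bf.
have fvw : fin (fun j => v j - c *: w j).
  have [J2 k2] := field_trunc Af x.
  exists (maxn J1 `|(J2 + 1)%R|)%N => j; rewrite geq_max => /andP[j1 j2].
  rewrite /v /w u3 // k2; last by lia.
  by rewrite (lin0 (field_lin Bf _)) !scaler0 subr0.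
have binrec j : j.+1%:R * nbin r j.+1 = (r + j)%:R * nbin r j.
  by rewrite /nbin -!natrM addnS /= -mul_bin_diag.
rewrite /nprod (lin_fsum Tl (nprod_fin_sub e r m x Af Bf)).
have <- := fsumZ m%:~R fR.
rewrite -(fsumB fP (fin_scale _ fR)).
have tele : fsum (fun j => (v j.+1 - c *: w j.+1) - (v j - c *: w j)) = 0.
  rewrite (fsumB (finS fvw) fvw) [X in _ - X](fsumS fvw).
  by rewrite /v /w !mul0r !scale0r scaler0 subr0 add0r subrr.
rewrite -[RHS]addr0 -{}tele -(fsumD (finB fP (fin_scale _ fR)) (finB (finS fvw) fvw)).
apply: eq_fsum => j; rewrite /P /R /v /w !binrec.
rewrite (linZ Tl) (linB Tl) (linZ Tl) TA TB TB TA.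
rewrite (linB (field_lin Af _)) (linZ (field_lin Af _)).
rewrite (linB (field_lin Bf _)) (linZ (field_lin Bf _)) -/c.
have -> : - (r + j)%N%:Z - 1 = - (r + j.+1)%N%:Z by lia.
have -> : m + j%:Z - 1 = m - 1 + j%:Z by lia.
have -> : m - 1 + j.+1%:Z = m + j%:Z by lia.
have -> : m - (r + j)%N%:Z - 1 = m - 1 - (r + j)%N%:Z by lia.
have -> : m - (r + j.+1)%N%:Z = m - 1 - (r + j)%N%:Z by lia.
have -> : j.+1%:Z - 1 = j%:Z by lia.
move: (A _ (B (m + j%:Z) x)) (A _ (B (m - 1 + j%:Z) x)) (A _ (B _ (T x)))
  (B _ (A j%:Z x)) (B _ (A (j%:Z - 1) x)) (B _ (A _ (T x))) => a1 a2 a3 b1 b2 b3.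
have k1 : (- (r + j)%N%:Z)%:~R = - (r + j)%:R :> K by rewrite mulrNz.
have k2 : (m + j%:Z)%:~R = m%:~R + j%:R :> K by rewrite intrD.
have k3 : (m - (r + j)%N%:Z)%:~R = m%:~R - (r + j)%:R :> K by rewrite intrB.
rewrite k1 k2 k3 -[j%:Z%:~R]/(j%:R) natrD.
have [L [LD LN LZ Lv]] := formal_comb [:: a1; a2; a3; b1; b2; b3].
rewrite (Lv 0%N isT : a1 = _) (Lv 1%N isT : a2 = _) (Lv 2%N isT : a3 = _).
rewrite (Lv 3%N isT : b1 = _) (Lv 4%N isT : b2 = _) (Lv 5%N isT : b3 = _).
by rewrite ?(LZ, =^~ LD, =^~ LN); congr L; ring.
Qed.

(** $A(z)v_0$ has no pole and constant term $u$; its higher coefficients are left free. *)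
Definition creates v0 A u := forall n : int, -1 <= n ->
  A n v0 = if n == -1 then u else 0.

Lemma nprod_creates v0 e r A B u : is_field A -> is_field B ->
  (forall n : int, 0 <= n -> A n v0 = 0) -> creates v0 B u ->
  creates v0 (nprod e r A B) (A (- r%:Z) u).
Proof.
move=> Af Bf A0 Bc m m1; rewrite /nprod (@fsum_single _ _ 0%N).
  rewrite nbinr0 scale1r A0 // (lin0 (field_lin Bf _)) scaler0 subr0 addr0 addn0.
  by rewrite Bc //; case: ifP => _ //; rewrite (lin0 (field_lin Af _)).
move=> j j0; rewrite A0 // (lin0 (field_lin Bf _)) scaler0 subr0 Bc; last by lia.
by case: ifP => [|_]; [lia | rewrite (lin0 (field_lin Af _)) scaler0].
Qed.

(** Goddard's argument: since [A] kills [v0], locality reads $(z-w)^N A(z)B(w)v_0=0$, and the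
    constant term in $w$ is $z^N A(z)u=0$. *)
Lemma uniqueness v0 e A B u : is_field A -> is_field B ->
  (forall n, A n v0 = 0) -> local e A B -> creates v0 B u ->
  forall n, A n u = 0.
Proof.
move=> Af Bf A0 [N h] Bc n.
(* On the lowest power of $w$ only the factor $z^M$ of $(z-w)^M$ acts. *)
have bin_iter M (F : int -> int -> X) m k :
    (forall i j : int, k < j -> F i j = 0) -> iter M diff2 F m k = F (m + M%:Z) k.
  elim: M F m => [|M IH] F m Fk; first by rewrite addr0.
  rewrite iterSr IH; last by move=> i j kj; rewrite /diff2 !Fk ?subr0 //; lia.
  rewrite /diff2 (Fk _ (k + 1)) ?subr0; last by lia.
  by congr (F _ _); lia.
have E : scomm e A B v0 = fun m n => A m (B n v0).
  apply/funext => m; apply/funext => k.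
  by rewrite /scomm A0 (lin0 (field_lin Bf _)) scaler0 subr0.
have := congr1 (fun F => F (n - N%:Z) (-1)) (h v0).
rewrite /= E bin_iter; first by rewrite Bc // eqxx subrK.
move=> i j j0; rewrite Bc; last by lia.
by case: ifP => [|_]; [lia | rewrite (lin0 (field_lin Af _))].
Qed.

End Modes.

(** * Fock spaces *)

(* The Fock modules with their Heisenberg operators and vertex operators, up to
   isomorphism: vec gam m is the monomial m times the vacuum of charge gam. *)
Record fock_space (K : fieldType) (I : finType) (g : I -> K) (L : zmodType)
    (mom : L -> I -> K) (M : Type) (m1 : M) (mx : I -> nat -> M -> M)
    (X : lmodType K) (vec : L -> M -> X) (coef : L -> M -> X -> K)
    (b : I -> int -> X -> X) (sh : L -> X -> X) (dg : (L -> K) -> X -> X) :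
    Prop := {
  fs_char : forall n, n.+1%:R != 0 :> K;
  fs_g : forall a, g a != 0;
  fs_momD : forall gam gam' a, mom (gam + gam') a = mom gam a + mom gam' a;
  fs_ind : forall P : M -> Prop, P m1 -> (forall a k m, P m -> P (mx a k m)) ->
    forall m, P m;
  fs_ext : forall (Z : lmodType K) (f h : X -> Z), lin f -> lin h ->
    (forall gam m, f (vec gam m) = h (vec gam m)) -> forall x, f x = h x;
  fs_trunc : forall A : int -> X -> X, (forall n, lin (A n)) ->
    (forall gam m, exists N : int, forall n : int, N <= n -> A n (vec gam m) = 0) ->
    forall x, exists N : int, forall n : int, N <= n -> A n x = 0;
  fs_coef_lin : forall gam m c u v,
    coef gam m (c *: u + v) = c * coef gam m u + coef gam m v;
  fs_coef_ext : forall x, (forall gam m, coef gam m x = 0) -> x = 0;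
  fs_coef_vec : forall gam gam', coef gam m1 (vec gam' m1) = (gam == gam')%:R;
  fs_b_lin : forall a n, lin (b a n);
  fs_comm : forall a c m n x, b a m (b c n x) = b c n (b a m x) +
    (if (a == c) && (m + n == 0) then m%:~R * g a else 0) *: x;
  fs_neg : forall a k gam m, b a (Negz k) (vec gam m) = vec gam (mx a k m);
  fs_vac : forall a k gam, b a k.+1 (vec gam m1) = 0;
  fs_b0 : forall a x, b a 0 x = g a *: dg (fun gam => mom gam a) x;
  fs_b_trunc : forall a x, exists N : int, forall n : int, N <= n -> b a n x = 0;
  fs_coef_neg : forall a k gam x, coef gam m1 (b a (Negz k) x) = 0;
  fs_coef_pos : forall a k gam m, exists2 c, c != 0 &
    forall x, coef gam m (b a k.+1 x) = c * coef gam (mx a k m) x;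
  fs_sh_lin : forall s, lin (sh s);
  fs_sh : forall s gam m, sh s (vec gam m) = vec (gam + s) m;
  fs_sh_b : forall s a n x, n != 0 -> b a n (sh s x) = sh s (b a n x);
  fs_dg_lin : forall f, lin (dg f);
  fs_dg : forall f gam m, dg f (vec gam m) = f gam *: vec gam m;
  fs_dg_b : forall f a n x, b a n (dg f x) = dg f (b a n x)
}.

(** * Exponentials of series of commuting operators *)

Section Exponential.
Variables (K : fieldType) (X : lmodType K).
Hypothesis char0 : forall n, n.+1%:R != 0 :> K.

Variable A : nat -> X -> X.
Hypothesis Al : forall k, lin (A k).
Hypothesis AC : forall k l x, A k.+1 (A l.+1 x) = A l.+1 (A k.+1 x).

(** The coefficient of $z^j$ in the $r$-th power of $\sum_{k\ge1} A_k z^k$, in recursive form;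
    [tuple_compositions] identifies it with the sum over tuples in [expcoef]. *)
Fixpoint compositions (r j : nat) (v : X) : X :=
  if r is r'.+1 then
    \sum_(k < j) A k.+1 (compositions r' (j - k.+1)%N v)
  else if j == 0%N then v else 0.

(** Indexed by integers, with value zero at negative ones, so that shifts of the exponent need no
    side condition. *)
Definition exps (j : int) (v : X) : X :=
  if j is Posz j then
    \sum_(r < j.+1) (r`!%:R)^-1 *: compositions r j v
  else 0.

Definition compz r (j : int) v := if j is Posz j then compositions r j v else 0.

Lemma compz_lin r j : lin (compz r j).
Proof.
case: j => [j|j]; last exact: lin_zero.
elim: r j => [|r IH] j /=; first by apply: lin_if; [exact: lin_id|exact: lin_zero].
by apply: lin_bigsum => k; exact: lin_comp (Al _) (IH _).
Qed.

Lemma exps_lin j : lin (exps j).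
Proof.
case: j => [j|j]; last exact: lin_zero.
by apply: lin_bigsum => r; exact: lin_scale _ (compz_lin r j).
Qed.

Lemma compzS N r j v : j <= N%:Z ->
  compz r.+1 j v = \sum_(k < N) A k.+1 (compz r (j - k.+1%:Z) v).
Proof.
case: j => [j|j] jN; last first.
  by rewrite big1 // => k _; rewrite /= (lin0 (Al _)).
have {}jN : (j <= N)%N by lia.
rewrite /= (big_ord_widen N (fun k => A k.+1 (compositions r (j - k.+1)%N v))) //.
rewrite big_mkcond; apply: eq_bigr => k _; case: ltnP => kj.
  by rewrite -[compositions _ _ _]/(compz r (j - k.+1)%N%:Z v) -subzn.
have -> : j%:Z - k.+1%:Z = Negz (k - j) by lia.
by rewrite /= (lin0 (Al _)).
Qed.

Lemma compz_large r j v : j < r%:Z -> compz r j v = 0.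
Proof.
elim: r j => [|r IH] j jr; first by case: j jr.
case: j jr => // j jr.
rewrite (@compzS j) // big1 // => k _; rewrite IH ?(lin0 (Al _)) //; lia.
Qed.

(** The derivation $z\,d/dz$ applied to a power of the series: as the operators commute, all factors
    contribute equally. *)
Lemma compz_weight N r j v : j <= N%:Z -> j%:~R *: compz r.+1 j v =
  r.+1%:R *: \sum_(k < N) k.+1%:R *: A k.+1 (compz r (j - k.+1%:Z) v).
Proof.
elim: r j => [|r IH] j jN.
  rewrite scale1r (compzS _ _ jN) scaler_sumr; apply: eq_bigr => k _.
  case E: (j - k.+1%:Z) => [[|i]|i]; rewrite /= ?(lin0 (Al _)) ?scaler0 //.
  by have -> : j = k.+1 by lia.
rewrite (compzS _ _ jN) scaler_sumr.
under eq_bigr => k _.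
  rewrite (_ : j%:~R = k.+1%:R + (j - k.+1%:Z)%:~R); last first.
    by rewrite intrB addrC subrK.
  rewrite scalerDl -[X in _ + X](linZ (Al _)) IH; last by lia.
  rewrite (linZ (Al _)) (lin_sum (Al _)).
  over.
rewrite big_split /= -scaler_sumr exchange_big /=.
rewrite -[in RHS]addn1 addnC natrD scalerDl scale1r; congr (_ + _).
congr (_ *: _); apply: eq_bigr => k _.
rewrite (@compzS N); last by lia.
rewrite (lin_sum (Al _)) scaler_sumr; apply: eq_bigr => l _.
by rewrite (linZ (Al _)) AC addrAC.
Qed.

Lemma exps_compz N j v : j <= N%:Z ->
  exps j v = \sum_(r < N.+1) (r`!%:R)^-1 *: compz r j v.
Proof.
case: j => [j|j] jN; last by rewrite big1 // => r _; rewrite scaler0.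
rewrite /= (big_ord_widen N.+1 (fun r => (r`!%:R)^-1 *: compz r j v)); last by lia.
rewrite big_mkcond; apply: eq_bigr => r _; case: ltnP => // jr.
rewrite (_ : compositions r j v = 0) ?scaler0 //.
by apply: (@compz_large r j%:Z v); lia.
Qed.

(** The differential equation of the exponential. In characteristic zero it determines the
    coefficients, and all later facts on exponentials are proved by induction along it. *)
Lemma exps_rec N j v : j <= N%:Z ->
  j%:~R *: exps j v = \sum_(k < N) k.+1%:R *: A k.+1 (exps (j - k.+1%:Z) v).
Proof.
move=> jN; rewrite (@exps_compz N.+1) ?scaler_sumr; last by lia.
rewrite big_ord_recl /= fact0 invr1 scale1r.
have -> : j%:~R *: compz 0 j v = 0.
  by case: j {jN} => [[|j]|j] /=; rewrite ?scale0r ?scaler0.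
rewrite add0r; under eq_bigr => r _.
  rewrite /bump /= add1n scalerA mulrC -scalerA (compz_weight _ _ jN) scalerA.
  have -> : (r.+1)`!%:R^-1 * r.+1%:R = r`!%:R^-1 :> K.
    by rewrite factS natrM invfM mulrAC mulVf ?mul1r // char0.
  over.
rewrite /=; under eq_bigr do rewrite scaler_sumr.
rewrite exchange_big; apply: eq_bigr => k _ /=.
rewrite (@exps_compz N); last by lia.
rewrite (lin_sum (Al _)) scaler_sumr; apply: eq_bigr => r _.
by rewrite (linZ (Al _)) !scalerA mulrC.
Qed.

Lemma exps0 v : exps 0 v = v.
Proof. by rewrite /= big_ord_recl big_ord0 addr0 /= fact0 invr1 scale1r. Qed.

Lemma exps_neg j v : j < 0 -> exps j v = 0.
Proof. by case: j. Qed.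

Lemma scale_natI n (u v : X) : n.+1%:R *: u = n.+1%:R *: v -> u = v.
Proof. by move=> /(scalerI (char0 n)). Qed.

(* A linear map whose values on A k are scalars, zero unless k = n, acts on
   exp (\sum A k z^k) as multiplication by a multiple of z^n. *)
Lemma exps_derivation (B : X -> X) n c : lin B -> (0 < n)%N ->
  (forall k v, B (A k.+1 v) = A k.+1 (B v) + (if k.+1 == n then c else 0) *: v) ->
  forall j v, B (exps j v) = exps j (B v) + c *: exps (j - n%:Z) v.
Proof.
move=> Bl n0 BA j v; case: j => [j|j]; last first.
  have -> : Negz j - n%:Z = Negz (j + n) by lia.
  by rewrite /= (lin0 Bl) scaler0 addr0.
elim/ltn_ind: j => -[|j] IH.
  have -> : 0%N%:Z - n%:Z = Negz n.-1 by lia.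
  by rewrite !exps0 scaler0 addr0.
apply: (@scale_natI j).
have rec w : j.+1%:R *: exps j.+1 w =
    \sum_(k < j.+1) k.+1%:R *: A k.+1 (exps (j.+1%:Z - k.+1%:Z) w).
  exact: (@exps_rec j.+1 j.+1%:Z w).
rewrite -(linZ Bl) rec (lin_sum Bl) scalerDr rec scalerA mulrC.
have -> : j.+1%:R = (j.+1%:Z - n%:Z)%:~R + n%:R :> K by rewrite intrB subrK.
rewrite mulrDr scalerDl -(scalerA c) (@exps_rec j.+1); last by lia.
rewrite scaler_sumr addrA -big_split /=.
have -> : (c * n%:R) *: exps (j.+1%:Z - n%:Z) v =
    \sum_(k < j.+1) k.+1%:R *: ((if k.+1 == n then c else 0) *:
      exps (j.+1%:Z - k.+1%:Z) v).
  case: n n0 {BA IH} => // n _; rewrite (eq_bigr (fun k : 'I_j.+1 =>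
      if k == n :> nat then (c * n.+1%:R) *: exps (j.+1%:Z - n.+1%:Z) v else 0));
    last first.
    move=> k _; rewrite eqSS; case: eqP => [->|_]; first by rewrite scalerA mulrC.
    by rewrite scale0r scaler0.
  rewrite -big_mkcond /=; have [nj|jn] := ltnP n j.+1.
    by rewrite (big_pred1 (Ordinal nj)).
  rewrite big_pred0 => [|k]; last by apply/negbTE; rewrite neq_ltn (leq_trans (ltn_ord k) jn).
  by rewrite exps_neg ?scaler0 //; lia.
rewrite -big_split; apply: eq_bigr => k _ /=; rewrite (linZ Bl) BA.
have kj := ltn_ord k; have -> : j.+1%:Z - k.+1%:Z = (j - k)%N%:Z by lia.
rewrite IH; last by rewrite ltnS leq_subr.
rewrite (linD (Al _)) (linZ (Al _)) !scalerDr !scalerA [c * _]mulrC.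
by have -> : (j - k)%N%:Z - n%:Z = j.+1%:Z - n%:Z - k.+1%:Z by lia.
Qed.

Lemma exps_fixed j v : (forall k, A k.+1 v = 0) -> exps j v = if j == 0 then v else 0.
Proof.
move=> Av; case: j => [j|j] //; elim/ltn_ind: j => -[|j] IH; first exact: exps0.
apply: (@scale_natI j).
rewrite [LHS](@exps_rec j.+1 j.+1%:Z) // big1 ?scaler0 // => k _.
have kj := ltn_ord k; have -> : j.+1%:Z - k.+1%:Z = (j - k)%N%:Z by lia.
rewrite IH; last by rewrite ltnS leq_subr.
by case: ifP => _; rewrite ?Av ?(lin0 (Al _)) scaler0.
Qed.

End Exponential.

Arguments exps : simpl never.

(** * The exponential part of a vertex operator *)

Section FockTheory.
Variables (K : fieldType) (I : finType) (g : I -> K) (L : zmodType)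
  (mom : L -> I -> K) (M : Type) (m1 : M) (mx : I -> nat -> M -> M)
  (X : lmodType K) (vec : L -> M -> X) (coef : L -> M -> X -> K)
  (b : I -> int -> X -> X) (sh : L -> X -> X) (dg : (L -> K) -> X -> X).
Hypothesis F : fock_space g mom m1 mx vec coef b sh dg.

Let char0 := fs_char F.
Let bl := fs_b_lin F.

Definition cre (mu : I -> K) k v := \sum_a (mu a / k%:R) *: b a (- k%:Z) v.
Definition ann (mu : I -> K) k v := \sum_a (- mu a / k%:R) *: b a k%:Z v.

Lemma cre_lin mu k : lin (cre mu k).
Proof. by apply: lin_bigsum => a; exact: lin_scale _ (bl _ _). Qed.

Lemma ann_lin mu k : lin (ann mu k).
Proof. by apply: lin_bigsum => a; exact: lin_scale _ (bl _ _). Qed.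

Lemma creE mu k v : cre mu k v = \sum_a (mu a / k%:R) *: b a (- k%:Z) v.
Proof. by []. Qed.

Lemma annE mu k v : ann mu k v = \sum_a (- mu a / k%:R) *: b a k%:Z v.
Proof. by []. Qed.

Lemma b_cre mu a n k v : b a n (cre mu k.+1 v) =
  cre mu k.+1 (b a n v) + (if n == k.+1%:Z then g a * mu a else 0) *: v.
Proof.
rewrite /cre (lin_sum (bl _ _)).
under eq_bigr => c _ do rewrite (linZ (bl _ _)) (fs_comm F) scalerDr scalerA.
rewrite big_split; congr (_ + _); rewrite (bigD1 a) //= big1 => [|c ca]; last first.
  by rewrite eq_sym (negPf ca) mulr0 scale0r.
rewrite eqxx addr0 subr_eq0 /=; congr (_ *: _); case: eqP => [->|]; last by rewrite mulr0.
by rewrite mulrA divfK ?char0 // mulrC.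
Qed.

Lemma b_ann mu a n k v : b a n (ann mu k.+1 v) =
  ann mu k.+1 (b a n v) + (if n == - k.+1%:Z then g a * mu a else 0) *: v.
Proof.
rewrite /ann (lin_sum (bl _ _)).
under eq_bigr => c _ do rewrite (linZ (bl _ _)) (fs_comm F) scalerDr scalerA.
rewrite big_split; congr (_ + _); rewrite (bigD1 a) //= big1 => [|c ca]; last first.
  by rewrite eq_sym (negPf ca) mulr0 scale0r.
rewrite eqxx addr0 addr_eq0 /=; congr (_ *: _); case: eqP => [->|]; last by rewrite mulr0.
by rewrite mulrNz mulrA mulrN !mulNr opprK divfK ?char0 // mulrC.
Qed.

Lemma cre_comm mu mu' k l v :
  cre mu k.+1 (cre mu' l.+1 v) = cre mu' l.+1 (cre mu k.+1 v).
Proof.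
rewrite [LHS]creE (creE mu k.+1 v) (lin_sum (cre_lin _ _)).
apply: eq_bigr => a _; rewrite b_cre (linZ (cre_lin _ _)).
by case: eqP => [|_]; [lia | rewrite scale0r addr0].
Qed.

Lemma ann_comm mu mu' k l v :
  ann mu k.+1 (ann mu' l.+1 v) = ann mu' l.+1 (ann mu k.+1 v).
Proof.
rewrite [LHS]annE (annE mu k.+1 v) (lin_sum (ann_lin _ _)).
apply: eq_bigr => a _; rewrite b_ann (linZ (ann_lin _ _)).
by case: eqP => [|_]; [lia | rewrite scale0r addr0].
Qed.

Lemma ann_cre mu mu' k l v : ann mu k.+1 (cre mu' l.+1 v) =
  cre mu' l.+1 (ann mu k.+1 v)
  + (if l == k then - pairing g mu mu' / k.+1%:R else 0) *: v.
Proof.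
rewrite [LHS]annE; under eq_bigr => a _ do rewrite b_cre scalerDr scalerA.
rewrite big_split /=; congr (_ + _).
  rewrite annE (lin_sum (cre_lin _ _)); apply: eq_bigr => a _.
  by rewrite (linZ (cre_lin _ _)).
rewrite -scaler_suml; congr (_ *: _); rewrite eqz_nat eqSS eq_sym.
case: eqP => _; last by rewrite big1 // => a _; rewrite mulr0.
rewrite /pairing -sumrN mulr_suml; apply: eq_bigr => a _.
by rewrite mulrAC !mulNr !mulrA.
Qed.

Definition expm mu := exps (cre mu).
Definition expp mu := exps (ann mu).

Lemma expm_lin mu j : lin (expm mu j).
Proof. exact: exps_lin (cre_lin mu) j. Qed.

Lemma expp_lin mu j : lin (expp mu j).
Proof. exact: exps_lin (ann_lin mu) j. Qed.

Lemma exps_commute A (B : X -> X) j v : (forall k, lin (A k)) ->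
  (forall k l x, A k.+1 (A l.+1 x) = A l.+1 (A k.+1 x)) ->
  lin B -> (forall k v, B (A k.+1 v) = A k.+1 (B v)) ->
  B (exps A j v) = exps A j (B v).
Proof.
move=> Al AC Bl BA.
rewrite (@exps_derivation _ _ char0 A Al AC B 1 0) ?scale0r ?addr0 // => k w.
by rewrite BA if_same scale0r addr0.
Qed.

Lemma b_expm mu a n j v : n != 0 -> b a n (expm mu j v) =
  expm mu j (b a n v) + (if 0 < n then g a * mu a else 0) *: expm mu (j - n) v.
Proof.
case: n => [[|n]|n] // _; last first.
  rewrite /= scale0r addr0; apply: exps_commute => [k|k l x||k w].
  - exact: cre_lin.
  - exact: cre_comm.
  - exact: bl.
  - by rewrite b_cre; case: eqP => [|_]; [lia | rewrite scale0r addr0].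
rewrite /=; apply: (exps_derivation char0 (cre_lin mu)) => // [k l x|k w].
- exact: cre_comm.
- by rewrite b_cre eqz_nat eq_sym.
Qed.

Lemma b_expp mu a n j v : n != 0 -> b a n (expp mu j v) =
  expp mu j (b a n v) + (if n < 0 then g a * mu a else 0) *: expp mu (j + n) v.
Proof.
case: n => [[|n]|n] // _.
  rewrite /= scale0r addr0; apply: exps_commute => [k|k l x||k w].
  - exact: ann_lin.
  - exact: ann_comm.
  - exact: bl.
  - by rewrite b_ann; case: eqP => [|_]; [lia | rewrite scale0r addr0].
rewrite /= NegzE; apply: (exps_derivation char0 (ann_lin mu)) => // [k l x|k w].
- exact: ann_comm.
- by rewrite b_ann eqr_opp eqz_nat eq_sym.
Qed.

Lemma ann_vac mu k gam : ann mu k.+1 (vec gam m1) = 0.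
Proof. by rewrite /ann big1 // => a _; rewrite (fs_vac F) scaler0. Qed.

Lemma expp_vac mu j gam :
  expp mu j (vec gam m1) = if j == 0 then vec gam m1 else 0.
Proof.
apply: (exps_fixed char0 (ann_lin mu)) => [k l x|k]; last exact: ann_vac.
exact: ann_comm.
Qed.

Lemma expp_trunc mu x : exists N : int, forall n : int, N <= n -> expp mu n x = 0.
Proof.
apply: (fs_trunc F) => [n|gam m]; first exact: expp_lin.
move: m; apply: (fs_ind F) => [|a k m [N hN]].
  by exists 1 => n n1; rewrite expp_vac; case: eqP => // n0; lia.
(* A creation mode of index $-k-1$ commutes with the exponential up to a shift of the exponent by
   $k+1$. *)
exists (N + k.+1%:Z) => n nN; rewrite -(fs_neg F).
have := @b_expp mu a (Negz k) n (vec gam m) isT.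
rewrite hN ?hN ?(lin0 (bl _ _)) ?scaler0 ?addr0 //; lia.
Qed.

(** The coefficient of $z^d$ in the product of the creation and annihilation exponentials, that is,
    $V_\mu(z)$ without the charge shift and the power of $z$ from the zero modes. *)
Definition dressed mu (d : int) x : X :=
  fsum (fun i : nat => expm mu (d + i%:Z) (expp mu i x)).

Lemma dressed_fin mu d (h : nat -> int -> X -> X) x :
  (forall i e, lin (h i e)) -> fin (fun i : nat => h i d (expp mu i x)).
Proof.
move=> hl; have [N hN] := expp_trunc mu x; exists `|N|%N => i iN.
by rewrite hN ?(lin0 (hl _ _)) //; lia.
Qed.

Lemma dressed_lin mu d : lin (dressed mu d).
Proof.
apply: (lin_fsum_fun (F := fun (i : nat) x => expm mu (d + i%:Z) (expp mu i x))).
  by move=> i; exact: lin_comp (expm_lin _ _) (expp_lin _ _).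
by move=> x; exact: (@dressed_fin mu d (fun i d => expm mu (d + i%:Z))
  x (fun _ _ => expm_lin _ _)).
Qed.

Lemma fsum_shift (f : nat -> X) k : fin f -> (forall i, (i < k)%N -> f i = 0) ->
  fsum f = fsum (fun i => f (i + k)%N).
Proof.
elim: k f => [|k IH] f ff f0; first by apply: eq_fsum => i; rewrite addn0.
rewrite fsumS // f0 // add0r IH; [ | exact: finS | by move=> i ik; apply: f0].
by apply: eq_fsum => i; rewrite addnS.
Qed.

(** Positive modes meet only the creation exponential, negative ones only the other, yet both give
    the same commutator, a multiple of $z^n$ times the operator. *)
Lemma b_dressed mu a n d x : n != 0 -> b a n (dressed mu d x) =
  dressed mu d (b a n x) + (g a * mu a) *: dressed mu (d - n) x.
Proof.
move=> n0; have fd d' y := @dressed_fin mu d' (fun i e => expm mu (e + i%:Z)) y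
  (fun _ _ => expm_lin _ _).
rewrite /dressed (lin_fsum (bl a n) (fd d x)) -(fsumZ _ (fd (d - n) x)).
case: n n0 => [[|n]|n] // n0.
  rewrite -(fsumD (fd d (b a n.+1 x)) (fin_scale _ (fd (d - n.+1%:Z) x))).
  apply: eq_fsum => i; rewrite b_expm // b_expp //= scale0r addr0.
  by congr (_ + _ *: expm mu _ _); lia.
have f' : fin (fun i : nat => (g a * mu a) *: expm mu (d + i%:Z) (expp mu (i%:Z + Negz n) x)).
  have [N hN] := expp_trunc mu x; exists `|(N + n.+1%:Z)%R|%N => i iN.
  by rewrite hN ?(lin0 (expm_lin _ _)) ?scaler0 //; lia.
transitivity (fsum (fun i : nat => expm mu (d + i%:Z) (expp mu i (b a (Negz n) x))
    + (g a * mu a) *: expm mu (d + i%:Z) (expp mu (i%:Z + Negz n) x))).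
  apply: eq_fsum => i; rewrite b_expm // b_expp //= scale0r addr0.
  by rewrite (linD (expm_lin _ _)) (linZ (expm_lin _ _)).
rewrite (fsumD (fd d (b a (Negz n) x)) f'); congr (_ + _).
(* The first $n+1$ terms have a negative exponent in [expp] and vanish. *)
rewrite (fsum_shift (k := n.+1) f') => [|i ik].
  by apply: eq_fsum => i; congr (_ *: expm mu _ (expp mu _ x)); lia.
by rewrite [expp _ _ _]exps_neg ?(lin0 (expm_lin _ _)) ?scaler0 //; lia.
Qed.

End FockTheory.

Lemma iter_diff2_map (K : fieldType) (X Z : lmodType K) N (f : X -> Z)
    (F : int -> int -> X) : lin f ->
  iter N (@diff2 K Z) (fun m n => f (F m n))
    = fun m n => f (iter N (@diff2 K X) F m n).
Proof.
move=> fl; elim: N => // N IH; rewrite !iterS IH.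
by apply/funext => m; apply/funext => n; rewrite /diff2 (linB fl).
Qed.

(** * Vertex operators *)

Section Beta.
Variable K : fieldType.
Hypothesis char0 : forall n, n.+1%:R != 0 :> K.
Implicit Types S : K.

(* The coefficients of (1 - z)^S. *)
Fixpoint beta S n : K :=
  if n is n'.+1 then (n'%:R - S) / n'.+1%:R * beta S n' else 1.

Definition betaz S (i : int) : K := if i is Posz n then beta S n else 0.

(** The recursion of $\exp(-S\sum_k z^k/k)$, the form in which $(1-z)^S$ arises when two vertex
    operators are multiplied. *)
Lemma beta_sum S n : - S * (\sum_(k < n.+1) beta S k) = n.+1%:R * beta S n.+1.
Proof.
elim: n => [|n IH]; first by rewrite big_ord1 /= sub0r !mulr1 divr1 mul1r.
rewrite big_ord_recr mulrDr IH -mulrDl.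
rewrite -[beta S n.+2]/((n.+1%:R - S) / n.+2%:R * beta S n.+1) [RHS]mulrA.
by rewrite [n.+2%:R * _]mulrC divfK ?char0.
Qed.

Lemma beta_pascal S n : beta (S + 1) n.+1 = beta S n.+1 - beta S n.
Proof.
elim: n => [|n IH]; first by rewrite /= !divr1 !mulr1; ring.
rewrite -[LHS]/((n.+1%:R - (S + 1)) / n.+2%:R * beta (S + 1) n.+1) IH.
rewrite -[beta S n.+2]/((n.+1%:R - S) / n.+2%:R * beta S n.+1).
rewrite -[beta S n.+1]/((n%:R - S) / n.+1%:R * beta S n).
have := char0 n; have := char0 n.+1.
move: (beta S n) => x; rewrite -!natr1 => h1 h2; field.
by rewrite h1 h2.
Qed.

Lemma betaz_pascal S i : betaz (S + 1) i = betaz S i - betaz S (i - 1).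
Proof.
case: i => [[|n]|n]; first by rewrite /= subr0.
  rewrite (_ : n.+1%:Z - 1 = n); last by lia.
  exact: beta_pascal.
by rewrite /= subrr.
Qed.

Lemma beta0 n : beta 0 n.+1 = 0.
Proof.
elim: n => [|n IH]; first by rewrite /= subr0 !mul0r.
by rewrite -[LHS]/((n.+1%:R - 0) / n.+2%:R * beta 0 n.+1) IH mulr0.
Qed.

Lemma betaz0 i : betaz 0 i = (i == 0)%:R.
Proof. by case: i => [[|n]|n] //=; exact: beta0. Qed.

(* The difference of the expansions of (z - w)^S in |z| > |w| and |w| > |z|. *)
Definition expansion_diff (S P Q : int) : K^o :=
  if P + Q == S then betaz S%:~R Q - (-1) ^+ `|S| * betaz S%:~R P else 0.

(** $(z-w)(z-w)^S=(z-w)^{S+1}$ in both expansions, by [betaz_pascal]. *)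
Lemma expansion_diff_rec (S a b : int) N :
  iter N (@diff2 K K^o) (fun p q => expansion_diff S (a - p) (b - q))
    = fun p q => expansion_diff (S + N%:Z) (a - p) (b - q).
Proof.
elim: N => [|N IH]; first by rewrite addr0.
rewrite iterS IH; apply/funext => p; apply/funext => q.
rewrite /diff2 /expansion_diff.
have -> : S + N.+1%:Z = S + N%:Z + 1 by lia.
move: (S + N%:Z) => S'.
have e1 : (a - (p + 1) + (b - q) == S') = (a - p + (b - q) == S' + 1).
  by apply/eqP/eqP; lia.
have e2 : (a - p + (b - (q + 1)) == S') = (a - p + (b - q) == S' + 1).
  by apply/eqP/eqP; lia.
rewrite e1 e2; case: eqP => _; last by rewrite subr0.
rewrite intrD !betaz_pascal.
have -> : a - (p + 1) = a - p - 1 by lia.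
have -> : b - (q + 1) = b - q - 1 by lia.
have -> : (-1) ^+ `|S' + 1| = - (-1) ^+ `|S'| :> K.
  rewrite -signr_odd -[in RHS]signr_odd.
  have -> : odd `|S' + 1| = ~~ odd `|S'| by lia.
  by case: (odd _); rewrite ?expr0 ?expr1 ?opprK.
move: (betaz _ _) (betaz _ _) (betaz _ _) (betaz _ _) (_ ^+ _) => x1 x2 x3 x4 x5.
by rewrite /GRing.scale /=; ring.
Qed.

Lemma expansion_diff0 : expansion_diff 0 = fun _ _ => 0.
Proof.
apply/funext => P; apply/funext => Q; rewrite /expansion_diff.
case: eqP => // PQ; rewrite expr0 mul1r !betaz0.
have -> : (P == 0) = (Q == 0) by apply/eqP/eqP; lia.
by rewrite subrr.
Qed.

Lemma expansion_diff_local (S : int) : exists N, forall a b : int,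
  iter N (@diff2 K K^o) (fun p q => expansion_diff S (a - p) (b - q))
    = fun _ _ => 0.
Proof.
(* A pole is cleared by reaching exponent 0, where the expansions agree. For $S\ge0$ they agree
   already: their difference is $(z-w)^S$ times the one for exponent 0. *)
exists (if S is Negz n then n.+1 else 0%N) => a b.
rewrite expansion_diff_rec; case: S => n.
  rewrite addr0; have /= <- := @iter_diff2_0 K K^o n.
  have -> : (fun p q => expansion_diff n (a - p) (b - q)) = 
     iter n (@diff2 K K^o) (fun p q => expansion_diff 0 (a - p) (b - q)).
    by rewrite expansion_diff_rec add0r.
  by rewrite expansion_diff0.
by rewrite NegzE addNr expansion_diff0.
Qed.

End Beta.

Lemma intpartE (K : fieldType) (n : int) : (forall n, n.+1%:R != 0 :> K) ->
  intpart (n%:~R : K) = n.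
Proof.
move=> char0; rewrite /intpart; case: xgetP => [m _ /= E|H]; last by case: (H n).
have inj (k : int) : k%:~R = 0 :> K -> k = 0.
  case: k => [[|k]|k] // k0; have := char0 k; last rewrite -oppr_eq0.
    by rewrite -[k.+1%:R]/(k.+1%:Z%:~R) k0 eqxx.
  by rewrite -[- _]/((Negz k)%:~R) k0 eqxx.
by apply/eqP; rewrite -subr_eq0; apply/eqP/inj; rewrite intrB E subrr.
Qed.

Section VertexOperators.
Variables (K : fieldType) (I : finType) (g : I -> K) (L : zmodType)
  (mom : L -> I -> K) (M : Type) (m1 : M) (mx : I -> nat -> M -> M)
  (X : lmodType K) (vec : L -> M -> X) (coef : L -> M -> X -> K)
  (b : I -> int -> X -> X) (sh : L -> X -> X) (dg : (L -> K) -> X -> X)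
  (V : (I -> K) -> L -> int -> X -> X).
Hypothesis F : fock_space g mom m1 mx vec coef b sh dg.

Local Notation h mu gam := (intpart (pairing g mu (mom gam))).

Hypothesis Vl : forall mu s e, lin (V mu s e).
Hypothesis V_vec : forall mu s e gam m,
  V mu s e (vec gam m) = sh s (dressed b mu (e - h mu gam) (vec gam m)).

Let char0 := fs_char F.
Let bl := fs_b_lin F.
Local Notation pr gam := (fun gam' : L => (gam' == gam)%:R : K).

Lemma dg_sh f s x : dg f (sh s x) = sh s (dg (fun gam => f (gam + s)) x).
Proof.
apply: (fs_ext F (lin_comp (fs_dg_lin F _) (fs_sh_lin F _))
  (lin_comp (fs_sh_lin F _) (fs_dg_lin F _))) => gam m.
by rewrite (fs_sh F) !(fs_dg F) (linZ (fs_sh_lin F s)) (fs_sh F).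
Qed.

Lemma dg_dg f f' x : dg f (dg f' x) = dg (fun gam => f gam * f' gam) x.
Proof.
apply: (fs_ext F (lin_comp (fs_dg_lin F _) (fs_dg_lin F _)) (fs_dg_lin F _)) => gam m.
by rewrite !(fs_dg F) (linZ (fs_dg_lin F f)) (fs_dg F) scalerA mulrC.
Qed.

Lemma dgD f f' x : dg (fun gam => f gam + f' gam) x = dg f x + dg f' x.
Proof.
apply: (fs_ext F (fs_dg_lin F _) (lin_add (fs_dg_lin F _) (fs_dg_lin F _))) => gam m.
by rewrite !(fs_dg F) scalerDl.
Qed.

Lemma dgc c x : dg (fun=> c) x = c *: x.
Proof.
apply: (fs_ext F (fs_dg_lin F _) (lin_scale c (@lin_id _ _))) => gam m.
exact: (fs_dg F).
Qed.

Lemma dg_exp (A : (I -> K) -> nat -> X -> X) f mu j x :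
  (A = cre b \/ A = ann b) -> dg f (exps (A mu) j x) = exps (A mu) j (dg f x).
Proof.
case=> [->|->]; apply: (exps_commute F) => //.
- exact: (cre_lin F mu).
- exact: (cre_comm F mu mu).
- exact: (fs_dg_lin F f).
- move=> k v; rewrite !creE (lin_sum (fs_dg_lin F f)); apply: eq_bigr => a _.
  by rewrite (linZ (fs_dg_lin F f)) (fs_dg_b F).
- exact: (ann_lin F mu).
- exact: (ann_comm F mu mu).
- exact: (fs_dg_lin F f).
- move=> k v; rewrite !annE (lin_sum (fs_dg_lin F f)); apply: eq_bigr => a _.
  by rewrite (linZ (fs_dg_lin F f)) (fs_dg_b F).
Qed.

Lemma dg_dressed f mu d x : dg f (dressed b mu d x) = dressed b mu d (dg f x).
Proof.
rewrite /dressed (lin_fsum (fs_dg_lin F f)).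
  apply: eq_fsum => i.
  by rewrite (@dg_exp (@cre _ _ _ b)); [rewrite (@dg_exp (@ann _ _ _ b)) //; right | left].
exact: (@dressed_fin _ _ _ _ _ _ _ _ _ _ _ _ _ _ F mu d
  (fun i d => expm b mu (d + i%:Z)) x (fun _ _ => expm_lin F _ _)).
Qed.

(** The power of $z$ contributed by the zero modes depends on the charge only, so that [V_vec]
    extends from basis vectors to everything of charge [gam]. *)
Lemma V_charge mu s e gam y : dg (pr gam) y = y ->
  V mu s e y = sh s (dressed b mu (e - h mu gam) y).
Proof.
move=> <-; apply: (fs_ext F (lin_comp (Vl _ _ _) (fs_dg_lin F _))
  (lin_comp (lin_comp (fs_sh_lin F _) (dressed_lin F _ _)) (fs_dg_lin F _))).
move=> gam' m; rewrite (fs_dg F) (linZ (Vl _ _ _)) V_vec.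
rewrite (linZ (dressed_lin F _ _)) (linZ (fs_sh_lin F _)).
by case: eqP => [->//|_]; rewrite !scale0r.
Qed.

Lemma pr_vec gam m : dg (pr gam) (vec gam m) = vec gam m.
Proof. by rewrite (fs_dg F) eqxx scale1r. Qed.

Lemma V_b mu s e a n x : n != 0 -> b a n (V mu s e x) =
  V mu s e (b a n x) + (g a * mu a) *: V mu s (e - n) x.
Proof.
move=> n0; apply: (fs_ext F (lin_comp (bl _ _) (Vl _ _ _))
  (lin_add (lin_comp (Vl _ _ _) (bl _ _)) (lin_scale _ (Vl _ _ _)))) => gam m.
rewrite !V_vec (fs_sh_b F) // (b_dressed F) // (linD (fs_sh_lin F _)).
rewrite (linZ (fs_sh_lin F _)) (@V_charge mu s e gam); last first.
  by rewrite -(fs_dg_b F) pr_vec.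
by rewrite [e - n - _]addrAC.
Qed.

Lemma V_dg f mu s e x : dg f (V mu s e x) = V mu s e (dg (fun gam => f (gam + s)) x).
Proof.
apply: (fs_ext F (lin_comp (fs_dg_lin F _) (Vl _ _ _))
  (lin_comp (Vl _ _ _) (fs_dg_lin F _))) => gam m.
by rewrite (fs_dg F) (linZ (Vl _ _ _)) V_vec dg_sh dg_dressed (fs_dg F)
  (linZ (dressed_lin F _ _)) (linZ (fs_sh_lin F _)).
Qed.

Lemma V_b0 mu s e a x : b a 0 (V mu s e x) =
  V mu s e (b a 0 x) + (g a * mom s a) *: V mu s e x.
Proof.
rewrite !(fs_b0 F) V_dg (linZ (Vl _ _ _)) -scalerA -scalerDr; congr (_ *: _).
rewrite -(linZ (Vl _ _ _)) -(linD (Vl _ _ _)) -dgc -dgD; congr (V _ _ _ (dg _ _)).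
by apply/funext => gam; rewrite (fs_momD F).
Qed.

Lemma V_trunc mu s x : exists N : int, forall n : int, N <= n ->
  V mu s (- n - 1) x = 0.
Proof.
apply: (fs_trunc F (A := fun n x => V mu s (- n - 1) x)) => [n|gam m]; first exact: Vl.
have [N hN] := expp_trunc F mu (vec gam m).
exists (N - h mu gam) => n nN; rewrite V_vec /dressed fsum0 ?(lin0 (fs_sh_lin F s)) // => i.
have [Ni|iN] := leP N i%:Z; first by rewrite hN // (lin0 (expm_lin F _ _)).
by rewrite [expm _ _ _ _]exps_neg //; lia.
Qed.

(* The field of a charged vertex operator, weighted by a function of the charge
   on which it acts: c carries the cocycle signs, and may restrict the operator
   to some of the charges. *)
Definition vfield (c : L -> K) (s : L) (n : int) (x : X) : X :=
  V (mom s) s (- n - 1) (dg c x).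

Lemma vfield_lin c s n : lin (vfield c s n).
Proof. exact: lin_comp (Vl _ _ _) (fs_dg_lin F _). Qed.

Lemma vfield_field c s : is_field (vfield c s).
Proof.
split=> [n|x]; first exact: vfield_lin.
exact: V_trunc.
Qed.

Lemma b_field a : is_field (b a).
Proof. by split=> [n|x]; [exact: bl | exact: fs_b_trunc F a x]. Qed.

(** Zero modes see the charge shift [s] and the other modes see the momentum; for a charged field
    the two agree and all modes obey one formula. *)
Lemma b_vfield c s a n p x : b a n (vfield c s p x) =
  vfield c s p (b a n x) + (g a * mom s a) *: vfield c s (p + n) x.
Proof.
rewrite /vfield -(fs_dg_b F); have [->|n0] := eqVneq n 0.
  by rewrite addr0; exact: V_b0.
by rewrite V_b //; congr (_ + _ *: V _ _ _ _); lia.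
Qed.

Lemma dg_vfield f c s n x :
  dg f (vfield c s n x) = vfield c s n (dg (fun gam => f (gam + s)) x).
Proof.
rewrite /vfield V_dg !dg_dg; congr (V _ _ _ (dg _ _)).
by apply/funext => gam; rewrite mulrC.
Qed.

(* An operator is determined by its commutators with the b^a_n, n <> 0, and by
   its matrix coefficients between vacuum vectors. *)
Lemma rigidity (P : (X -> X) -> Prop) :
  (forall D, P D -> lin D) ->
  (forall D gam gam', P D -> coef gam' m1 (D (vec gam m1)) = 0) ->
  (forall D a n, P D -> n != 0 -> exists c1 D1 c2 D2, [/\ P D1, P D2 &
    forall x, b a n (D x) = D (b a n x) + c1 *: D1 x + c2 *: D2 x]) ->
  forall D, P D -> forall x, D x = 0.
Proof.
move=> Pl P0 Pb.
(* On vacuum vectors first, where annihilation modes reduce every coefficient to a vacuum one;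
   creation modes then reach all vectors. *)
have Pvac D gam : P D -> D (vec gam m1) = 0.
  move=> PD; apply: (fs_coef_ext F) => gam' m; move: m D PD.
  apply: (fs_ind F) => [D PD|a k m IH D PD]; first exact: P0.
  have [c c0 E] := fs_coef_pos F a k gam' m.
  apply: (mulfI c0); rewrite -E mulr0.
  have [c1 [D1 [c2 [D2 [P1 P2 E']]]]] := Pb D a k.+1 PD isT.
  rewrite E' (fs_vac F) (lin0 (Pl D PD)) add0r.
  have cl : lin (coef gam' m : X -> K^o) by exact: (fs_coef_lin F).
  by rewrite (linD cl) !(linZ cl) !IH // !scaler0 addr0.
move=> D PD; apply: (fs_ext F (Pl D PD) (@lin_zero _ _ _)) => gam m.
move: m D PD; apply: (fs_ind F) => [D|a k m IH D PD]; first exact: Pvac.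
rewrite -(fs_neg F).
have [c1 [D1 [c2 [D2 [P1 P2 E']]]]] := Pb D a (Negz k) PD isT.
have := E' (vec gam m).
rewrite (IH D PD) (IH D1 P1) (IH D2 P2) (lin0 (bl _ _)) !scaler0 !addr0.
by move=> <-.
Qed.

End VertexOperators.

(** * Vacuum matrix coefficients and locality of vertex operators *)

Section Correlations.
Variables (K : fieldType) (I : finType) (g : I -> K) (L : zmodType)
  (mom : L -> I -> K) (M : Type) (m1 : M) (mx : I -> nat -> M -> M)
  (X : lmodType K) (vec : L -> M -> X) (coef : L -> M -> X -> K)
  (b : I -> int -> X -> X) (sh : L -> X -> X) (dg : (L -> K) -> X -> X)
  (V : (I -> K) -> L -> int -> X -> X).
Hypothesis F : fock_space g mom m1 mx vec coef b sh dg.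

Local Notation h mu gam := (intpart (pairing g mu (mom gam))).

Hypothesis Vl : forall mu s e, lin (V mu s e).
Hypothesis V_vec : forall mu s e gam m,
  V mu s e (vec gam m) = sh s (dressed b mu (e - h mu gam) (vec gam m)).

Let char0 := fs_char F.
Let bl := fs_b_lin F.
Let shl := fs_sh_lin F.
Local Notation vf := (vfield mom dg V).
Local Notation e_ gam := (vec gam m1).
Local Notation coef1 gam x := (coef gam m1 x).

Lemma coef_lin gam m : lin (coef gam m : X -> K^o).
Proof. exact: (fs_coef_lin F). Qed.

Lemma fcoefZ gam m c x : coef gam m (c *: x) = c * coef gam m x.
Proof. exact: (linZ (coef_lin gam m)). Qed.

Lemma fcoef_sum gam m (T : Type) (r : seq T) (f : T -> X) :
  coef gam m (\sum_(i <- r) f i) = \sum_(i <- r) coef gam m (f i).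
Proof. exact: (lin_sum (coef_lin gam m)). Qed.

Lemma coef_cre gam mu k y : coef1 gam (cre b mu k.+1 y) = 0.
Proof.
rewrite creE fcoef_sum big1 // => a _.
by rewrite fcoefZ (_ : - k.+1%:Z = Negz k) // (fs_coef_neg F) mulr0.
Qed.

Lemma coef_expm gam mu j y :
  coef1 gam (expm b mu j y) = if j == 0 then coef1 gam y else 0.
Proof.
case: j => [[|j]|j]; first by rewrite /expm exps0.
  apply: (mulfI (char0 j)); rewrite mulr0 -fcoefZ.
  rewrite [_ *: _](@exps_rec _ _ char0 _ (cre_lin F mu) (cre_comm F mu mu)
    j.+1 j.+1%:Z y (lexx _)).
  by rewrite fcoef_sum big1 // => k _; rewrite fcoefZ coef_cre mulr0.
by rewrite (lin0 (coef_lin gam m1)).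
Qed.

Lemma coef_sh gam s y : coef1 gam (sh s y) = coef1 (gam - s) y.
Proof.
apply: (fs_ext F (Z := K^o) (lin_comp (coef_lin gam m1) (shl s)) (coef_lin (gam - s) m1)).
move=> gam' m; rewrite (fs_sh F); move: m; apply: (fs_ind F) => [|a k m _].
  by rewrite !(fs_coef_vec F) subr_eq.
by rewrite -!(fs_neg F) !(fs_coef_neg F).
Qed.

Lemma dressed_vac mu d gam : dressed b mu d (e_ gam) = expm b mu d (e_ gam).
Proof.
rewrite /dressed (@fsum_single _ _ 0%N) => [|i i0]; rewrite (expp_vac F).
  by rewrite addr0.
by rewrite eqz_nat (negPf i0) (lin0 (expm_lin F _ _)).
Qed.

Lemma coef_dressed gam mu d y :
  coef1 gam (dressed b mu d y) = coef1 gam (expp b mu (- d) y).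
Proof.
have fd := @dressed_fin _ _ _ _ _ _ _ _ _ _ _ _ _ _ F mu d
  (fun i d => expm b mu (d + i%:Z)) y (fun _ _ => expm_lin F _ _).
rewrite /dressed (lin_fsum (coef_lin gam m1) fd) /=.
case: (leP d 0) => d0.
  rewrite (@fsum_single _ _ `|d|%N) => [|i id].
    rewrite coef_expm; case: eqP => [_|]; last by lia.
    by rewrite (_ : `|d|%N%:Z = - d) //; lia.
  by rewrite coef_expm; case: eqP => // di; move/eqP: id; lia.
rewrite [expp _ _ _ _]exps_neg ?(lin0 (coef_lin gam m1)); last by lia.
by apply: fsum0 => i; rewrite coef_expm; case: eqP => //; lia.
Qed.

(** Modes of the outer exponential pass through the inner one to the vacuum, each leaving a scalar
    $-(\mu,\mu')/k$. This gives the recursion [beta_sum], hence the coefficients of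
    $(1-z)^{(\mu,\mu')}$. *)
Lemma coef_expp_expm gam gam' mu mu' i j :
  coef1 gam (expp b mu i (expm b mu' j (e_ gam'))) =
  if (gam == gam') && (i == j) then betaz (pairing g mu mu') i else 0.
Proof.
set S := pairing g mu mu'; case: i => [i|i]; last first.
  by rewrite (lin0 (coef_lin gam m1)) /= if_same.
have rec n q : n.+1%:R *: expp b mu n.+1 (expm b mu' q (e_ gam')) =
    (- S) *: \sum_(k < n.+1) expp b mu (n.+1%:Z - k.+1%:Z)
                               (expm b mu' (q - k.+1%:Z) (e_ gam')).
  rewrite [LHS](@exps_rec _ _ char0 _ (ann_lin F mu) (ann_comm F mu mu)
    n.+1 n.+1%:Z _ (lexx _)) scaler_sumr; apply: eq_bigr => k _.
  rewrite (exps_commute F _ _ (ann_lin F mu) (ann_comm F mu mu) (ann_lin F mu k.+1));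
    last by move=> k' v; exact: (ann_comm F).
  rewrite (exps_derivation char0 (cre_lin F mu') (cre_comm F mu' mu')
    (n := k.+1) (c := - S / k.+1%:R) (ann_lin F mu k.+1)) //; last first.
    by move=> k' v; rewrite (ann_cre F) eqSS.
  rewrite (ann_vac F) (lin0 (exps_lin (cre_lin F mu') _)) add0r.
  by rewrite (linZ (exps_lin (ann_lin F mu) _)) scalerA mulrC divfK ?char0.
elim/ltn_ind: i j => -[|i] IH j.
  rewrite [expp _ _ _ _]exps0 coef_expm (fs_coef_vec F) eq_sym /=.
  by rewrite [0 == j]eq_sym; case: eqP; case: eqP.
apply: (mulfI (char0 i)); rewrite -fcoefZ rec fcoefZ fcoef_sum.
under eq_bigr => k _.
  have kj := ltn_ord k; have -> : i.+1%:Z - k.+1%:Z = (i - k)%N%:Z by lia.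
  rewrite IH; last by rewrite ltnS leq_subr.
  have -> : (((i - k)%N%:Z == j - k.+1%:Z) = (i.+1%:Z == j)).
    by apply/eqP/eqP; lia.
  over.
case: ifP => _; last by rewrite big1 ?mulr0.
rewrite -(beta_sum char0) (reindex_inj rev_ord_inj) /=; congr (_ * _).
by apply: eq_bigr => k _; congr (beta _ _); have := ltn_ord k; lia.
Qed.

Lemma V_vac mu s e gam :
  V mu s e (e_ gam) = sh s (expm b mu (e - h mu gam) (e_ gam)).
Proof. by rewrite V_vec dressed_vac. Qed.

Lemma sh_expm s mu j x : sh s (expm b mu j x) = expm b mu j (sh s x).
Proof.
apply: (exps_commute F) => //; [exact: (cre_lin F mu)|exact: (cre_comm F mu mu)|].
move=> k v; rewrite !creE (lin_sum (shl s)); apply: eq_bigr => a _.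
by rewrite (linZ (shl s)) (fs_sh_b F).
Qed.

Lemma coef_V mu s e gam gam' :
  coef1 gam' (V mu s e (e_ gam)) = ((e == h mu gam) && (gam' == gam + s))%:R.
Proof.
rewrite V_vac coef_sh coef_expm (fs_coef_vec F) subr_eq0 subr_eq.
by case: eqP => _; case: eqP.
Qed.

Lemma coef_VV mu s e mu' s' e' gam gam' :
  coef1 gam' (V mu s e (V mu' s' e' (e_ gam))) =
  if (gam' == gam + s' + s) && (h mu (gam + s') - e == e' - h mu' gam)
  then betaz (pairing g mu mu') (e' - h mu' gam) else 0.
Proof.
rewrite V_vac sh_expm (fs_sh F) (@V_charge _ _ _ _ _ _ _ _ _ _ _ _ _ _ _ F Vl V_vec
  mu s e (gam + s')).
  rewrite coef_sh coef_dressed coef_expp_expm opprB subr_eq.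
  by case: ifP => // /andP[_ /eqP->].
by rewrite (dg_exp F) ?(pr_vec F) //; left.
Qed.

(* intpart is not a junk value on the charges on which c does not vanish. *)
Definition integral_on (c : L -> K) (s : L) := forall gam, c gam != 0 ->
  (h (mom s) gam)%:~R = pairing g (mom s) (mom gam).

Lemma pairingDr mu nu nu' : pairing g mu (fun a => nu a + nu' a) =
  pairing g mu nu + pairing g mu nu'.
Proof.
by rewrite /pairing -big_split; apply: eq_bigr => a _; rewrite mulrDr.
Qed.

Lemma pairing_mom mu gam gam' : pairing g mu (mom (gam + gam')) =
  pairing g mu (mom gam) + pairing g mu (mom gam').
Proof.
by rewrite -pairingDr; apply: eq_bigr => a _; rewrite (fs_momD F).
Qed.

Lemma pairingC mu nu : pairing g mu nu = pairing g nu mu.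
Proof. by apply: eq_bigr => a _; ring. Qed.

Lemma intpartD mu gam gam' (n m : int) : pairing g mu (mom gam) = n%:~R ->
  pairing g mu (mom gam') = m%:~R ->
  h mu (gam + gam') = n + m.
Proof. by move=> E E'; rewrite pairing_mom E E' -intrD intpartE. Qed.

Lemma coef_vfield c s n gam gam' : coef1 gam' (vf c s n (e_ gam)) =
  if (gam' == gam + s) && (- n - 1 == h (mom s) gam) then c gam else 0.
Proof.
rewrite /vfield (fs_dg F) (linZ (Vl _ _ _)) fcoefZ coef_V.
by case: eqP; case: eqP; rewrite ?mulr1 ?mulr0.
Qed.

Lemma coef_vfield2 c s m c' s' n gam gam' :
  coef1 gam' (vf c s m (vf c' s' n (e_ gam))) = (c (gam + s') * c' gam) *
    if (gam' == gam + s' + s) &&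
       (h (mom s) (gam + s') - (- m - 1) == - n - 1 - h (mom s') gam)
    then betaz (pairing g (mom s) (mom s')) (- n - 1 - h (mom s') gam) else 0.
Proof.
rewrite /vfield (fs_dg F) (linZ (Vl _ _ _)) (linZ (fs_dg_lin F _)).
rewrite (V_dg F Vl V_vec) (fs_dg F) !(linZ (Vl _ _ _)) scalerA fcoefZ coef_VV.
by rewrite [c' _ * _]mulrC.
Qed.

(** By [rigidity] only vacuum coefficients have to be compared. The condition on the weights makes
    the two orders of the fields the two expansions of one function, whose difference is
    [expansion_diff]. *)
Lemma vfield_local e c s c' s' (S : int) : e * e = 1 ->
  integral_on c s -> integral_on c' s' ->
  pairing g (mom s) (mom s') = S%:~R ->
  (forall gam, c (gam + s') * c' gam
     = e * (-1) ^+ `|S| * (c' (gam + s) * c gam)) ->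
  local e (vf c s) (vf c' s').
Proof.
move=> ee ic ic' SE cc'.
have [N hN] := expansion_diff_local char0 S.
exists N => x; apply/funext => p; apply/funext => q.
(* All modes together: a commutator with a Heisenberg mode shifts one of the two indices, so that
   only the whole family is stable. *)
pose P D := exists p q,
  D = fun x => iter N (@diff2 K X) (scomm e (vf c s) (vf c' s') x) p q.
have vl c0 s0 n : lin (vf c0 s0 n) by exact: (vfield_lin F Vl).
have scl p0 q0 : lin (fun x => scomm e (vf c s) (vf c' s') x p0 q0).
  by apply: lin_sub; [exact: lin_comp (vl _ _ _) (vl _ _ _)
    | exact: lin_scale (lin_comp (vl _ _ _) (vl _ _ _))].
suff: forall D, P D -> forall x, D x = 0.
  by move=> /(_ _ (ex_intro _ p (ex_intro _ q erefl))); apply.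
apply: (rigidity F) => [D [p0 [q0 ->]]|D gam gam' [p0 [q0 ->]]|D a n [p0 [q0 ->]] n0].
- elim: N {hN P} p0 q0 => [|N IH] p0 q0; first exact: scl.
  exact: lin_sub (IH _ _) (IH _ _).
- have := congr1 (fun f => f p0 q0) (iter_diff2_map N
    (scomm e (vf c s) (vf c' s') (e_ gam)) (coef_lin gam' m1)).
  move=> /= <-.
  set w := c (gam + s') * c' gam.
  (* Mode [m] belongs to $z^{-m-1}$; removing the power of $z$ due to the initial charge leaves the
     exponent in $(z-w)^S$, and likewise for $w$. *)
  have -> : (fun m n => coef1 gam' (scomm e (vf c s) (vf c' s') (e_ gam) m n)) =
      fun m n => (if gam' == gam + s + s' then w else 0) *:
        expansion_diff K S (- 1 - h (mom s) gam - m) (- 1 - h (mom s') gam - n).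
    apply/funext => m; apply/funext => n; rewrite /scomm.
    rewrite (linB (coef_lin gam' m1)) fcoefZ !coef_vfield2 (pairingC (mom s') (mom s)) SE -/w.
    set w' := c' (gam + s) * c gam.
    have ww' : e * w' = (-1) ^+ `|S| * w.
      rewrite /w cc' -/w' mulrA [_ * (e * _)]mulrCA -exprD addnn -mul2n exprM.
      by rewrite sqrrN !expr1n mulr1.
    rewrite [_ *: _]/GRing.scale /= mulrA ww' [gam + s' + s]addrAC.
    (* For zero weight there is nothing to prove; otherwise all four weights are nonzero and
       [intpart] is evaluated at integers only. *)
    have [w0|w0] := eqVneq w 0; first by rewrite w0 !(mulr0, mul0r) if_same mul0r subrr.
    have [c'0 cs'0] : c' gam != 0 /\ c (gam + s') != 0.
      by move: w0; rewrite /w mulf_eq0 negb_or => /andP[].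
    have [c0 c's0] : c gam != 0 /\ c' (gam + s) != 0.
      move: w0; rewrite /w cc' mulf_eq0 negb_or => /andP[_].
      by rewrite mulf_eq0 negb_or => /andP[].
    rewrite (intpartD (esym (ic _ c0)) SE).
    rewrite (intpartD (esym (ic' _ c'0)) (etrans (pairingC _ _) SE)).
    rewrite /expansion_diff; case: (gam' == _); last by rewrite !(mulr0, mul0r) subrr.
    set P' := - 1 - _ - m; set Q' := - 1 - _ - n.
    have -> : - n - 1 - h (mom s') gam = Q' by rewrite /Q'; lia.
    have -> : - m - 1 - h (mom s) gam = P' by rewrite /P'; lia.
    have -> : (h (mom s) gam + S - (- m - 1) == Q') = (P' + Q' == S).
      by rewrite /P'; apply/eqP/eqP; lia.
    have -> : (h (mom s') gam + S - (- n - 1) == P') = (P' + Q' == S).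
      by rewrite /Q'; apply/eqP/eqP; lia.
    rewrite /=; case: ifP => _; last by rewrite !mulr0 subrr.
    by rewrite mulrBr [w * (_ * _)]mulrCA !mulrA.
  rewrite (iter_diff2_lin _ _ (lin_scale _ (@lin_id _ K^o))) hN.
  by rewrite scaler0.
- have shift1 (G : int -> int -> X) u m k :
      iter N (@diff2 K X) (fun m k => G (m + u) k) m k =
      iter N (@diff2 K X) G (m + u) k.
    by elim: N {hN P} m k => // N IH m k; rewrite !iterS /diff2 !IH addrAC.
  have shift2 (G : int -> int -> X) u m k :
      iter N (@diff2 K X) (fun m k => G m (k + u)) m k =
      iter N (@diff2 K X) G m (k + u).
    by elim: N {hN P shift1} m k => // N IH m k; rewrite !iterS /diff2 !IH [k + 1 + u]addrAC.
  exists (g a * mom s a), (fun x => iter N (@diff2 K X) (scomm e (vf c s) (vf c' s') x) (p0 + n) q0).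
  exists (g a * mom s' a), (fun x => iter N (@diff2 K X) (scomm e (vf c s) (vf c' s') x) p0 (q0 + n)).
  split; [by exists (p0 + n), q0 | by exists p0, (q0 + n) | move=> y].
  have E m k : b a n (scomm e (vf c s) (vf c' s') y m k) =
      scomm e (vf c s) (vf c' s') (b a n y) m k
      + (g a * mom s a) *: scomm e (vf c s) (vf c' s') y (m + n) k
      + (g a * mom s' a) *: scomm e (vf c s) (vf c' s') y m (k + n).
    rewrite /scomm (linB (bl _ _)) (linZ (bl _ _)) !(b_vfield F Vl V_vec).
    rewrite !(linD (vl _ _ _)) !(linZ (vl _ _ _)).
    move: (vf _ _ _ _) (vf _ _ _ _) (vf _ _ _ _) (vf _ _ _ _) (vf _ _ _ _) (vf _ _ _ _).
    move=> x1 x2 x3 x4 x5 x6.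
    have [Lc [LD LN LZ Lv]] := formal_comb [:: x1; x2; x3; x4; x5; x6].
    rewrite (Lv 0%N isT : x1 = _) (Lv 1%N isT : x2 = _) (Lv 2%N isT : x3 = _).
    rewrite (Lv 3%N isT : x4 = _) (Lv 4%N isT : x5 = _) (Lv 5%N isT : x6 = _).
    by rewrite ?(LZ, =^~ LD, =^~ LN); congr Lc; ring.
  have /= <- := congr1 (fun f => f p0 q0) (iter_diff2_lin N
    (scomm e (vf c s) (vf c' s') y) (bl a n)).
  under eq_fun do under eq_fun do rewrite E.
  move: (scomm _ _ _ y) (scomm _ _ _ (b a n y)) => G1 G2.
  rewrite !iter_diff2D !(iter_diff2_lin _ _ (lin_scale _ (@lin_id _ X))).
  by rewrite shift1 shift2.
Qed.

End Correlations.

(** * Translation operator and fields of states *)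

Section StateFields.
Variables (K : fieldType) (I : finType) (g : I -> K) (L : zmodType)
  (mom : L -> I -> K) (M : Type) (m1 : M) (mx : I -> nat -> M -> M)
  (X : lmodType K) (vec : L -> M -> X) (coef : L -> M -> X -> K)
  (b : I -> int -> X -> X) (sh : L -> X -> X) (dg : (L -> K) -> X -> X)
  (V : (I -> K) -> L -> int -> X -> X).
Hypothesis F : fock_space g mom m1 mx vec coef b sh dg.

Local Notation h mu gam := (intpart (pairing g mu (mom gam))).

Hypothesis Vl : forall mu s e, lin (V mu s e).
Hypothesis V_vec : forall mu s e gam m,
  V mu s e (vec gam m) = sh s (dressed b mu (e - h mu gam) (vec gam m)).

Let char0 := fs_char F.
Let bl := fs_b_lin F.
Local Notation vf := (vfield mom dg V).

Lemma b_local a c : local 1 (b a) (b c).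
Proof.
exists 2%N => x; apply/funext => m; apply/funext => n.
have E : scomm 1 (b a) (b c) x = fun m n =>
    (if (a == c) && (m + n == 0) then m%:~R * g a else 0) *: x.
  apply/funext => p; apply/funext => q.
  by rewrite /scomm scale1r (fs_comm F) addrAC subrr add0r.
rewrite !iterS /= E /diff2.
have e1 : (m + 1 + 1 + n == 0) = (m + (n + 1 + 1) == 0) by apply/eqP/eqP; lia.
have e2 : (m + 1 + (n + 1) == 0) = (m + (n + 1 + 1) == 0) by apply/eqP/eqP; lia.
rewrite e1 e2; case: (_ && _); last by rewrite !scale0r !subrr.
by rewrite -!scalerBl -!mulrBl !intrD -[RHS](scale0r x); congr (_ *: _); ring.
Qed.

Lemma b_vfield_local a c s : local 1 (b a) (vf c s).
Proof.
exists 1%N => x; apply/funext => m; apply/funext => n.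
have E : scomm 1 (b a) (vf c s) x = fun m n =>
    (g a * mom s a) *: vf c s (n + m) x.
  apply/funext => p; apply/funext => q.
  by rewrite /scomm scale1r (b_vfield F Vl V_vec) addrAC subrr add0r.
rewrite /= E /diff2; have -> : n + 1 + m = n + (m + 1) by lia.
by rewrite subrr.
Qed.

(* The Sugawara form of the translation operator. *)
Definition transl x :=
  \sum_a (g a)^-1 *: fsum (fun k : nat => b a (Negz k) (b a k x)).

Lemma transl_fin a x : fin (fun k : nat => b a (Negz k) (b a k x)).
Proof.
have [N hN] := fs_b_trunc F a x; exists `|N|%N => k kN.
by rewrite hN ?(lin0 (bl _ _)) //; lia.
Qed.

Lemma transl_lin : lin transl.
Proof.
apply: lin_bigsum => a; apply: lin_scale.
apply: (lin_fsum_fun (F := fun (k : nat) x => b a (Negz k) (b a k x))).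
  by move=> k; exact: lin_comp (bl _ _) (bl _ _).
exact: transl_fin.
Qed.

Lemma transl_b c : covariant transl (b c).
Proof.
move=> n x; rewrite /transl (lin_sum (bl c n)).
rewrite [X in _ - X](_ : _ = \sum_a (if a == c then n%:~R *: b c (n - 1) x else 0));
  last by rewrite -big_mkcond big_pred1_eq.
rewrite -sumrB; apply: eq_bigr => a _; rewrite (linZ (bl c n)).
rewrite (lin_fsum (bl c n) (transl_fin a x)).
have E k : b a (Negz k) (b a k%:Z (b c n x)) = b c n (b a (Negz k) (b a k%:Z x)) +
    ((if (a == c) && (k%:Z + n == 0) then k%:R * g a else 0) *: b a (Negz k) x
     + (if (a == c) && (Negz k + n == 0) then (Negz k)%:~R * g a else 0) *: b a k x).
  rewrite (fs_comm F a c k%:Z n) (linD (bl _ _)) (linZ (bl _ _)).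
  by rewrite (fs_comm F a c (Negz k) n) -addrA [_ *: _ + _ *: _]addrC.
rewrite (eq_fsum E); case: eqP E => [<-|_] E; last first.
  rewrite subr0; congr (_ *: _); apply: eq_fsum => k /=.
  by rewrite !scale0r !addr0.
have [N hN] := fs_b_trunc F a x.
rewrite fsumD; first last.
- exists (maxn `|N| `|n|).+1 => k kN.
  rewrite ifF; last by apply/eqP; lia.
  rewrite ifF; last by apply/eqP; lia.
  by rewrite !scale0r addr0.
- exact: (fin_lin (bl a n) (transl_fin a x)).
rewrite scalerDr; congr (_ + _).
(* Exactly one [k] contributes: $k=-n$ if $n\le0$, through the right factor, and $k=n-1$ otherwise,
   through the left one. *)
case: (leP n 0) => n0.
  rewrite (@fsum_single _ _ `|n|%N) => [|k kn].
    rewrite ifT; last by apply/eqP; lia.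
    rewrite ifF; last by apply/eqP; lia.
    rewrite scale0r addr0 scalerA mulrC mulfK ?(fs_g F) //.
    rewrite -scaleNr; congr (_ *: b a _ x); last by lia.
    by rewrite -[_%:R]/(`|n|%N%:Z%:~R) -mulrNz; congr (_%:~R); lia.
  rewrite ifF; last by apply/eqP; lia.
  rewrite ifF; last by apply/eqP; lia.
  by rewrite !scale0r addr0.
rewrite (@fsum_single _ _ `|n - 1|%N) => [|k kn].
  rewrite ifF; last by apply/eqP; lia.
  rewrite ifT; last by apply/eqP; lia.
  rewrite scale0r add0r scalerA mulrC mulfK ?(fs_g F) //.
  rewrite -scaleNr -mulrNz; congr (_%:~R *: b a _ x); lia.
rewrite ifF; last by apply/eqP; lia.
rewrite ifF; last by apply/eqP; lia.
by rewrite !scale0r addr0.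
Qed.

Lemma transl_vac gam : transl (vec gam m1) = \sum_a mom gam a *: b a (-1) (vec gam m1).
Proof.
apply: eq_bigr => a _; rewrite (@fsum_single _ _ 0%N) => [|[|k] // _].
  rewrite (fs_b0 F) (fs_dg F) !(linZ (bl _ _)) !scalerA.
  by rewrite mulKf ?(fs_g F).
by rewrite (fs_vac F) (lin0 (bl _ _)).
Qed.

Lemma coef_transl gam x : coef gam m1 (transl x) = 0.
Proof.
rewrite (fcoef_sum F) big1 // => a _; rewrite (fcoefZ F).
rewrite (lin_fsum (coef_lin F gam m1) (transl_fin a x)) fsum0 ?mulr0 // => k.
exact: (fs_coef_neg F).
Qed.

(** By [rigidity] again: on a vacuum vector the translation operator gives the modes of index $-1$,
    and moving them to the left, where a vacuum coefficient kills them, leaves the pairing of the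
    charges. *)
Lemma transl_vfield c s : integral_on g mom c s -> covariant transl (vf c s).
Proof.
move=> ic p x; have vl n : lin (vf c s n) by exact: (vfield_lin F Vl).
pose D p x := transl (vf c s p x) - vf c s p (transl x) + p%:~R *: vf c s (p - 1) x.
suff: D p x = 0.
  by rewrite /D => /eqP; rewrite addr_eq0 subr_eq => /eqP->; rewrite addrC.
pose P E := exists p, E = D p.
have PD : P (D p) by exists p.
move: PD x; apply: (rigidity F) => [E [q ->]|E gam gam' [q ->]|E a n [q ->] n0].
- apply: lin_add; last exact: lin_scale (vl _).
  by apply: lin_sub; [exact: lin_comp transl_lin (vl _) | exact: lin_comp (vl _) transl_lin].
- rewrite /D; have cl := coef_lin F gam' m1.
  rewrite (linD cl) (linB cl) (linZ cl) coef_transl sub0r transl_vac.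
  rewrite (lin_sum (vl q)) (lin_sum cl).
  have -> : \sum_a coef gam' m1 (vf c s q (mom gam a *: b a (-1) (vec gam m1))) =
      - pairing g (mom s) (mom gam) * coef gam' m1 (vf c s (q - 1) (vec gam m1)).
    rewrite /pairing -sumrN mulr_suml; apply: eq_bigr => a _.
    rewrite (linZ (vl q)) (fcoefZ F).
    have := b_vfield F Vl V_vec c s a (Negz 0) q (vec gam m1).
    move=> /(congr1 (coef gam' m1 : X -> K^o)).
    rewrite (linD cl) (linZ cl) (fs_coef_neg F) => /esym/eqP.
    rewrite addr_eq0 => /eqP ->.
    by rewrite -[_ *: _]/(_ * _) ; ring.
  rewrite -[_ *: _]/(_ * _) mulNr opprK -mulrDl (coef_vfield F Vl V_vec).
  (* The coefficient is nonzero only for the mode at which the pairing cancels [q]. *)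
  case: ifP => [/andP[_ /eqP qh]|_]; last by rewrite mulr0.
  have [->|c0] := eqVneq (c gam) 0; first by rewrite mulr0.
  by rewrite -(ic _ c0) -qh -intrD (_ : _ + q = 0) ?mul0r //; lia.
- exists (g a * mom s a), (D (q + n)), 0, (D q).
  split; [by exists (q + n) | by exists q | move=> y].
  rewrite scale0r addr0 /D.
  have bT z : b a n (transl z) = transl (b a n z) + n%:~R *: b a (n - 1) z.
    by rewrite transl_b subrK.
  rewrite (linD (bl _ _)) (linB (bl _ _)) (linZ (bl _ _)) bT.
  rewrite !(b_vfield F Vl V_vec) bT (linD (vl _)) !(linD transl_lin).
  rewrite !(linZ transl_lin) !(linZ (vl _)).
  have -> : q + (n - 1) = q + n - 1 by lia.
  have -> : q - 1 + n = q + n - 1 by lia.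
  move: (transl (vf c s q (b a n y))) (transl (vf c s (q + n) y))
    (vf c s q (b a (n - 1) y)) (vf c s (q + n - 1) y) (vf c s q (transl (b a n y)))
    (vf c s (q + n) (transl y)) (vf c s (q - 1) (b a n y)).
  move=> x1 x2 x3 x4 x5 x6 x7.
  have [Lc [LD LN LZ Lv]] := formal_comb [:: x1; x2; x3; x4; x5; x6; x7].
  rewrite (Lv 0%N isT : x1 = _) (Lv 1%N isT : x2 = _) (Lv 2%N isT : x3 = _).
  rewrite (Lv 3%N isT : x4 = _) (Lv 4%N isT : x5 = _) (Lv 5%N isT : x6 = _).
  rewrite (Lv 6%N isT : x7 = _).
  by rewrite ?(LZ, =^~ LD, =^~ LN) intrD; congr Lc; ring.
Qed.

(** The $(-k-1)$-st product with $b^a$ is the normally ordered product with the $k$-th divided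
    derivative of $b^a(z)$, so that Dong's lemma covers all fields of states. *)
Definition sfield (c : L -> K) (s : L) (l : seq (I * nat)) : int -> X -> X :=
  foldr (fun x A => nprod 1 x.2.+1 (b x.1) A) (vf c s) l.

Lemma sfield_field c s l : is_field (sfield c s l).
Proof.
elim: l => [|x l IH]; first exact: (vfield_field F Vl V_vec).
by apply: nprod_field; [exact: (b_field F) | exact: IH].
Qed.

Lemma b_sfield_local a c s l : local 1 (b a) (sfield c s l).
Proof.
have swap A B : local 1 A B -> local 1 B A.
  by apply: local_sym; rewrite mulr1.
apply: (swap _ _); elim: l a => [|x l IH] a; first by apply: (swap _ _); exact: b_vfield_local.
rewrite -[1]mulr1; apply: dong; [exact: (b_field F) | exact: sfield_field
  | exact: (b_field F) | by apply: (swap _ _); exact: IH | exact: b_local | exact: IH].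
Qed.

Lemma sfield_local_gen e c s l C : is_field C ->
  (forall a, local 1 (b a) C) -> local e (vf c s) C -> local e (sfield c s l) C.
Proof.
move=> Cf bC vC; elim: l => [|x l IH] //.
rewrite -[e]mul1r; apply: dong; [exact: (b_field F) | exact: sfield_field
  | exact: Cf | exact: b_sfield_local | exact: bC | exact: IH].
Qed.

(** Dong's lemma builds up one argument at a time, the symmetry of locality exchanging them in
    between. *)
Lemma sfield_local e c s l c' s' l' : e * e = 1 ->
  local e (vf c s) (vf c' s') -> local e (sfield c s l) (sfield c' s' l').
Proof.
move=> ee vv; apply: sfield_local_gen; [exact: sfield_field | | ].
  by move=> a; exact: b_sfield_local.
apply: local_sym => //; apply: sfield_local_gen.
- exact: (vfield_field F Vl V_vec).
- by move=> a; exact: b_vfield_local.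
- exact: local_sym.
Qed.

Lemma sfield_covariant c s l : integral_on g mom c s ->
  covariant transl (sfield c s l).
Proof.
move=> ic; elim: l => [|x l IH]; first exact: transl_vfield.
apply: nprod_covariant; [exact: transl_lin | exact: (b_field F)
  | exact: sfield_field | exact: transl_b | exact: IH].
Qed.

Lemma mom0 a : mom 0 a = 0.
Proof. by apply: (addrI (mom 0 a)); rewrite -(fs_momD F) !addr0. Qed.

Local Notation v0 := (vec 0 m1).

Lemma b_v0 a (n : int) : 0 <= n -> b a n v0 = 0.
Proof.
case: n => [[|n]|n] // _; last exact: (fs_vac F).
by rewrite (fs_b0 F) (fs_dg F) mom0 scale0r scaler0.
Qed.

Lemma vfield_creates c s : creates v0 (vf c s) (c 0 *: vec s m1).
Proof.
move=> n n1; rewrite /vfield (fs_dg F) (linZ (Vl _ _ _)) (V_vac F V_vec).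
have -> : pairing g (mom s) (mom 0) = 0%:~R.
  by rewrite /pairing big1 // => a _; rewrite mom0 mulr0.
rewrite intpartE // subr0; case: eqP => [->|nn].
  by rewrite /expm opprK subrr exps0 (fs_sh F) add0r.
by rewrite [expm _ _ _ _]exps_neg ?(lin0 (fs_sh_lin F s)) ?scaler0 //; lia.
Qed.

Lemma sfield_creates c s l :
  creates v0 (sfield c s l) (c 0 *: vec s (foldr (fun x => mx x.1 x.2) m1 l)).
Proof.
elim: l => [|x l IH]; first exact: vfield_creates.
rewrite /= -(fs_neg F) -(linZ (bl _ _)).
by apply: nprod_creates; [exact: (b_field F) | exact: sfield_field
  | move=> n; exact: b_v0 | exact: IH].
Qed.

Lemma transl_v0 : transl v0 = 0.
Proof. by rewrite transl_vac big1 // => a _; rewrite mom0 scale0r. Qed.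

Lemma dg_fsum f (h : nat -> X) : fin h -> dg f (fsum h) = fsum (fun j => dg f (h j)).
Proof. exact: (lin_fsum (fs_dg_lin F f)). Qed.

Lemma dg_sfield f c s l n x :
  dg f (sfield c s l n x) = sfield c s l n (dg (fun gam => f (gam + s)) x).
Proof.
elim: l n x => [|y l IH] n x; first exact: (dg_vfield F Vl V_vec).
rewrite /= /nprod dg_fsum; last first.
  by apply: nprod_fin_sub; [exact: (b_field F) | exact: sfield_field].
apply: eq_fsum => j; rewrite (linZ (fs_dg_lin F f)) (linB (fs_dg_lin F f)).
by rewrite (linZ (fs_dg_lin F f)) -!(fs_dg_b F) !IH -!(fs_dg_b F).
Qed.

End StateFields.

(** * Lattice vertex superalgebras *)

Section FreeModule.
Variables (K : fieldType) (B : choiceType).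

Lemma linextE (V : lmodType K) (f : B -> V) (u : {malg K[B]}) (D : {fset B}) :
  (msupp u `<=` D)%fset -> linext f u = \sum_(b <- D) u@_b *: f b.
Proof.
move=> sD; rewrite /linext; apply: big_fset_incl => // b _ bu.
by rewrite mcoeff_outdom ?scale0r.
Qed.

Lemma linext_lin (V : lmodType K) (f : B -> V) :
  lin (linext f : ({malg K[B]} : lmodType K) -> V).
Proof.
move=> c u v.
rewrite !(@linextE _ f _ (msupp (c *: u + v) `|` msupp u `|` msupp v)%fset).
- rewrite scaler_sumr -big_split; apply: eq_bigr => b _ /=.
  by rewrite mcoeffD mcoeffZ scalerDl scalerA.
- exact: fsubsetUr.
- by rewrite -fsetUA fsetUCA fsubsetUl.
- by rewrite -fsetUA fsubsetUl.
Qed.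

Lemma linextU (V : lmodType K) (f : B -> V) b : linext f << b >> = f b.
Proof.
by rewrite /linext msuppU oner_eq0 big_seq_fset1 mcoeffUU scale1r.
Qed.

Lemma malg_basis (u : {malg K[B]}) : u = \sum_(b <- msupp u) u@_b *: << b >>.
Proof.
rewrite {1}[u]monalgE; apply: eq_bigr => b _.
by apply/malgP => b'; rewrite mcoeffZ !mcoeffU mulr_natr.
Qed.

Lemma lin_ext (V : lmodType K) (f h : ({malg K[B]} : lmodType K) -> V) :
  lin f -> lin h -> (forall b, f << b >> = h << b >>) -> forall u, f u = h u.
Proof.
move=> fl hl fh u; rewrite [u]malg_basis (lin_sum fl) (lin_sum hl).
by apply: eq_bigr => b _; rewrite (linZ fl) (linZ hl) fh.
Qed.

Lemma mcoeff_lin b : lin (fun u : ({malg K[B]} : lmodType K) => u@_b : K^o).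
Proof. by move=> c u v; rewrite mcoeffD mcoeffZ. Qed.

Lemma trunc_basis (V : lmodType K) (A : int -> ({malg K[B]} : lmodType K) -> V) :
  (forall n, lin (A n)) ->
  (forall b, exists N : int, forall n : int, N <= n -> A n << b >> = 0) ->
  forall u, exists N : int, forall n : int, N <= n -> A n u = 0.
Proof.
move=> Al Ab u.
suff [N hN] : exists N : int, forall n : int, N <= n ->
    \sum_(b <- msupp u) u@_b *: A n << b >> = 0.
  exists N => n /hN <-; rewrite {1}[u]malg_basis (lin_sum (Al n)).
  by apply: eq_bigr => b _; rewrite (linZ (Al n)).
elim: (enum_fset _) => [|b r [N hN]]; first by exists 0 => n _; rewrite big_nil.
have [M hM] := Ab b; exists (Order.max N M) => n; rewrite ge_max => /andP[nN nM].
by rewrite big_cons hM // hN // scaler0 addr0.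
Qed.

End FreeModule.

Section Monomials.
Variable T : choiceType.
Implicit Types (m : {cmonom T}) (x y : T).

Lemma cm_mul_div m x : (0 < m x)%N -> mmul (ucm x) (divcm m (ucm x)) = m.
Proof.
move=> mx; apply/eqP/cmP => y; rewrite cmM divcmE cmU.
by case: eqVneq => [<-|_] /=; rewrite ?add0n ?subn0 // add1n subn1 prednK.
Qed.

Lemma cm_div_mul m x : divcm (mmul (ucm x) m) (ucm x) = m.
Proof. by apply/eqP/cmP => y; rewrite divcmE cmM addKn. Qed.

Lemma cm_div_mulC m x y : x != y ->
  divcm (mmul (ucm y) m) (ucm x) = mmul (ucm y) (divcm m (ucm x)).
Proof.
move=> xy; apply/eqP/cmP => z; rewrite !(divcmE, cmM, cmU).
case: (eqVneq x z) => [<-|_] /=; last by rewrite !subn0.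
by rewrite eq_sym (negPf xy) !add0n.
Qed.

Lemma cm_divC m x y :
  divcm (divcm m (ucm x)) (ucm y) = divcm (divcm m (ucm y)) (ucm x).
Proof. by apply/eqP/cmP => z; rewrite !divcmE subnAC. Qed.

Lemma cm_mulCA m x y : mmul (ucm x) (mmul (ucm y) m) = mmul (ucm y) (mmul (ucm x) m).
Proof. by rewrite !mulmA [mmul (ucm x) _]mulmC. Qed.

Lemma cm_ind (P : {cmonom T} -> Prop) :
  P mone -> (forall x m, P m -> P (mmul (ucm x) m)) -> forall m, P m.
Proof.
move=> P1 Pm m; have [n] := ubnP (mdeg m); elim: n m => // n IH m.
have [->//|m1] := eqVneq m mone.
have [x xm] : exists x, x \in finsupp m.
  apply/fset0Pn; apply: contra m1 => /eqP m0; apply/eqP/eqP/cmP => y.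
  by rewrite cm1; apply/eqP; rewrite cmE_eq0 m0 inE.
have xm' : (0 < m x)%N by rewrite lt0n cmE_neq0.
rewrite -(cm_mul_div xm') mdegM mdegU ltnS => lt; apply: Pm; apply: IH.
by rewrite -(ltn_add2l 1) add1n.
Qed.

End Monomials.

(** * Heisenberg operators on the monomial basis *)

Section FockFromBasis.
Variables (K : fieldType) (I : finType) (g : I -> K) (L : zmodType)
  (mom : L -> I -> K) (X : lmodType K).
Local Notation M := {cmonom (I * nat)%type}.
Variables (fvec : L -> M -> X) (fcoef : L -> M -> X -> K)
  (fheis : I -> int -> X -> X) (fshift : L -> X -> X) (fdiag : (L -> K) -> X -> X).
Hypothesis char0 : forall n, n.+1%:R != 0 :> K.
Hypothesis g_neq0 : forall a, g a != 0.

Definition fmul a k (m : M) : M := mmul (ucm (a, k)) m.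

Hypothesis fheis_lin : forall a n, lin (fheis a n).
Hypothesis fshift_lin : forall s, lin (fshift s).
Hypothesis fdiag_lin : forall f, lin (fdiag f).
Hypothesis fcoef_lin : forall gam m, lin (fcoef gam m : X -> K^o).
Hypothesis fheisN : forall a k gam m,
  fheis a (Negz k) (fvec gam m) = fvec gam (fmul a k m).
Hypothesis fheisP : forall a k gam m, fheis a k.+1 (fvec gam m) =
  (k.+1%:R * g a * (m (a, k))%:R) *: fvec gam (divcm m (ucm (a, k))).
Hypothesis fheis0 : forall a gam m,
  fheis a 0 (fvec gam m) = (g a * mom gam a) *: fvec gam m.
Hypothesis fshift_vec : forall s gam m, fshift s (fvec gam m) = fvec (gam + s) m.
Hypothesis fdiag_vec : forall f gam m, fdiag f (fvec gam m) = f gam *: fvec gam m.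
Hypothesis fcoef_vec : forall gam m gam' m',
  fcoef gam m (fvec gam' m') = ((gam' == gam) && (m' == m))%:R.
Hypothesis fcoef_ext : forall x, (forall gam m, fcoef gam m x = 0) -> x = 0.
Hypothesis fext : forall (Z : lmodType K) (f h : X -> Z), lin f -> lin h ->
  (forall gam m, f (fvec gam m) = h (fvec gam m)) -> forall x, f x = h x.
Hypothesis ftrunc : forall A : int -> X -> X, (forall n, lin (A n)) ->
  (forall gam m, exists N : int, forall n : int, N <= n -> A n (fvec gam m) = 0) ->
  forall x, exists N : int, forall n : int, N <= n -> A n x = 0.
Hypothesis momD : forall gam gam' a, mom (gam + gam') a = mom gam a + mom gam' a.

Lemma fheis_comm a c m n x : fheis a m (fheis c n x) = fheis c n (fheis a m x) +
  (if (a == c) && (m + n == 0) then m%:~R * g a else 0) *: x.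
Proof.
pose q := if (a == c) && (m + n == 0) then m%:~R * g a else 0.
have hl := fheis_lin.
apply: (fext (lin_comp (hl _ _) (hl _ _))
  (lin_add (lin_comp (hl _ _) (hl _ _)) (lin_scale q (@lin_id _ _)))) => gam u.
have PN a' c' k l gam' u' :
    fheis a' k.+1 (fheis c' (Negz l) (fvec gam' u')) =
    fheis c' (Negz l) (fheis a' k.+1 (fvec gam' u')) +
    (if (a' == c') && (k == l) then k.+1%:R * g a' else 0) *: fvec gam' u'.
  rewrite fheisN !fheisP (linZ (hl _ _)) fheisN /fmul cmM cmU xpair_eqE.
  rewrite [c' == a']eq_sym [l == k]eq_sym.
  have [/andP[/eqP <- /eqP <-]|ne] := boolP (_ && _).
    rewrite cm_div_mul natrD mulrDr scalerDl mulr1 addrC; congr (_ + _).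
    (* [divcm] truncates, so that multiplying back is legitimate only if the variable occurs;
       otherwise the scalar is zero. *)
    have [->|m1] := posnP (u' (a', k)); first by rewrite mulr0 !scale0r.
    by rewrite cm_mul_div.
  rewrite scale0r addr0 add0n cm_div_mulC //.
have scal0 a' c' n' : fheis c' 0 (fheis a' n' (fvec gam u)) =
    fheis a' n' (fheis c' 0 (fvec gam u)).
  rewrite (fheis0 c') (linZ (hl _ _)).
  case: n' => [[|k]|k]; rewrite ?fheis0 ?fheisP ?fheisN ?(linZ (hl _ _)) fheis0 //.
    by rewrite !scalerA mulrC.
  by rewrite !scalerA mulrC.
rewrite {}/q; case: m => [[|k]|k]; case: n => [[|l]|l].
- by rewrite (scal0 a c) mulr0z mul0r if_same scale0r addr0.
- by rewrite (scal0 c a) andbF scale0r addr0.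
- by rewrite (scal0 c a) andbF scale0r addr0.
- by rewrite -(scal0 a c) andbF scale0r addr0.
- rewrite andbF scale0r addr0 !fheisP !(linZ (hl _ _)) !fheisP !scalerA cm_divC.
  congr (_ *: _); rewrite !divcmE !cmU !xpair_eqE [c == a]eq_sym [l == k]eq_sym.
  by case: andP => [[/eqP-> /eqP->]|_]; rewrite ?subn0; ring.
- rewrite PN; congr (_ + _ *: _).
  by have -> : (k.+1%:Z + Negz l == 0) = (k == l) by apply/eqP/eqP; lia.
- by rewrite -(scal0 a c) andbF scale0r addr0.
- rewrite PN -addrA -scalerDl [c == a]eq_sym.
  have -> : (Negz k + l.+1%:Z == 0) = (l == k) by apply/eqP/eqP; lia.
  case: andP => [[/eqP-> /eqP->]|_]; last by rewrite addr0 scale0r addr0.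
  by rewrite NegzE mulrNz mulNr -[_%:~R]/(_%:R) subrr scale0r addr0.
- by rewrite andbF scale0r addr0 !fheisN /fmul cm_mulCA.
Qed.

Lemma fheis_trunc a x : exists N : int, forall n : int, N <= n -> fheis a n x = 0.
Proof.
move: x; apply: (ftrunc (A := fun n x => fheis a n x)) => [n|gam m].
  exact: fheis_lin.
have [K0 hK] : exists K0 : nat, forall k, (K0 <= k)%N -> m (a, k) = 0%N.
  (* A crude bound: the sum exceeds the index of every variable of the monomial. *)
  exists (\sum_(y <- finsupp m) y.2.+1)%N => k; apply: contraTeq.
  rewrite cmE_neq0 -ltnNge => km; rewrite (big_fsetD1 _ km) /=; exact: leq_addr.
exists (K0.+1%:Z) => -[[|n]|n] // hn.
by rewrite fheisP hK ?mulr0 ?scale0r //; lia.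
Qed.

Lemma fcoef_pos a k gam m : exists2 c : K, c != 0 &
  forall x, fcoef gam m (fheis a k.+1 x) = c * fcoef gam (fmul a k m) x.
Proof.
(* The scalar by which the annihilation mode carries [fmul a k m] to [m]. *)
exists (k.+1%:R * g a * (m (a, k)).+1%:R).
  by rewrite !mulf_neq0.
apply: (fext (Z := K^o) (lin_comp (fcoef_lin _ _) (fheis_lin _ _))
  (lin_scale _ (fcoef_lin _ _))) => gam' m'.
rewrite fheisP (linZ (fcoef_lin _ _)) !fcoef_vec.
have [m0|m0] := posnP (m' (a, k)).
  rewrite m0 mulr0 scale0r; case: (m' =P fmul a k m) => [E|_]; last by rewrite andbF scaler0.
  by move: m0; rewrite E /fmul cmM cmU eqxx.
have -> : (divcm m' (ucm (a, k)) == m) = (m' == fmul a k m).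
  apply/eqP/eqP => [<-|->]; last exact: cm_div_mul.
  by rewrite /fmul cm_mul_div.
case: (m' =P _) => [->|_]; last by rewrite andbF !scaler0.
by rewrite /fmul cmM cmU eqxx add1n.
Qed.

Lemma fock_from_basis : fock_space g mom mone fmul fvec fcoef fheis fshift fdiag.
Proof.
split=> //.
- by move=> P P1 Pm; apply: cm_ind => // -[a k] m; apply: Pm.
- by move=> gam gam'; rewrite fcoef_vec eqxx andbT eq_sym.
- exact: fheis_comm.
- by move=> a k gam; rewrite fheisP cm1 mulr0 scale0r.
- move=> a; apply: (fext (fheis_lin _ _) (lin_scale (g a) (fdiag_lin _))) => gam m.
  by rewrite fheis0 fdiag_vec scalerA.
- exact: fheis_trunc.
- move=> a k gam x.
  apply: (fext (Z := K^o) (lin_comp (fcoef_lin _ _) (fheis_lin _ _)) (@lin_zero _ _ _)).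
  move=> gam' m; rewrite fheisN fcoef_vec; case: (_ =P mone) => [E|_]; last by rewrite andbF.
  have := congr1 (fun u : M => u (a, k)) E.
  by rewrite /= /fmul cmM cmU eqxx cm1.
- exact: fcoef_pos.
- move=> s a n x n0.
  apply: (fext (lin_comp (fheis_lin _ _) (fshift_lin _))
    (lin_comp (fshift_lin _) (fheis_lin _ _))) => gam m.
  by case: n n0 => [[|n]|n] // _; rewrite fshift_vec ?fheisN ?fheisP
    ?(linZ (fshift_lin _)) fshift_vec.
- move=> f a n x.
  apply: (fext (lin_comp (fheis_lin _ _) (fdiag_lin _))
    (lin_comp (fdiag_lin _) (fheis_lin _ _))) => gam m.
  by case: n => [[|n]|n]; rewrite fdiag_vec (linZ (fheis_lin _ _)) ?fheis0 ?fheisN ?fheisP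
    ?(linZ (fdiag_lin _)) fdiag_vec // !scalerA mulrC.
Qed.

End FockFromBasis.

Section LatticeFock.
Variables (K : fieldType) (I J : finType) (g : I -> K) (lam : J -> I -> K).
Hypothesis char0 : forall n, n.+1%:R != 0 :> K.
Hypothesis g_neq0 : forall a, g a != 0.

Local Notation X := (latspace K I J).
Local Notation L := {ffun J -> int}.
Local Notation M := {cmonom (I * nat)%type}.
Local Notation mom := (momentum lam).

(* Opaque, so that conversion does not unfold finitely supported functions. *)
Fact fvec_sig : {f : L -> M -> X | forall gam m, f gam m = << (gam, m) >>}.
Proof. by exists (fun gam m => << (gam, m) >>). Qed.
Fact fcoef_sig : {f : L -> M -> X -> K | forall gam m x, f gam m x = x@_(gam, m)}.
Proof. by exists (fun gam m x => x@_(gam, m)). Qed.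
Fact fheis_sig : {f : I -> int -> X -> X | forall a n x, f a n x = heis g lam a n x}.
Proof. by exists (heis g lam). Qed.
Fact fshift_sig : {f : L -> X -> X | forall s x,
  f s x = linext (fun c : latbasis I J => << (c.1 + s, c.2) >> : X) x}.
Proof. by exists (fun s => linext (fun c : latbasis I J => << (c.1 + s, c.2) >> : X)). Qed.
Fact fdiag_sig : {f : (L -> K) -> X -> X | forall h x,
  f h x = linext (fun c : latbasis I J => h c.1 *: << c >> : X) x}.
Proof. by exists (fun h => linext (fun c : latbasis I J => h c.1 *: << c >> : X)). Qed.

Definition fvec := sval fvec_sig.
Definition fcoef := sval fcoef_sig.
Definition fheis := sval fheis_sig.
Definition fshift := sval fshift_sig.
Definition fdiag := sval fdiag_sig.

Lemma fvecE gam m : fvec gam m = << (gam, m) >>.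
Proof. exact: (svalP fvec_sig). Qed.
Lemma fcoefE gam m x : fcoef gam m x = x@_(gam, m).
Proof. exact: (svalP fcoef_sig). Qed.
Lemma fheisE a n x : fheis a n x = heis g lam a n x.
Proof. exact: (svalP fheis_sig). Qed.
Lemma fshiftE s x : fshift s x =
  linext (fun c : latbasis I J => << (c.1 + s, c.2) >> : X) x.
Proof. exact: (svalP fshift_sig). Qed.
Lemma fdiagE h x :
  fdiag h x = linext (fun c : latbasis I J => h c.1 *: << c >> : X) x.
Proof. exact: (svalP fdiag_sig). Qed.

Lemma fheis_lin a n : lin (fheis a n).
Proof. by move=> c u v; rewrite !fheisE; case: n => [[|n]|n]; apply: linext_lin. Qed.

Lemma fshift_lin s : lin (fshift s).
Proof. by move=> c u v; rewrite !fshiftE; apply: linext_lin. Qed.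

Lemma fdiag_lin f : lin (fdiag f).
Proof. by move=> c u v; rewrite !fdiagE; apply: linext_lin. Qed.

Lemma fcoef_lin gam m : lin (fcoef gam m : X -> K^o).
Proof. by move=> c u v; rewrite !fcoefE; apply: mcoeff_lin. Qed.

Lemma fheisN a k gam m : fheis a (Negz k) (fvec gam m) = fvec gam (fmul a k m).
Proof. by rewrite fheisE !fvecE; exact: linextU. Qed.

Lemma fheisP a k gam m : fheis a k.+1 (fvec gam m) =
  (k.+1%:R * g a * (m (a, k))%:R) *: fvec gam (divcm m (ucm (a, k))).
Proof. by rewrite fheisE !fvecE; exact: linextU. Qed.

Lemma fheis0 a gam m : fheis a 0 (fvec gam m) = (g a * mom gam a) *: fvec gam m.
Proof. by rewrite fheisE !fvecE; exact: linextU. Qed.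

Lemma fshift_vec s gam m : fshift s (fvec gam m) = fvec (gam + s) m.
Proof. by rewrite fshiftE !fvecE; exact: linextU. Qed.

Lemma fdiag_vec f gam m : fdiag f (fvec gam m) = f gam *: fvec gam m.
Proof. by rewrite fdiagE !fvecE; exact: linextU. Qed.

Lemma fcoef_vec gam m gam' m' :
  fcoef gam m (fvec gam' m') = ((gam' == gam) && (m' == m))%:R.
Proof. by rewrite fcoefE fvecE mcoeffU. Qed.

Lemma fext (Z : lmodType K) (f h : X -> Z) : lin f -> lin h ->
  (forall gam m, f (fvec gam m) = h (fvec gam m)) -> forall x, f x = h x.
Proof.
by move=> fl hl E; apply: (lin_ext fl hl) => -[gam m]; have := E gam m; rewrite !fvecE.
Qed.

Lemma momD gam gam' a : mom (gam + gam') a = mom gam a + mom gam' a.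
Proof.
rewrite -big_split; apply: eq_bigr => c _.
by rewrite ffunE intrD mulrDl.
Qed.

Lemma lattice_fock : fock_space g mom mone (@fmul I) fvec fcoef fheis fshift fdiag.
Proof.
apply: fock_from_basis => //.
- exact: fheis_lin.
- exact: fshift_lin.
- exact: fdiag_lin.
- exact: fcoef_lin.
- exact: fheisN.
- exact: fheisP.
- exact: fheis0.
- exact: fshift_vec.
- exact: fdiag_vec.
- exact: fcoef_vec.
- by move=> x x0; apply/malgP => -[gam m]; have := x0 gam m; rewrite fcoefE mcoeff0.
- exact: fext.
- move=> A Al Ab; apply: (trunc_basis (A := A)) => // -[gam m].
  by have [N hN] := Ab gam m; exists N => n /hN; rewrite fvecE.
- exact: momD.
Qed.

End LatticeFock.

(** * Comparison with the sums and modes of the definitions *)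

Section ExponentialSums.
Variables (K : fieldType) (X : lmodType K) (A : nat -> X -> X).
Hypothesis Al : forall k, lin (A k).

(** Induction on the first entry. The bound [n] on the entries is kept apart from [j], which
    decreases while the type of the tuples stays. *)
Lemma tuple_compositions n r j v : (j < n)%N ->
  \sum_(t : r.-tuple 'I_n |
      all (fun k : 'I_n => 0 < k)%N t && (\sum_(k <- t) k == j)%N)
    foldr (fun k : 'I_n => A k) v t = compositions A r j v.
Proof.
elim: r j => [|r IH] j jn.
  rewrite big_mkcond (bigD1 [tuple]) //= big_nil big1 => [|t].
    by rewrite addr0 eq_sym.
  by rewrite tuple0 => /eqP.
rewrite (reindex (fun p : 'I_n * r.-tuple 'I_n => [tuple of p.1 :: p.2])) /=; last first.
  exists (fun t : r.+1.-tuple 'I_n => (thead t, [tuple of behead t])).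
    by case=> k t _; congr (_, _); apply/val_inj.
  by move=> t _; rewrite [RHS](tuple_eta t).
rewrite (eq_bigl (fun p : 'I_n * r.-tuple 'I_n => (0 < p.1 <= j)%N &&
    (all (fun k : 'I_n => 0 < k)%N p.2 && (\sum_(k <- p.2) k == j - p.1)%N))); last first.
  move=> [k t] /=; rewrite big_cons -!andbA; congr (_ && _).
  rewrite andbCA; congr (_ && _).
  apply/eqP/andP => [<-|[kj /eqP ->]]; last by rewrite subnKC.
  by rewrite leq_addr addKn.
rewrite -(pair_big_dep (fun k : 'I_n => 0 < k <= j)%N
  (fun (k : 'I_n) (t : r.-tuple 'I_n) => all (fun k : 'I_n => 0 < k)%N t &&
     (\sum_(k <- t) k == j - k)%N)
  (fun (k : 'I_n) (t : r.-tuple 'I_n) => A k (foldr (fun k : 'I_n => A k) v t))) /=.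
under eq_bigr => k /andP[k0 kj].
  rewrite -(lin_sum (Al k)) IH; last by apply: leq_ltn_trans jn; exact: leq_subr.
  over.
rewrite /= -(big_mkord (fun k => 0 < k <= j)%N (fun k => A k (compositions A r (j - k) v))).
rewrite (big_cat_nat (leq0n j.+1) jn) /= [X in _ + X]big_nat_cond [X in _ + X]big_pred0 ?addr0.
  rewrite big_mkcond big_nat_recl //= add0r.
  rewrite -(big_mkord predT (fun k => A k.+1 (compositions A r (j - k.+1)%N v))).
  by apply: eq_big_nat => k /andP[_ kj]; rewrite kj.
by move=> k; apply/negP => /andP[/andP[jk _] /andP[_ kj]]; rewrite leqNgt jk in kj.
Qed.

Lemma exps_tuples (j : nat) v :
  \sum_(r < j.+1) (r`!%:R)^-1 *:
    \sum_(t : r.-tuple 'I_j.+1 |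
          all (fun k : 'I_j.+1 => 0 < k)%N t && (\sum_(k <- t) k == j)%N)
      foldr (fun k : 'I_j.+1 => A k) v t = exps A j v.
Proof. by apply: eq_bigr => r _; rewrite tuple_compositions. Qed.

End ExponentialSums.

Lemma nprod_normal (K : fieldType) (X : lmodType K) (b : int -> X -> X)
    (A : int -> X -> X) k n v :
  fsum (fun j : nat => 'C(k + j, k)%:R *: (b (- (k + j).+1%:Z) (A (n + j%:Z) v)
     + (-1) ^+ k *: A (n - k%:Z - j%:Z - 1) (b j%:Z v)))
  = nprod 1 k.+1 b A n v :> X.
Proof.
apply: eq_fsum => j; rewrite /nbin addSn /= -[in LHS](@bin_sub (k + j) k) ?leq_addr //.
rewrite addKn mul1r exprS mulN1r scaleNr opprK.
by have -> : n - k%:Z - j%:Z - 1 = n - (k + j).+1%:Z by lia.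
Qed.

(** The binomial expansion of $(z-w)^N$, the form in which [va_local] states locality. *)
Lemma iter_diff2E (K : fieldType) (X : lmodType K) N (F : int -> int -> X) m n :
  iter N (@diff2 K X) F m n = \sum_(j < N.+1) ((-1) ^+ j * 'C(N, j)%:R) *:
    F (m + (N - j)%N%:Z) (n + j%:Z).
Proof.
elim: N m n => [|N IH] m n; first by rewrite big_ord1 expr0 mul1r scale1r !addr0.
rewrite iterS /diff2 !IH.
pose a j := ((-1) ^+ j * 'C(N, j)%:R) *: F (m + 1 + (N - j)%N%:Z) (n + j%:Z).
have -> : \sum_(j < N.+1) ((-1) ^+ j * 'C(N, j)%:R) *:
    F (m + 1 + (N - j)%N%:Z) (n + j%:Z) = a 0%N + \sum_(j < N.+1) a j.+1.
  transitivity (\sum_(j < N.+2) a j); last by rewrite big_ord_recl.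
  have aN : a N.+1 = 0 by rewrite /a (bin_small (ltnSn N)) mulr0 scale0r.
  by rewrite [RHS]big_ord_recr /= aN addr0.
rewrite [RHS]big_ord_recl -addrA; congr (_ + _).
  by rewrite /a !bin0 !subn0; congr (_ *: F _ _); lia.
rewrite -sumrB; apply: eq_bigr => j _; have jN := ltn_ord j.
rewrite /a lift0 binS.
have -> : n + 1 + j%:Z = n + j.+1%:Z by lia.
rewrite natrD mulrDr scalerDl subSS; congr (_ + _).
  have [jN'|jN'] := ltnP j N; last by rewrite bin_small // mulr0 !scale0r.
  by have -> : m + 1 + (N - j.+1)%N%:Z = m + (N - j)%N%:Z by lia.
by rewrite exprS mulN1r mulNr scaleNr.
Qed.

(** * Reconstruction of a vertex superalgebra from mutually local fields *)

Section VertexFields.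
Variables (K : fieldType) (A : vertexData K).
Local Notation X := (carrier A).
Local Notation vp := (@vprod K A).
Variables (Y : Defs.vbasis A -> int -> X -> X) (b0 : Defs.vbasis A) (T : X -> X).

Hypothesis vprodE : forall u n v,
  vp u n v = \sum_(b <- msupp u) u@_b *: Y b n v.
Hypothesis vacE : vvac A = << b0 >>.
Hypothesis par0 : vpar b0 = false.
Hypothesis Yf : forall b, is_field (Y b).
Hypothesis Yloc : forall b b', local ((-1) ^+ (vpar b && vpar b')) (Y b) (Y b').
Hypothesis Yc : forall b, creates (vvac A) (Y b) << b >>.
Hypothesis Tl : lin T.
Hypothesis T0 : T (vvac A) = 0.
Hypothesis Tc : forall b, covariant T (Y b).
Hypothesis Y0 : forall n v, Y b0 n v = if n == -1 then v else 0.
Hypothesis Ypar : forall b p n v,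
  hpart (vpar b (+) p) (Y b n v) = Y b n (hpart p v).

(** Turns homogeneity into a linear equation, which passes through linear maps. *)
Lemma homog_hpartP p (u : X) : homog p u <-> hpart p u = u.
Proof.
split=> [hu|hu b].
  rewrite {2}[u]malg_basis /hpart /linext; apply: eq_big_seq => b bu.
  by rewrite (hu b bu) eqxx.
rewrite -hu -mcoeff_neq0 /hpart /linext raddf_sum /= => E.
apply/eqP; apply: contraNT E => bp; apply/eqP.
apply: big1_seq => b' _; rewrite mcoeffZ; case: eqP => [b'p|_]; last by rewrite mcoeff0 mulr0.
by rewrite mcoeffU; case: eqP => [E|_]; rewrite ?mulr0 //; rewrite -E b'p eqxx in bp.
Qed.

Lemma vprod_field u : is_field (fun n => vp u n).
Proof.
have -> : (fun n => vp u n) = fun n v => \sum_(b <- msupp u) u@_b *: Y b n v.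
  by apply/funext => n; apply/funext => v; exact: vprodE.
exact: field_sum.
Qed.

Lemma vprod_linl n v : lin (fun u : X => vp u n v).
Proof.
have -> : (fun u : X => vp u n v) = linext (fun b => Y b n v).
  by apply/funext => u; exact: vprodE.
exact: linext_lin.
Qed.

Lemma vprod_basis b n v : vp << b >> n v = Y b n v.
Proof.
have -> : vp << b >> n v = linext (fun b => Y b n v) << b >> by exact: vprodE.
exact: linextU.
Qed.

Lemma vprod_creates u : creates (vvac A) (fun n => vp u n) u.
Proof.
move=> n n1; rewrite vprodE; case: eqP => [->|nn].
  by rewrite [RHS]malg_basis; apply: eq_bigr => b _; rewrite Yc // eqxx.
by rewrite big1 // => b _; rewrite Yc //; case: eqP => //; rewrite scaler0.
Qed.

Lemma vprod_covariant u : covariant T (fun n => vp u n).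
Proof.
move=> n x; rewrite !vprodE (lin_sum Tl) scaler_sumr -sumrB.
apply: eq_bigr => b _; rewrite (linZ Tl) Tc scalerBr; congr (_ - _).
by rewrite !scalerA mulrC.
Qed.

Lemma vtransE u : vtrans u = T u.
Proof.
rewrite /vtrans; have := vprod_covariant u (-1) (vvac A).
rewrite T0 (lin0 (field_lin (vprod_field u) _)) sub0r (vprod_creates u) // eqxx.
move=> ->; rewrite mulrNz scaleNr opprK scale1r.
by congr (vp u _ _).
Qed.

Lemma vprod_local_basis p u b : homog p u ->
  local ((-1) ^+ (p && vpar b)) (fun n => vp u n) (Y b).
Proof.
move=> hu.
have -> : (fun n => vp u n) = fun n v => \sum_(b <- msupp u) u@_b *: Y b n v.
  by apply/funext => n; apply/funext => v; exact: vprodE.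
by apply: local_sum => // b' b'u; rewrite -(hu b' b'u).
Qed.

Lemma sign_sqr (b : bool) : (-1) ^+ b * (-1) ^+ b = 1 :> K.
Proof. by rewrite -expr2 sqrr_sign. Qed.

Lemma vprod_local p q u v : homog p u -> homog q v ->
  local ((-1) ^+ (p && q)) (fun n => vp u n) (fun n => vp v n).
Proof.
move=> hu hv; apply: local_sym; first exact: sign_sqr.
have -> : (fun n => vp v n) = fun n w => \sum_(b <- msupp v) v@_b *: Y b n w.
  by apply/funext => n; apply/funext => w; exact: vprodE.
apply: local_sum => [|b bv]; first exact: vprod_field.
apply: local_sym; first exact: sign_sqr.
by rewrite -(hv b bv); exact: vprod_local_basis.
Qed.

Lemma vsa_of_fields : vertex_superalgebra (A := A) setT.
Proof.
split=> //.
- by move=> c u u' n v _ _ _; exact: vprod_linl.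
- by move=> c u n v v' _ _ _; exact: (field_lin (vprod_field u)).
- by apply/homog_hpartP; rewrite vacE /hpart linextU par0.
- move=> p q u n v _ _ hu hv; apply/homog_hpartP; rewrite vprodE.
  have hl : lin (hpart (p (+) q) : X -> X) by exact: linext_lin.
  rewrite (lin_sum hl); apply: eq_big_seq => b bu.
  by rewrite (linZ hl) -{1}(hu b bu) Ypar (homog_hpartP q v).1.
- by move=> u v _ _; exact: (field_trunc (vprod_field u)).
- by move=> n v _; rewrite vacE vprod_basis Y0.
- by move=> u _; rewrite (vprod_creates u) // eqxx.
- by move=> u n _ n0; rewrite (vprod_creates u) ?ifF //; lia.
- move=> u n v _ _; rewrite !vtransE vprod_covariant.
  by rewrite scaleNr addrAC subrr add0r.
- move=> p q u v _ _ hu hv; have [N hN] := vprod_local hu hv.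
  exists N => m n x _; have := congr1 (fun f => f m n) (hN x).
  by rewrite /= iter_diff2E.
Qed.

End VertexFields.

Lemma vsa_sub (K : fieldType) (A : vertexData K) (U : set (carrier A)) :
  vertex_superalgebra (A := A) setT ->
  U (vvac A) -> (forall c u v, U u -> U v -> U (c *: u + v)) ->
  (forall p u, U u -> U (hpart p u)) ->
  (forall u n v, U u -> U v -> U (vprod u n v)) -> vertex_superalgebra U.
Proof.
move=> H U0 Ul Up Uv; split=> //.
- by move=> c u u' n v _ _ _; exact: (va_linl H).
- by move=> c u n v v' _ _ _; exact: (va_linr H).
- exact: (va_vac_even H).
- by move=> p q u n v _ _; exact: (va_par H).
- by move=> u v _ _; exact: (va_trunc H).
- by move=> n v _; exact: (va_vacl H).
- by move=> u _; exact: (va_vacr H).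
- by move=> u n _; exact: (va_create H).
- by move=> u n v _ _; exact: (va_trans H).
- move=> p q u v _ _ hu hv; have [N hN] := va_local H I I hu hv.
  by exists N => m n x _; exact: hN.
Qed.

Lemma dressed_of_coefs (K : fieldType) (I : finType) (X : lmodType K)
    (b : I -> int -> X -> X) (E E' : nat -> X -> X) mu d x :
  (forall j y, E j y = expm b mu j y) -> (forall j y, E' j y = expp b mu j y) ->
  dressed b mu d x = fsum (fun i : nat =>
    if d + i%:Z is Posz j then E j (E' i x) else 0).
Proof.
move=> hE hE'; apply: eq_fsum => i; rewrite hE'.
by case: (d + i%:Z) => [j|j]; rewrite ?hE.
Qed.

Section LatticeOperators.
Variables (K : fieldType) (I J : finType) (g : I -> K) (lam : J -> I -> K).

Local Notation X := (latspace K I J).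
Local Notation L := {ffun J -> int}.
Local Notation mom := (momentum lam).
Local Notation hs := (fheis g lam).

Fact fvert_sig : {f : (I -> K) -> L -> int -> X -> X | forall mu s e x,
  f mu s e x = vertop g lam mu s e x}.
Proof. by exists (vertop g lam). Qed.
Definition fvert := sval fvert_sig.

Lemma fvertE mu s e x : fvert mu s e x = vertop g lam mu s e x.
Proof. exact: (svalP fvert_sig). Qed.

Lemma fvert_lin mu s e : lin (fvert mu s e).
Proof. by move=> c u v; rewrite !fvertE; apply: linext_lin. Qed.

Hypothesis char0 : forall n, n.+1%:R != 0 :> K.
Hypothesis g_neq0 : forall a, g a != 0.
Let F := lattice_fock lam char0 g_neq0.

Lemma creationE mu : creation g lam mu = cre hs mu.
Proof.
apply/funext => k; apply/funext => v; apply: eq_bigr => a _.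
by rewrite fheisE.
Qed.

Lemma annihilE mu : annihil g lam mu = ann hs mu.
Proof.
apply/funext => k; apply/funext => v; apply: eq_bigr => a _.
by rewrite fheisE.
Qed.

Lemma expcoefE A j v : (forall k, lin (A k)) ->
  expcoef A j v = exps A j v :> latspace K I J.
Proof. by move=> Al; exact: exps_tuples. Qed.

Lemma dressedE mu d x : dressed hs mu d x =
  \sum_(i \in [set: nat]%classic)
    (if d + i%:Z is Posz j
     then expcoef (creation g lam mu) j (expcoef (annihil g lam mu) i x) else 0).
Proof.
apply: dressed_of_coefs => j y.
  by rewrite creationE; exact: (expcoefE j y (cre_lin F mu)).
by rewrite annihilE; exact: (expcoefE j y (ann_lin F mu)).
Qed.

Lemma fvert_vec mu s e gam m : fvert mu s e (fvec K gam m) =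
  fshift s (dressed hs mu (e - intpart (pairing g mu (mom gam))) (fvec K gam m)).
Proof.
rewrite fvertE fshiftE dressedE fvecE.
exact: linextU.
Qed.

Local Notation vf := (vfield mom (@fdiag K I J) fvert).
Local Notation sf := (sfield mom hs (@fdiag K I J) fvert).

Lemma lattice_fieldE ltJ l :
  lattice_field g lam ltJ l = vf (cocycle g lam ltJ l) l.
Proof.
apply/funext => n; apply/funext => x; rewrite /vfield.
have fl : lin (lattice_field g lam ltJ l n) by exact: linext_lin.
apply: (fext fl (lin_comp (fvert_lin _ _ _) (@fdiag_lin K I J _))) => gam m.
rewrite fdiag_vec (linZ (fvert_lin _ _ _)) fvertE fvecE.
exact: linextU.
Qed.

Definition monomial_list (m : {cmonom (I * nat)%type}) : seq (I * nat) :=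
  flatten [seq nseq (m x) x | x <- finsupp m].

Lemma normal_prodE x A n v :
  normal_prod g lam x A n v = nprod 1 x.2.+1 (hs x.1) A n v.
Proof.
have -> : hs x.1 = heis g lam x.1.
  by apply/funext => k; apply/funext => w; exact: fheisE.
exact: (nprod_normal (heis g lam x.1) A x.2 n v).
Qed.

Lemma state_fieldE ltJ b : state_field g lam ltJ b =
  sf (cocycle g lam ltJ b.1) b.1 (monomial_list b.2).
Proof.
rewrite /state_field lattice_fieldE.
have -> : normal_prod g lam = fun x A => nprod 1 x.2.+1 (hs x.1) A.
  apply/funext => x; apply/funext => A; apply/funext => n; apply/funext => v.
  exact: normal_prodE.
by [].
Qed.

Lemma monomial_listK (m : {cmonom (I * nat)%type}) :
  foldr (fun x => fmul x.1 x.2) mone (monomial_list m) = m.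
Proof.
have E l y : foldr (fun x => fmul x.1 x.2) mone l y = count_mem y l.
  elim: l => [|x l IH]; first by rewrite cm1.
  by rewrite /= /fmul cmM cmU IH -surjective_pairing.
apply/eqP/cmP => y; rewrite E /monomial_list count_flatten -map_comp sumnE big_map.
rewrite (eq_bigr (fun x => if x == y then m x else 0%N)); last first.
  by move=> x _; rewrite /= count_nseq /=; case: eqP => _; rewrite ?mul1n.
have [ym|ym] := boolP (y \in finsupp m).
  rewrite (big_fsetD1 y) //= eqxx big1_fset ?addn0 // => x.
  by rewrite in_fsetD1; case: eqP.
rewrite big1_fset => [|x xm _]; first by move: ym; rewrite -cmE_eq0 => /eqP.
by case: eqP => // xy; rewrite -xy xm in ym.
Qed.

End LatticeOperators.

(** * Signs and parity modulo 2 *)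

Section Cocycle.
Variables (K : fieldType) (I J : finType) (g : I -> K) (lam : J -> I -> K)
  (ltJ : rel J).
Hypothesis char0 : forall n, n.+1%:R != 0 :> K.
Hypothesis intg : forall c c', exists n : int, pairing g (lam c) (lam c') = n%:~R.
Hypothesis ltJ_irr : irreflexive ltJ.
Hypothesis ltJ_total : forall c c', c != c' -> ltJ c c' = ~~ ltJ c' c.

Local Notation L := {ffun J -> int}.
Local Notation mom := (momentum lam).

Definition gram c c' : int := intpart (pairing g (lam c) (lam c')).

Lemma gramE c c' : pairing g (lam c) (lam c') = (gram c c')%:~R.
Proof. by rewrite /gram; have [n ->] := intg c c'; rewrite intpartE. Qed.

Lemma gramC c c' : gram c c' = gram c' c.
Proof. by rewrite /gram pairingC. Qed.

Definition lform (l l' : L) : int := \sum_c \sum_c' l c * l' c' * gram c c'.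

Lemma pairing_lform l l' : pairing g (mom l) (mom l') = (lform l l')%:~R.
Proof.
rewrite /lform rmorph_sum /=.
under [RHS]eq_bigr => c _.
  rewrite rmorph_sum /=.
  under eq_bigr do rewrite !intrM -gramE.
  over.
transitivity (\sum_a \sum_c \sum_c'
    (l c)%:~R * lam c a * g a * ((l' c')%:~R * lam c' a)).
  by apply: eq_bigr => a _; rewrite mulr_suml big_distrlr.
rewrite exchange_big; apply: eq_bigr => c _.
rewrite exchange_big; apply: eq_bigr => c' _ /=.
rewrite /pairing.
by rewrite mulr_sumr; apply: eq_bigr => a _; ring.
Qed.

Lemma intpart_lform l l' : intpart (pairing g (mom l) (mom l')) = lform l l'.
Proof. by rewrite pairing_lform intpartE. Qed.

Definition odd_int (z : int) : bool := odd `|z|%N.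

Lemma odd_intD : {morph odd_int : x y / x + y >-> x + y}.
Proof. by move=> x y; rewrite /odd_int -[RHS]/(_ (+) _); lia. Qed.

Lemma odd_intM : {morph odd_int : x y / x * y >-> x * y}.
Proof. by move=> x y; rewrite /odd_int abszM oddM. Qed.

Lemma odd_int_sum (T : Type) (r : seq T) (P : pred T) (f : T -> int) :
  odd_int (\sum_(i <- r | P i) f i) = \sum_(i <- r | P i) odd_int (f i) :> bool.
Proof. exact: (big_morph odd_int odd_intD). Qed.

Lemma signz (z : int) : (-1) ^ z = (-1) ^+ odd_int z :> K.
Proof.
rewrite /odd_int signr_odd; case: z => [n|n] //=.
by rewrite NegzE -exprnN /= -signr_odd invr_sign.
Qed.

(** The exponent of the cocycle, with [bool] as the field of two elements: identities between signs
    become ring computations. *)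
Definition cocycle_exp (l l' : L) : bool := \sum_c \sum_(c' | ltJ c' c)
  odd_int (l c) * odd_int (l' c') *
    (odd_int (gram c c') + odd_int (gram c c) * odd_int (gram c' c')).

Lemma cocycleE l l' : cocycle g lam ltJ l l' = (-1) ^+ cocycle_exp l l'.
Proof.
have sD : {morph (fun b : bool => (-1) ^+ b : K) : x y / x + y >-> x * y}.
  by move=> x y; rewrite -signr_addb.
have s0 : (-1) ^+ (0 : bool)%R = 1 :> K by [].
rewrite /cocycle_exp (big_morph (fun b : bool => (-1) ^+ b : K) sD s0).
apply: eq_bigr => c _.
rewrite (big_morph (fun b : bool => (-1) ^+ b : K) sD s0).
by apply: eq_bigr => c' _; rewrite signz !(odd_intM, odd_intD).
Qed.

Lemma bool2 (b : bool) : b + b = 0.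
Proof. by case: b. Qed.

Lemma cocycle_expDr l l1 l2 :
  cocycle_exp l (l1 + l2) = cocycle_exp l l1 + cocycle_exp l l2.
Proof.
rewrite -big_split; apply: eq_bigr => c _; rewrite -big_split; apply: eq_bigr => c' _.
by rewrite ffunE odd_intD [odd_int (l c) * (_ + _)]mulrDr mulrDl.
Qed.

(** Off-diagonal terms cancel in pairs modulo 2. *)
Lemma sum_sym (f : J -> J -> bool) : (forall c c', f c c' = f c' c) ->
  \sum_c \sum_c' f c c' = \sum_c f c c :> bool.
Proof.
move=> fC.
have E : \sum_c \sum_c' f c c' = \sum_c f c c + \sum_c \sum_(c' | ltJ c' c) f c c'
    + \sum_c \sum_(c' | ltJ c c') f c c' :> bool.
  rewrite -!big_split; apply: eq_bigr => c _ /=.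
  rewrite (bigD1 c) //= -addrA; congr (_ + _).
  rewrite (bigID (fun c' => ltJ c' c)) /=; congr (_ + _); apply: eq_bigl => c'.
    by case: eqP => [->|] //=; rewrite ltJ_irr.
  by case: eqVneq => [->|ne] /=; rewrite ?ltJ_irr // (ltJ_total ne) negbK.
rewrite E [X in _ + X](exchange_big_dep predT) //=.
rewrite -addrA [X in _ + X](_ : _ = 0) ?addr0 //.
rewrite -big_split big1 // => c _ /=.
rewrite -[RHS](bool2 (\sum_(c' | ltJ c' c) f c c')); congr (_ + _).
by apply: eq_bigr => c' _.
Qed.

Lemma odd_lform l l' : odd_int (lform l l') =
  \sum_c \sum_c' odd_int (l c) * odd_int (l' c') * odd_int (gram c c').
Proof.
rewrite /lform odd_int_sum; apply: eq_bigr => c _.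
by rewrite odd_int_sum; apply: eq_bigr => c' _; rewrite !odd_intM.
Qed.

Lemma odd_square (b : bool) : b * b = b. Proof. by case: b. Qed.

Lemma odd_norm l : odd_int (lform l l) =
  \sum_c odd_int (l c) * odd_int (gram c c).
Proof.
rewrite odd_lform sum_sym => [|c c'].
  by apply: eq_bigr => c _; rewrite odd_square.
by rewrite gramC [odd_int (l c) * _]mulrC.
Qed.

(** The cross term is twice $(l,l')$; hence products of fields respect the parity. *)
Lemma odd_normD l l' :
  odd_int (lform (l + l') (l + l')) = odd_int (lform l l) + odd_int (lform l' l').
Proof.
rewrite !odd_norm -big_split; apply: eq_bigr => c _.
by rewrite ffunE odd_intD mulrDl.
Qed.

(** The weights [w] are symmetric and vanish on the diagonal, so that the sum over $c'<c$ and its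
    transpose make up the full double sum, which is bilinear in the charges. *)
Lemma cocycle_expC l l' : cocycle_exp l l' = cocycle_exp l' l +
  (odd_int (lform l l') + odd_int (lform l l) * odd_int (lform l' l')).
Proof.
pose w c c' := odd_int (gram c c') + odd_int (gram c c) * odd_int (gram c' c') : bool.
have E : odd_int (lform l l') + odd_int (lform l l) * odd_int (lform l' l') =
    \sum_c \sum_c' odd_int (l c) * odd_int (l' c') * w c c'.
  rewrite odd_lform !odd_norm mulr_suml -big_split; apply: eq_bigr => c _.
  rewrite mulr_sumr -big_split; apply: eq_bigr => c' _ /=.
  by rewrite /w mulrDr; congr (_ + _); rewrite !mulrA; congr (_ * _); rewrite mulrAC.
rewrite E {E}.
have wC c c' : w c c' = w c' c by rewrite /w gramC [odd_int _ * _]mulrC.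
have w0 c : w c c = 0 by rewrite /w odd_square bool2.
have -> : \sum_c \sum_c' odd_int (l c) * odd_int (l' c') * w c c' =
    cocycle_exp l l' + cocycle_exp l' l.
  have -> : cocycle_exp l' l = \sum_c \sum_(c' | ltJ c c')
      odd_int (l c) * odd_int (l' c') * w c c' :> bool.
    rewrite /cocycle_exp (exchange_big_dep predT) //=.
    apply: eq_bigr => c _; apply: eq_bigr => c' _.
    by rewrite -/(w c' c) wC [odd_int (l' c') * _]mulrC.
  rewrite -big_split; apply: eq_bigr => c _ /=.
  rewrite (bigD1 c) //= w0 mulr0 add0r (bigID (fun c' => ltJ c' c)) /=.
  congr (_ + _); apply: eq_bigl => c'.
    by case: eqP => [->|] //=; rewrite ltJ_irr.
  by case: eqVneq => [->|ne] /=; rewrite ?ltJ_irr // (ltJ_total ne) negbK.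
by rewrite addrCA bool2 addr0.
Qed.

Lemma cocycle0l l : cocycle g lam ltJ 0 l = 1.
Proof.
rewrite /cocycle big1 // => c _; rewrite big1 // => c' _.
by rewrite ffunE !mul0r expr0z.
Qed.

Lemma cocycle0r l : cocycle g lam ltJ l 0 = 1.
Proof.
rewrite /cocycle big1 // => c _; rewrite big1 // => c' _.
by rewrite ffunE mulr0 !mul0r expr0z.
Qed.

(** The condition on weights in [vfield_local]. *)
Lemma cocycle_local l l' gam :
  cocycle g lam ltJ l (gam + l') * cocycle g lam ltJ l' gam =
  (-1) ^+ (odd_int (lform l l) && odd_int (lform l' l')) * (-1) ^+ `|lform l l'| *
  (cocycle g lam ltJ l' (gam + l) * cocycle g lam ltJ l gam).
Proof.
rewrite !cocycleE -[(-1) ^+ `|_|]signr_odd -!signr_addb.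
rewrite -/(odd_int (lform l l')); congr (_ ^+ nat_of_bool _).
rewrite !cocycle_expDr [in LHS](cocycle_expC l l').
by move: (cocycle_exp _ _) (cocycle_exp _ _) (cocycle_exp _ _) (odd_int _) (odd_int _)
  (odd_int _) => [] [] [] [] [] [].
Qed.

End Cocycle.

(** Gives the vacuum axiom and, later, the identity on the tensor factor that a screening charge
    does not involve. *)
Lemma V_zero (K : fieldType) (I : finType) (g : I -> K) (L : zmodType)
    (mom : L -> I -> K) (M : Type) (m1 : M) (mx : I -> nat -> M -> M)
    (X : lmodType K) (vec : L -> M -> X) (coef : L -> M -> X -> K)
    (b : I -> int -> X -> X) (sh : L -> X -> X) (dg : (L -> K) -> X -> X)
    (V : (I -> K) -> L -> int -> X -> X)
    (F : fock_space g mom m1 mx vec coef b sh dg)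
    (Vl : forall mu s e, lin (V mu s e))
    (V_vec : forall mu s e gam m, V mu s e (vec gam m) =
      sh s (dressed b mu (e - intpart (pairing g mu (mom gam))) (vec gam m)))
    mu s e x : (forall a, mu a = 0) -> V mu s e x = if e == 0 then sh s x else 0.
Proof.
move=> mu0; have char0 := fs_char F.
have cre0 k v : cre b mu k v = 0.
  by rewrite creE big1 // => a _; rewrite mu0 mul0r scale0r.
have ann0 k v : ann b mu k v = 0.
  by rewrite annE big1 // => a _; rewrite mu0 oppr0 mul0r scale0r.
have sl := fs_sh_lin F s.
apply: (fs_ext F (Vl _ _ _) (lin_if _ sl (@lin_zero _ _ _))) => gam m.
have -> : V mu s e (vec gam m) = sh s (dressed b mu e (vec gam m)).
  rewrite V_vec; have -> : pairing g mu (mom gam) = 0%:~R.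
    by rewrite /pairing big1 // => a _; rewrite mu0 !mul0r.
  by rewrite intpartE // subr0.
have pE i : expp b mu i (vec gam m) = if i == 0 then vec gam m else 0.
  by apply: (exps_fixed char0 (ann_lin F mu) (ann_comm F mu mu)) => k; exact: ann0.
have mE i : expm b mu i (vec gam m) = if i == 0 then vec gam m else 0.
  by apply: (exps_fixed char0 (cre_lin F mu) (cre_comm F mu mu)) => k; exact: cre0.
rewrite /dressed (@fsum_single _ _ 0%N) => [|i i0].
  by rewrite addr0 pE mE; case: eqP => // _; rewrite (lin0 sl).
by rewrite pE eqz_nat (negPf i0) (lin0 (expm_lin F _ _)).
Qed.

(** * The lattice vertex superalgebra *)

Section LatticeVertexAlgebra.
Variables (K : fieldType) (I J : finType) (g : I -> K) (lam : J -> I -> K)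
  (ltJ : rel J).
Hypothesis char0 : forall n, n.+1%:R != 0 :> K.
Hypothesis g_neq0 : forall a, g a != 0.
Hypothesis intg : forall c c', exists n : int, pairing g (lam c) (lam c') = n%:~R.
Hypothesis ltJ_irr : irreflexive ltJ.
Hypothesis ltJ_total : forall c c', c != c' -> ltJ c c' = ~~ ltJ c' c.

Local Notation A := (latticeVA g lam ltJ).
Local Notation X := (latspace K I J).
Local Notation mom := (momentum lam).
Local Notation hs := (fheis g lam).
Local Notation lf := (lform g lam).
Local Notation vf := (vfield mom (@fdiag K I J) (fvert g lam)).
Local Notation sf := (sfield mom hs (@fdiag K I J) (fvert g lam)).
Local Notation coc := (cocycle g lam ltJ).

Let F := lattice_fock lam char0 g_neq0.
Let Vl := @fvert_lin K I J g lam.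
Let Vv := @fvert_vec K I J g lam char0 g_neq0.

Lemma coc_integral l : integral_on g mom (coc l) l.
Proof. by move=> gam _; rewrite pairing_lform // intpartE. Qed.

Lemma vf_local l l' :
  local ((-1) ^+ (odd_int (lf l l) && odd_int (lf l' l')))
    (vf (coc l) l) (vf (coc l') l').
Proof.
apply: (vfield_local F Vl Vv (S := lf l l')).
- exact: sign_sqr.
- exact: coc_integral.
- exact: coc_integral.
- exact: pairing_lform.
- by move=> gam; exact: cocycle_local.
Qed.

Lemma sf_local l m l' m' :
  local ((-1) ^+ (odd_int (lf l l) && odd_int (lf l' l')))
    (sf (coc l) l m) (sf (coc l') l' m').
Proof.
by apply: (sfield_local F Vl Vv); [exact: sign_sqr | exact: vf_local].
Qed.

Lemma sf_creates l m : creates (fvec K 0 mone) (sf (coc l) l (monomial_list m)) (fvec K l m).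
Proof.
have := sfield_creates F Vl Vv (coc l) l (monomial_list m).
by rewrite cocycle0r scale1r monomial_listK.
Qed.

Lemma vparE b : vpar (v := A) b = odd_int (lf b.1 b.1).
Proof. by rewrite /vpar /= intpart_lform. Qed.

Lemma hpartE p (u : X) : hpart (A := A) p u =
  fdiag (fun gam => (odd_int (lf gam gam) == p)%:R) u.
Proof.
have hl : lin (hpart (A := A) p : X -> X) by exact: linext_lin.
apply: (fext hl (@fdiag_lin K I J _)) => gam m; rewrite fdiag_vec fvecE.
rewrite /hpart linextU vparE /=.
by case: eqP; rewrite ?scale1r ?scale0r.
Qed.

Lemma state_field_vac n v : state_field g lam ltJ (0, mone) n v =
  if n == -1 then v else 0.
Proof.
rewrite state_fieldE /monomial_list mdom1 /= /vfield.
have -> : fdiag (coc 0) v = v.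
  have -> : coc 0 = fun=> 1 by apply/funext => l; exact: cocycle0l.
  by rewrite (dgc F) scale1r.
rewrite (V_zero F Vl Vv); last by move=> a; exact: (mom0 F).
have -> : (- n - 1 == 0) = (n == -1) by apply/eqP/eqP; lia.
case: eqP => // _; apply: (fext (@fshift_lin K I J 0) (@lin_id _ _)) => gam m.
by rewrite fshift_vec addr0.
Qed.

Lemma lattice_vsa : vertex_superalgebra (A := A) setT.
Proof.
apply: (@vsa_of_fields K A (state_field g lam ltJ) (0, mone) (transl g hs)).
- by [].
- by [].
- by rewrite vparE /lform big1 // => c _; rewrite big1 // => c' _; rewrite ffunE !mul0r.
- by move=> b; rewrite state_fieldE; exact: (sfield_field F Vl Vv).
- by move=> b b'; rewrite !state_fieldE !vparE; exact: sf_local.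
- move=> [l m]; rewrite state_fieldE /=.
  by have := sf_creates l m; rewrite !fvecE.
- exact: (transl_lin F).
- by have := transl_v0 F; rewrite fvecE.
- by move=> b; rewrite state_fieldE; apply: (sfield_covariant F Vl Vv); exact: coc_integral.
- exact: state_field_vac.
- move=> b p n v; rewrite !hpartE state_fieldE vparE (dg_sfield F Vl Vv).
  congr (sf _ _ _ _ (fdiag _ v)); apply/funext => gam.
  rewrite (odd_normD g lam ltJ_irr ltJ_total) -[_ + _]/(_ (+) _).
  by case: (odd_int _); case: (odd_int _); case: p.
Qed.

End LatticeVertexAlgebra.

Lemma lin_sum_eq0 (K : fieldType) (X Z : lmodType K) (f : X -> Z) (T : Type)
    (r : seq T) (y : T -> X) x :
  lin f -> x = \sum_(i <- r) y i -> (forall i, f (y i) = 0) -> f x = 0.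
Proof. by move=> fl -> y0; rewrite (lin_sum fl) big1. Qed.

(** * Kernels of screening operators *)

Section Intertwiners.
Variables (K : fieldType) (I : finType) (X X' : lmodType K) (f : X -> X').
Hypothesis fl : lin f.

Lemma exps_map (A : nat -> X -> X) (A' : nat -> X' -> X') j x :
  (forall k y, f (A k.+1 y) = A' k.+1 (f y)) -> f (exps A j x) = exps A' j (f x).
Proof.
move=> fA; case: j => [j|j]; last by rewrite (lin0 fl).
rewrite /exps (lin_sum fl); apply: eq_bigr => r _; rewrite (linZ fl); congr (_ *: _).
move: (nat_of_ord r) => k {r}; elim: k j x => [|k IH] j x /=; first by case: eqP => // _; rewrite (lin0 fl).
by rewrite (lin_sum fl); apply: eq_bigr => i _; rewrite fA IH.
Qed.

Lemma nprod_map e r (A B : int -> X -> X) (A' B' : int -> X' -> X') m x :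
  is_field A -> is_field B -> (forall n y, f (A n y) = A' n (f y)) ->
  (forall n y, f (B n y) = B' n (f y)) -> f (nprod e r A B m x) = nprod e r A' B' m (f x).
Proof.
move=> Af Bf fA fB; rewrite /nprod (lin_fsum fl (nprod_fin_sub e r m x Af Bf)).
apply: eq_fsum => j; rewrite (linZ fl) (linB fl) (linZ fl).
by rewrite !fA !fB !fA.
Qed.

Variables (b : I -> int -> X -> X) (b' : I -> int -> X' -> X').
Hypothesis fb : forall a n x, n != 0 -> f (b a n x) = b' a n (f x).

(** The exponentials contain no zero modes, so that maps changing the momenta still intertwine
    them. *)
Lemma expm_map mu j x : f (expm b mu j x) = expm b' mu j (f x).
Proof.
apply: exps_map => k y; rewrite !creE (lin_sum fl).
by apply: eq_bigr => a _; rewrite (linZ fl) fb.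
Qed.

Lemma expp_map mu j x : f (expp b mu j x) = expp b' mu j (f x).
Proof.
apply: exps_map => k y; rewrite !annE (lin_sum fl).
by apply: eq_bigr => a _; rewrite (linZ fl) fb.
Qed.

Lemma dressed_map mu d x :
  fin (fun i : nat => expm b mu (d + i%:Z) (expp b mu i x)) ->
  f (dressed b mu d x) = dressed b' mu d (f x).
Proof.
move=> fd; rewrite /dressed (lin_fsum fl fd); apply: eq_fsum => i.
by rewrite expm_map expp_map.
Qed.

End Intertwiners.

Lemma sum_option (V : nmodType) (J : finType) (h : option J -> V) :
  \sum_o h o = h None + \sum_c h (Some c).
Proof.
rewrite (bigD1 None) //=; congr (_ + _).
rewrite (reindex_omap Some id) => [|[c|] //]; apply: eq_bigl => c.
by rewrite eqxx.
Qed.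

(** * A screening operator as a mode in an enlarged lattice *)

Section Screening.
Variables (K : fieldType) (I J : finType) (g : I -> K) (lam : J -> I -> K)
  (ltJ : rel J) (mu : I -> K).
Hypothesis char0 : forall n, n.+1%:R != 0 :> K.
Hypothesis g_neq0 : forall a, g a != 0.
Hypothesis intg : forall c c', exists n : int, pairing g (lam c) (lam c') = n%:~R.
Hypothesis ltJ_irr : irreflexive ltJ.
Hypothesis ltJ_total : forall c c', c != c' -> ltJ c c' = ~~ ltJ c' c.
Hypothesis intmu : forall c, exists n : int, pairing g mu (lam c) = n%:~R.

Local Notation A := (latticeVA g lam ltJ).
Local Notation X := (latspace K I J).
Local Notation L := {ffun J -> int}.
Local Notation mom := (momentum lam).
Local Notation hs := (fheis g lam).
Local Notation lf := (lform g lam).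
Local Notation vf := (vfield mom (@fdiag K I J) (fvert g lam)).
Local Notation sf := (sfield mom hs (@fdiag K I J) (fvert g lam)).
Local Notation coc := (cocycle g lam ltJ).
Local Notation vec := (@fvec K I J).

Let F := lattice_fock lam char0 g_neq0.
Let Vl := @fvert_lin K I J g lam.
Let Vv := @fvert_vec K I J g lam char0 g_neq0.

(* The module Pi_mu is realised inside the space of a larger lattice, with one
   more generator, of momentum mu: this generator has no integrality property with
   itself, so that its vertex operator is only used on the charges not involving
   it. *)
Definition lam_ext (o : option J) : I -> K := if o is Some c then lam c else mu.

Local Notation X' := (latspace K I (option J)).
Local Notation L' := {ffun option J -> int}.
Local Notation mom' := (momentum lam_ext).
Local Notation hs' := (fheis g lam_ext).
Local Notation vf' := (vfield mom' (@fdiag K I (option J)) (fvert g lam_ext)).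
Local Notation sf' := (sfield mom' hs' (@fdiag K I (option J)) (fvert g lam_ext)).
Local Notation vec' := (@fvec K I (option J)).

Let F' := lattice_fock lam_ext char0 g_neq0.
Let Vl' := @fvert_lin K I (option J) g lam_ext.
Let Vv' := @fvert_vec K I (option J) g lam_ext char0 g_neq0.

Definition charge_ext (i : int) (l : L) : L' :=
  [ffun o => if o is Some c then l c else i].
Definition charge_res (l : L') : L := [ffun c => l (Some c)].

Lemma charge_extK i l : charge_res (charge_ext i l) = l.
Proof. by apply/ffunP => c; rewrite !ffunE. Qed.

Lemma charge_resD l l' : charge_res (l + l') = charge_res l + charge_res l'.
Proof. by apply/ffunP => c; rewrite !ffunE. Qed.

Lemma charge_extD i l i' l' :
  charge_ext i l + charge_ext i' l' = charge_ext (i + i') (l + l').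
Proof. by apply/ffunP => -[c|]; rewrite !ffunE. Qed.

Lemma mom_ext l a : mom' l a = (l None)%:~R * mu a + mom (charge_res l) a.
Proof.
rewrite /momentum sum_option; congr (_ + _).
by apply: eq_bigr => c _; rewrite ffunE.
Qed.

Lemma mom_ext0 l : mom' (charge_ext 0 l) = mom l.
Proof. by apply/funext => a; rewrite mom_ext charge_extK ffunE mul0r add0r. Qed.

Lemma mom_ext1 : mom' (charge_ext 1 0) = mu.
Proof.
by apply/funext => a; rewrite mom_ext charge_extK ffunE mul1r (mom0 F) addr0.
Qed.

Fact embed_sig : {f : int -> X -> X' | (forall i, lin (f i)) /\
  forall i l m, f i (vec l m) = vec' (charge_ext i l) m}.
Proof.
exists (fun i => linext (fun b : latbasis I J => vec' (charge_ext i b.1) b.2)).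
split=> [i|i l m]; first exact: linext_lin.
by rewrite fvecE; exact: linextU.
Qed.

Definition embed := sval embed_sig.

Lemma embed_lin i : lin (embed i).
Proof. exact: (proj1 (svalP embed_sig) i). Qed.

Lemma embed_vec i l m : embed i (vec l m) = vec' (charge_ext i l) m.
Proof. exact: (proj2 (svalP embed_sig) i). Qed.

Lemma embed_inj i x : embed i x = 0 -> x = 0.
Proof.
move=> x0; apply: (fs_coef_ext F) => gam m.
have -> : fcoef gam m x = fcoef (charge_ext i gam) m (embed i x).
  apply: (fext (Z := K^o) (@fcoef_lin K I J gam m)
    (lin_comp (@fcoef_lin K I (option J) _ m) (embed_lin i))) => gam' m'.
  rewrite embed_vec !fcoef_vec; congr (_ && _)%:R.
  by apply/eqP/eqP => [->|/(congr1 charge_res)]; rewrite ?charge_extK.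
by rewrite x0 (lin0 (@fcoef_lin K I (option J) _ m)).
Qed.

Lemma embed_b i a n x : n != 0 -> embed i (hs a n x) = hs' a n (embed i x).
Proof.
move=> n0; apply: (fext (lin_comp (embed_lin i) (fheis_lin g lam a n))
  (lin_comp (fheis_lin g lam_ext a n) (embed_lin i))) => gam m.
by rewrite embed_vec; case: n n0 => [[|n]|n] // _;
  rewrite ?fheisN ?fheisP ?(linZ (embed_lin i)) embed_vec.
Qed.

Lemma embed_b0 a n x : embed 0 (hs a n x) = hs' a n (embed 0 x).
Proof.
have [->|n0] := eqVneq n 0; last exact: embed_b.
apply: (fext (lin_comp (embed_lin 0) (fheis_lin g lam a 0))
  (lin_comp (fheis_lin g lam_ext a 0) (embed_lin 0))) => gam m.
by rewrite embed_vec !fheis0 (linZ (embed_lin 0)) embed_vec mom_ext0.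
Qed.

(** The operator may raise the coordinate along the new generator from 0 to [i], whence different
    embeddings on the two sides. *)
Lemma embed_vert i nu s e x :
  embed i (fvert g lam nu s e x) = fvert g lam_ext nu (charge_ext i s) e (embed 0 x).
Proof.
apply: (fext (lin_comp (embed_lin i) (Vl nu s e))
  (lin_comp (Vl' nu (charge_ext i s) e) (embed_lin 0))) => gam m.
have shE y : embed i (fshift s y) = fshift (charge_ext i s) (embed 0 y).
  apply: (fext (lin_comp (embed_lin i) (@fshift_lin K I J s))
    (lin_comp (@fshift_lin K I (option J) _) (embed_lin 0))) => gam' m'.
  by rewrite fshift_vec !embed_vec fshift_vec charge_extD add0r.
rewrite Vv shE (dressed_map (embed_lin 0) (fun a n y n0 => embed_b0 a n y)).
  by rewrite embed_vec Vv' mom_ext0.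
exact: (@dressed_fin _ _ _ _ _ _ _ _ _ _ _ _ _ _ F nu _
  (fun i d => expm hs nu (d + i%:Z)) _ (fun _ _ => expm_lin F _ _)).
Qed.

Definition lift_cocycle (c : L -> K) (l : L') : K := c (charge_res l).

Lemma embed_vfield c s n x :
  embed 0 (vf c s n x) = vf' (lift_cocycle c) (charge_ext 0 s) n (embed 0 x).
Proof.
rewrite /vfield embed_vert mom_ext0; congr (fvert _ _ _ _ _ _).
apply: (fext (lin_comp (embed_lin 0) (@fdiag_lin K I J c))
  (lin_comp (@fdiag_lin K I (option J) _) (embed_lin 0))) => gam m.
by rewrite fdiag_vec (linZ (embed_lin 0)) embed_vec fdiag_vec /lift_cocycle charge_extK.
Qed.

Lemma embed_sfield c s l n x :
  embed 0 (sf c s l n x) = sf' (lift_cocycle c) (charge_ext 0 s) l n (embed 0 x).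
Proof.
elim: l n x => [|y l IH] n x; first exact: embed_vfield.
rewrite /=; apply: (nprod_map (embed_lin 0)).
- exact: (b_field F).
- exact: (sfield_field F Vl Vv).
- by move=> k z; exact: embed_b0.
- exact: IH.
Qed.

Definition mu_gram (l : L) : int := \sum_c l c * intpart (pairing g mu (lam c)).

Lemma pairing_mu l : pairing g mu (mom l) = (mu_gram l)%:~R.
Proof.
transitivity (\sum_a \sum_c mu a * g a * ((l c)%:~R * lam c a)).
  by apply: eq_bigr => a _; rewrite mulr_sumr.
rewrite exchange_big /mu_gram rmorph_sum; apply: eq_bigr => c _; rewrite /= intrM.
have [n En] := intmu c; rewrite En intpartE // -En /pairing mulr_sumr.
by apply: eq_bigr => a _; ring.
Qed.

Definition screen_weight (l : L') : K := (l None == 0)%:R.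

Local Notation delta := (charge_ext 1 0).
Local Notation VN := (vf' screen_weight delta).
Local Notation Y' l m := (sf' (lift_cocycle (coc l)) (charge_ext 0 l) m).

Lemma screen_integral : integral_on g mom' screen_weight delta.
Proof.
move=> gam; rewrite /screen_weight; case: (gam None =P 0) => [gN _|_ /eqP] //.
have -> : mom' gam = mom (charge_res gam).
  by apply/funext => a; rewrite mom_ext gN mul0r add0r.
by rewrite mom_ext1 pairing_mu intpartE.
Qed.

(** Integrality can fail only for the pairing of [mu] with itself, and [l] does not involve [mu]. *)
Lemma lift_integral l : integral_on g mom' (lift_cocycle (coc l)) (charge_ext 0 l).
Proof.
move=> gam _; rewrite mom_ext0.
have -> : pairing g (mom l) (mom' gam) =
    (gam None * mu_gram l + lf l (charge_res gam))%:~R.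
  pose nu a := (gam None)%:~R * mu a.
  have -> : mom' gam = fun a => nu a + mom (charge_res gam) a.
    by apply/funext => a; rewrite mom_ext.
  rewrite pairingDr intrD pairing_lform //; congr (_ + _).
  rewrite intrM -pairing_mu /pairing mulr_sumr.
  by apply: eq_bigr => a _; rewrite /nu; ring.
by rewrite intpartE.
Qed.

Lemma lift_local l m l' m' :
  local ((-1) ^+ (odd_int (lf l l) && odd_int (lf l' l'))) (Y' l m) (Y' l' m').
Proof.
apply: (sfield_local F' Vl' Vv'); first exact: sign_sqr.
apply: (vfield_local F' Vl' Vv' (S := lf l l')).
- exact: sign_sqr.
- exact: lift_integral.
- exact: lift_integral.
- by rewrite !mom_ext0; exact: pairing_lform.
- by move=> gam; rewrite /lift_cocycle !charge_resD !charge_extK; exact: cocycle_local.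
Qed.

Lemma abs_sign_sqr (n : nat) : (-1) ^+ n * (-1) ^+ n = 1 :> K.
Proof. by rewrite -exprD addnn -mul2n exprM sqrrN !expr1n. Qed.

(** The new generator carries no cocycle, so that the sign of $(z-w)^{(\mu,l)}$ under exchange of
    the variables is itself the commutation sign. *)
Lemma screen_local l m : local ((-1) ^+ `|mu_gram l|) VN (Y' l m).
Proof.
apply: (sfield_local F' Vl' Vv' [::]); first exact: abs_sign_sqr.
apply: (vfield_local F' Vl' Vv' (S := mu_gram l)).
- exact: abs_sign_sqr.
- exact: screen_integral.
- exact: lift_integral.
- by rewrite mom_ext1 mom_ext0 pairing_mu.
- move=> gam; rewrite abs_sign_sqr mul1r /screen_weight /lift_cocycle.
  by rewrite charge_resD charge_extK addr0 !ffunE addr0 mulrC.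
Qed.

Lemma lift_creates l m :
  creates (vec' 0 mone) (Y' l (monomial_list m)) (vec' (charge_ext 0 l) m).
Proof.
have := sfield_creates F' Vl' Vv' (lift_cocycle (coc l)) (charge_ext 0 l) (monomial_list m).
rewrite monomial_listK /lift_cocycle (_ : charge_res 0 = 0) ?cocycle0r ?scale1r //.
by apply/ffunP => c; rewrite !ffunE.
Qed.

Lemma screeningE x : embed 1 (screening (g := g) (lam := lam) (ltJ := ltJ) mu x)
  = VN 0 (embed 0 x).
Proof.
rewrite /screening -fvertE embed_vert /vfield mom_ext1; congr (fvert _ _ _ _ _ _).
apply: (fext (embed_lin 0) (lin_comp (@fdiag_lin K I (option J) _) (embed_lin 0))).
move=> gam m; rewrite embed_vec fdiag_vec /screen_weight ffunE eqxx.
by rewrite scale1r.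
Qed.

Section HomogeneousCharge.
Variables (s : L) (u : X).
Hypothesis us : forall b, b \in msupp u -> b.1 = s.

(** The field of [u] on the enlarged space. As [u] has a single charge, all its terms have the same
    commutation sign with the screening current. *)
Definition lift_field (n : int) (x : X') : X' :=
  \sum_(b <- msupp u) u@_b *: Y' b.1 (monomial_list b.2) n x.

Lemma lift_field_field : is_field lift_field.
Proof. by apply: field_sum => b; exact: (sfield_field F' Vl' Vv'). Qed.

Lemma embed_vprod n v : embed 0 (vprod (v := A) u n v) = lift_field n (embed 0 v).
Proof.
rewrite -[vprod _ _ _]/(\sum_(b <- msupp u) u@_b *: state_field g lam ltJ b n v).
rewrite (lin_sum (embed_lin 0)); apply: eq_bigr => b _.
by rewrite (linZ (embed_lin 0)) state_fieldE embed_sfield.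
Qed.

Lemma lift_field_local l m :
  local ((-1) ^+ (odd_int (lf s s) && odd_int (lf l l))) lift_field (Y' l m).
Proof.
apply: local_sum => [|b bu]; first exact: (sfield_field F' Vl' Vv').
by rewrite -(us bu); exact: lift_local.
Qed.

Lemma screen_lift_local : local ((-1) ^+ `|mu_gram s|) VN lift_field.
Proof.
apply: local_sym; first exact: abs_sign_sqr.
apply: local_sum => [|b bu]; first exact: (vfield_field F' Vl' Vv').
by rewrite -(us bu); apply: local_sym; [exact: abs_sign_sqr | exact: screen_local].
Qed.

Hypothesis Qu : screening (g := g) (lam := lam) (ltJ := ltJ) mu u = 0.

Lemma lift_field_creates : creates (vec' 0 mone) lift_field (embed 0 u).
Proof.
move=> n n1; rewrite /lift_field.
have -> : embed 0 u = \sum_(b <- msupp u) u@_b *: vec' (charge_ext 0 b.1) b.2.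
  rewrite [in LHS](malg_basis u) (lin_sum (embed_lin 0)); apply: eq_bigr => b _.
  by rewrite (linZ (embed_lin 0)) -embed_vec fvecE -surjective_pairing.
case: eqP => [->|nn].
  by apply: eq_bigr => b _; rewrite lift_creates // eqxx.
by rewrite big1 // => b _; rewrite lift_creates //; case: eqP => //; rewrite scaler0.
Qed.

Local Notation e_ := ((-1) ^+ `|mu_gram s|).

Lemma VN_lin n : lin (VN n).
Proof. exact: (vfield_lin F' Vl'). Qed.

(* The residue of V_mu(z) Y(u, w) 1 is exp(w T) applied to the residue on u. *)
Lemma screen_vacuum n : VN 0 (lift_field n (vec' 0 mone)) = 0.
Proof.
have [n1|n1] := leP (-1) n.
  rewrite lift_field_creates //; case: eqP => _; last exact: (lin0 (VN_lin 0)).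
  by rewrite -screeningE Qu (lin0 (embed_lin 1)).
have [k ->] : exists k : nat, n = - k.+1%:Z by exists `|(n + 1)%R|%N; lia.
elim: {n n1} k => [|k IH].
  rewrite lift_field_creates // -screeningE Qu; exact: (lin0 (embed_lin 1)).
have TY : covariant (transl g hs') lift_field.
  move=> n x; rewrite /lift_field (lin_sum (transl_lin F')) scaler_sumr -sumrB.
  apply: eq_bigr => b _; rewrite (linZ (transl_lin F')).
  rewrite (sfield_covariant F' Vl' Vv' _ (@lift_integral b.1)).
  by rewrite scalerBr !scalerA [u@_b * _]mulrC.
have TV := transl_vfield F' Vl' Vv' screen_integral.
have := TV 0 (lift_field (- k.+1%:Z) (vec' 0 mone)).
rewrite IH TY (transl_v0 F') mulr0z scale0r subr0 (lin0 (transl_lin F')).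
rewrite (lin0 (field_lin lift_field_field _)) sub0r.
rewrite (linN (VN_lin 0)) (linZ (VN_lin 0)) mulrNz scaleNr opprK => /esym/eqP.
rewrite scaler_eq0 (negPf (char0 k)) /= => /eqP E.
by have -> : - k.+2%:Z = - k.+1%:Z - 1 by lia.
Qed.

Lemma screen_commutes n v :
  VN 0 (lift_field n (embed 0 v)) = e_ *: lift_field n (VN 0 (embed 0 v)).
Proof.
have VNf : is_field VN by exact: (vfield_field F' Vl' Vv').
(* For $r=0$ the modes of the product are the supercommutators with the residue, so that Dong's
   lemma makes them local to all fields of states and [uniqueness] applies. *)
pose D := nprod e_ 0 VN lift_field.
have DE m x : D m x = VN 0 (lift_field m x) - e_ *: lift_field m (VN 0 x).
  rewrite /D /nprod (@fsum_single _ _ 0%N) => [|[|j] // _]; last by rewrite nbin0S scale0r.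
  rewrite nbinr0 scale1r (_ : m + 0%N%:Z = m); last exact: addr0.
  by rewrite expr0 mulr1.
have Df : is_field D by apply: nprod_field => //; exact: lift_field_field.
have D0 m : D m (vec' 0 mone) = 0.
  have V0 : VN 0 (vec' 0 mone) = 0 by rewrite (vfield_creates F' Vl' Vv').
  rewrite DE screen_vacuum V0.
  by rewrite (lin0 (field_lin lift_field_field _)) scaler0 subr0.
suff : D n (embed 0 v) = 0 by rewrite DE => /eqP; rewrite subr_eq0 => /eqP.
apply: (fext (lin_comp (field_lin Df n) (embed_lin 0)) (@lin_zero _ _ _)) => l m.
rewrite embed_vec.
apply: (uniqueness Df (sfield_field F' Vl' Vv' (lift_cocycle (coc l)) (charge_ext 0 l)
  (monomial_list m)) D0 _ (lift_creates l m)).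
apply: dong; [exact: VNf | exact: lift_field_field | exact: (sfield_field F' Vl' Vv')
  | exact: screen_lift_local | exact: screen_local | exact: lift_field_local].
Qed.

End HomogeneousCharge.

Local Notation Q := (screening (g := g) (lam := lam) (ltJ := ltJ) mu).

Lemma screening_lin : lin (Q : X -> X).
Proof. by move=> c x y; rewrite /screening -!fvertE; exact: Vl. Qed.

Lemma screening_diag f x : Q (fdiag f x) = fdiag f (Q x) :> X.
Proof.
rewrite /screening -!fvertE (V_dg F Vl Vv); congr (fvert _ _ _ _ _ (fdiag _ x)).
by apply/funext => l; rewrite addr0.
Qed.

Lemma fcoef_diag (f : L -> K) (x : X) (l : L) m : fcoef l m (fdiag f x) = f l * fcoef l m x.
Proof.
apply: (fext (Z := K^o) (lin_comp (@fcoef_lin K I J l m) (@fdiag_lin K I J f))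
  (lin_scale (f l) (@fcoef_lin K I J l m))) => l' m'.
rewrite fdiag_vec (linZ (@fcoef_lin K I J l m)) fcoef_vec.
by case: eqP => [->|_]; rewrite ?scaler0.
Qed.

Lemma diag_sum (x : X) : x = \sum_(s <- undup [seq b.1 | b <- msupp x])
  fdiag (fun l => (l == s)%:R) x.
Proof.
have cl l m := @fcoef_lin K I J l m.
apply/eqP; rewrite -subr_eq0; apply/eqP; apply: (fs_coef_ext F) => l m.
rewrite (linB (cl l m)) (lin_sum (cl l m)) /=.
under eq_bigr do rewrite fcoef_diag.
have [lx|lx] := boolP (l \in undup [seq b.1 | b <- msupp x]).
  rewrite (bigD1_seq l) ?undup_uniq //= eqxx mul1r big1 ?addr0 ?subrr // => s sl.
  by rewrite eq_sym (negPf sl) mul0r.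
have -> : fcoef l m x = 0.
  rewrite fcoefE; apply: mcoeff_outdom; apply: contra lx => bx.
  by rewrite mem_undup; apply/mapP; exists (l, m).
by rewrite big1 ?subr0 // => s _; rewrite mulr0.
Qed.

(** Screening commutes with the projections onto single charges, so that [u] may be taken of one
    charge. *)
Lemma screening_vprod u n v : Q u = 0 -> Q v = 0 -> Q (vprod (v := A) u n v) = 0.
Proof.
move=> Qu Qv.
have vl : lin (fun u : X => vprod (v := A) u n v).
  have -> : (fun u : X => vprod (v := A) u n v) =
    linext (fun b => state_field g lam ltJ b n v) by [].
  exact: linext_lin.
apply: (lin_sum_eq0 (lin_comp screening_lin vl) (diag_sum u)) => s.
set w := fdiag _ u.
have ws b : b \in msupp w -> b.1 = s.
  case: b => l m; rewrite -mcoeff_neq0 -fcoefE fcoef_diag mulf_eq0 negb_or.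
  by case: (l =P s) => [->//|_]; rewrite eqxx.
have Qw : Q w = 0 by rewrite screening_diag Qu (lin0 (@fdiag_lin K I J _)).
apply: (@embed_inj 1); rewrite screeningE embed_vprod.
rewrite (screen_commutes ws Qw) -screeningE Qv (lin0 (embed_lin 1)).
by rewrite (lin0 (field_lin (lift_field_field w) n)) scaler0.
Qed.

Lemma screening_vac : Q (vvac A) = 0.
Proof.
apply: (@embed_inj 1); rewrite screeningE -[vvac A]/(<< (0, mone) >> : X) -fvecE embed_vec.
have -> : charge_ext 0 0 = 0 by apply/ffunP => -[c|]; rewrite !ffunE.
by rewrite (vfield_creates F' Vl' Vv').
Qed.

End Screening.

Section ScreeningKernel.
Variables (K : fieldType) (I J : finType) (g : I -> K) (lam : J -> I -> K)
  (ltJ : rel J).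
Hypothesis char0 : forall n, n.+1%:R != 0 :> K.
Hypothesis g_neq0 : forall a, g a != 0.
Hypothesis intg : forall c c', exists n : int, pairing g (lam c) (lam c') = n%:~R.
Hypothesis ltJ_irr : irreflexive ltJ.
Hypothesis ltJ_total : forall c c', c != c' -> ltJ c c' = ~~ ltJ c' c.

Local Notation A := (latticeVA g lam ltJ).

Lemma screening_kernel_vsa (P : (I -> K) -> Prop) :
  (forall mu, P mu -> forall c, exists n : int, pairing g mu (lam c) = n%:~R) ->
  vertex_superalgebra (A := A)
    [set v | forall mu, P mu -> screening (g := g) (lam := lam) (ltJ := ltJ) mu v = 0]%classic.
Proof.
move=> Pint.
have Ql mu : lin (screening (g := g) (lam := lam) (ltJ := ltJ) mu
    : latspace K I J -> latspace K I J) by exact: screening_lin.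
apply: vsa_sub; first exact: lattice_vsa.
- by move=> mu Pmu; apply: screening_vac => //; exact: Pint.
- move=> c u v Ku Kv mu Pmu; have := Ql mu c u v => ->.
  by rewrite Ku // Kv // scaler0 addr0.
- move=> p u Ku mu Pmu; rewrite hpartE // screening_diag // Ku //.
  exact: (lin0 (@fdiag_lin K I J _)).
- move=> u n v Ku Kv mu Pmu.
  by apply: screening_vprod => //; [exact: Pint | exact: Ku | exact: Kv].
Qed.

End ScreeningKernel.

(** * Splitting of a lattice into two orthogonal parts *)

Section IntegerSums.
Variable K : fieldType.
Variable X : lmodType K.
Implicit Types f h : int -> X.

Definition zsum f : X := \sum_(i \in [set: int]%classic) f i.
Definition zfin f := exists M : nat, forall i : int, (M <= `|i|)%N -> f i = 0.

Lemma eq_zsum f h : f =1 h -> zsum f = zsum h.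
Proof. by move=> fh; apply: eq_fsbigr => i _; apply: fh. Qed.

Lemma zsumE M f : (forall i : int, (M <= `|i|)%N -> f i = 0) ->
  zsum f = \sum_(k < M + M) f (k%:Z - M%:Z).
Proof.
move=> fM; rewrite /zsum.
rewrite (@fsbigE _ 0 _ _ _ [seq k%:Z - M%:Z | k <- iota 0 (M + M)]).
- rewrite big_map -(big_mkord xpredT (fun k => f (k%:Z - M%:Z))) /index_iota subn0.
  by apply: eq_bigl => i; apply: mem_set.
- rewrite map_inj_uniq ?iota_uniq // => i j /addIr; by case.
- by [].
- move=> i _ ir; apply: fM; rewrite leqNgt; apply: contra ir => iM.
  by apply/mapP; exists `|(i + M%:Z)%R|%N; [rewrite mem_iota; lia | lia].
Qed.

Lemma zfin2 f h : zfin f -> zfin h ->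
  exists M : nat, forall i : int, (M <= `|i|)%N -> f i = 0 /\ h i = 0.
Proof.
move=> [M f0] [N h0]; exists (maxn M N) => i; rewrite geq_max => /andP[iM iN].
by split; [apply: f0 | apply: h0].
Qed.

Lemma zsumD f h : zfin f -> zfin h -> zsum (fun i => f i + h i) = zsum f + zsum h.
Proof.
move=> ff fh; have [M fM] := zfin2 ff fh.
rewrite !(@zsumE M) ?big_split // => i /fM [h1 h2]; by rewrite ?h1 ?h2 ?addr0.
Qed.

Lemma zfinZ c f : zfin f -> zfin (fun i => c *: f i).
Proof. by move=> [M fM]; exists M => i /fM ->; rewrite scaler0. Qed.

Lemma zfin_shift k f : zfin f -> zfin (fun i => f (i + k)).
Proof. by move=> [M fM]; exists (M + `|k|)%N => i iM; apply: fM; lia. Qed.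

Lemma zsum_shift k f : zsum f = zsum (fun i => f (i + k)).
Proof.
rewrite /zsum (@reindex_fsbigT _ 0 _ _ _ (fun i : int => i + k)) //.
by exists (fun i => i - k) => i; rewrite ?addrK ?subrK.
Qed.

Lemma zsum_single f i0 : (forall i, i != i0 -> f i = 0) -> zsum f = f i0.
Proof.
move=> f0; rewrite (zsum_shift i0) (@zsumE 1).
  by rewrite !big_ord_recl big_ord0 /= f0 ?add0r ?addr0 //; lia.
by move=> i i1; apply: f0; lia.
Qed.

(** As [J] is uniform in [i], the finitely many remaining supports in [i] have a common bound. *)
Lemma fsum_zsum (f : nat -> int -> X) (J : nat) :
  (forall j i, (J <= j)%N -> f j i = 0) -> (forall j, zfin (f j)) ->
  fsum (fun j => zsum (f j)) = zsum (fun i => fsum (f^~ i)).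
Proof.
move=> fJ fz.
have [M fM] : exists M : nat, forall j i, (M <= `|i|)%N -> f j i = 0.
  suff [M hM] : exists M : nat, forall j i, (j < J)%N -> (M <= `|i|)%N -> f j i = 0.
    by exists M => j i iM; have [/fJ->//|jJ] := leqP J j; apply: hM.
  elim: J {fJ} => [|J [M hM]]; first by exists 0%N.
  have [M' hM'] := fz J; exists (maxn M M') => j i.
  rewrite ltnS leq_eqVlt geq_max => /orP[/eqP->|jJ] /andP[i1 i2]; first exact: hM'.
  exact: hM.
rewrite (@zsumE M) => [|i iM]; last by apply: fsum0 => j; apply: fM.
rewrite (@fsumE _ J) => [|j jJ]; last first.
  by rewrite (@zsumE 0) => [|i _]; [rewrite big_ord0 | apply: fJ].
under [RHS]eq_bigr do rewrite (@fsumE _ J) => [|j /fJ //].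
rewrite exchange_big; apply: eq_bigr => j _ /=.
by rewrite (@zsumE M) => [|i /fM].
Qed.

End IntegerSums.

Lemma zsum_lin (K : fieldType) (X Z : lmodType K) (t : X -> Z) (f : int -> X) :
  lin t -> zfin f -> t (zsum f) = zsum (fun i => t (f i)).
Proof.
move=> tl [M fM]; rewrite (zsumE fM) (lin_sum tl).
by rewrite (@zsumE _ _ M) // => i /fM ->; exact: lin0.
Qed.

Lemma zsumZ (K : fieldType) (X : lmodType K) c (f : int -> X) : zfin f -> zsum (fun i => c *: f i) = c *: zsum f.
Proof. by move=> /(zsum_lin (lin_scale c (@lin_id _ X))) ->. Qed.

(** * Fields on a tensor product of Fock spaces *)

Section Splitting.
Variables (K : fieldType).
Variables (I : finType) (g : I -> K) (L : zmodType)
  (mom : L -> I -> K) (M : Type) (m1 : M) (mx : I -> nat -> M -> M)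
  (X : lmodType K) (vec : L -> M -> X) (coef : L -> M -> X -> K)
  (b : I -> int -> X -> X) (sh : L -> X -> X) (dg : (L -> K) -> X -> X)
  (V : (I -> K) -> L -> int -> X -> X).
Hypothesis F : fock_space g mom m1 mx vec coef b sh dg.
Hypothesis Vl : forall mu s e, lin (V mu s e).
Hypothesis V_vec : forall mu s e gam m, V mu s e (vec gam m) =
  sh s (dressed b mu (e - intpart (pairing g mu (mom gam))) (vec gam m)).

Variables (I1 : finType) (g1 : I1 -> K) (L1 : zmodType)
  (mom1 : L1 -> I1 -> K) (M1 : Type) (m11 : M1) (mx1 : I1 -> nat -> M1 -> M1)
  (X1 : lmodType K) (vec1 : L1 -> M1 -> X1) (coef1 : L1 -> M1 -> X1 -> K)
  (b1 : I1 -> int -> X1 -> X1) (sh1 : L1 -> X1 -> X1) (dg1 : (L1 -> K) -> X1 -> X1)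
  (V1 : (I1 -> K) -> L1 -> int -> X1 -> X1).
Hypothesis F1 : fock_space g1 mom1 m11 mx1 vec1 coef1 b1 sh1 dg1.
Hypothesis Vl1 : forall mu s e, lin (V1 mu s e).
Hypothesis V_vec1 : forall mu s e gam m, V1 mu s e (vec1 gam m) =
  sh1 s (dressed b1 mu (e - intpart (pairing g1 mu (mom1 gam))) (vec1 gam m)).

Variables (I2 : finType) (g2 : I2 -> K) (L2 : zmodType)
  (mom2 : L2 -> I2 -> K) (M2 : Type) (m12 : M2) (mx2 : I2 -> nat -> M2 -> M2)
  (X2 : lmodType K) (vec2 : L2 -> M2 -> X2) (coef2 : L2 -> M2 -> X2 -> K)
  (b2 : I2 -> int -> X2 -> X2) (sh2 : L2 -> X2 -> X2) (dg2 : (L2 -> K) -> X2 -> X2)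
  (V2 : (I2 -> K) -> L2 -> int -> X2 -> X2).
Hypothesis F2 : fock_space g2 mom2 m12 mx2 vec2 coef2 b2 sh2 dg2.
Hypothesis Vl2 : forall mu s e, lin (V2 mu s e).
Hypothesis V_vec2 : forall mu s e gam m, V2 mu s e (vec2 gam m) =
  sh2 s (dressed b2 mu (e - intpart (pairing g2 mu (mom2 gam))) (vec2 gam m)).

Variables (f1 : I1 -> I) (f2 : I2 -> I) (res1 : L -> L1) (res2 : L -> L2)
  (pi : X1 -> X2 -> X).
Hypothesis f_cover : forall a, (exists a1, a = f1 a1) \/ (exists a2, a = f2 a2).
Hypothesis f_sum : forall h : I -> K,
  \sum_a h a = \sum_a h (f1 a) + \sum_a h (f2 a).
Hypothesis gE1 : forall a, g (f1 a) = g1 a.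
Hypothesis gE2 : forall a, g (f2 a) = g2 a.
Hypothesis momE1 : forall gam a, mom gam (f1 a) = mom1 (res1 gam) a.
Hypothesis momE2 : forall gam a, mom gam (f2 a) = mom2 (res2 gam) a.
Hypothesis resD1 : forall gam gam', res1 (gam + gam') = res1 gam + res1 gam'.
Hypothesis resD2 : forall gam gam', res2 (gam + gam') = res2 gam + res2 gam'.
Hypothesis res_inj : forall gam gam',
  res1 gam = res1 gam' -> res2 gam = res2 gam' -> gam = gam'.
Hypothesis pil : forall y, lin (pi^~ y).
Hypothesis pir : forall x, lin (pi x).
Hypothesis pi_ext : forall (f h : X -> X), lin f -> lin h ->
  (forall x y, f (pi x y) = h (pi x y)) -> forall x, f x = h x.
Hypothesis pi_univ : forall beta : X1 -> X2 -> X,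
  (forall y, lin (beta^~ y)) -> (forall x, lin (beta x)) ->
  exists2 f : X -> X, lin f & forall x y, f (pi x y) = beta x y.
Hypothesis pi_b1 : forall a n x y, b (f1 a) n (pi x y) = pi (b1 a n x) y.
Hypothesis pi_b2 : forall a n x y, b (f2 a) n (pi x y) = pi x (b2 a n y).
Hypothesis pi_vac : forall gam,
  vec gam m1 = pi (vec1 (res1 gam) m11) (vec2 (res2 gam) m12).
Hypothesis pi_coef : forall gam x y,
  coef gam m1 (pi x y) = coef1 (res1 gam) m11 x * coef2 (res2 gam) m12 y.

Let char0 := fs_char F.

Lemma pairing_split mu nu : pairing g mu nu =
  pairing g1 (mu \o f1) (nu \o f1) + pairing g2 (mu \o f2) (nu \o f2).
Proof.
rewrite /pairing f_sum; congr (_ + _); apply: eq_bigr => a _; by rewrite ?gE1 ?gE2.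
Qed.

Definition upper_zero (Z : lmodType K) (a : int -> Z) :=
  exists N : int, forall n, N <= n -> a n = 0.

Lemma zfin_conv (u : int -> X1) (v : int -> X2) (n : int) :
  upper_zero u -> upper_zero v -> zfin (fun i => pi (u i) (v (n - 1 - i))).
Proof.
move=> [N1 h1] [N2 h2].
exists (maxn `|N1| `|(n - 1 - N2)%R|).+1 => i iM.
have [iN|iN] := leP N1 i; first by rewrite h1 // (lin0 (pil _)).
by rewrite h2 ?(lin0 (pir _)) //; lia.
Qed.

Section VertexSplit.
Variables (mu : I -> K) (s : L).
Hypothesis int1 : forall gam, exists n : int,
  pairing g1 (mu \o f1) (mom1 gam) = n%:~R.
Hypothesis int2 : forall gam, exists n : int,
  pairing g2 (mu \o f2) (mom2 gam) = n%:~R.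

Local Notation mu1 := (mu \o f1).
Local Notation mu2 := (mu \o f2).
Local Notation W1 i := (V1 mu1 (res1 s) (- i - 1)).
Local Notation W2 i := (V2 mu2 (res2 s) (- i - 1)).

(** Both sides have the same commutators with the Heisenberg modes, each of which acts on one
    factor, and the same vacuum coefficients; [rigidity] is applied to their difference. *)
Lemma split_vert n x y : V mu s (- n - 1) (pi x y) =
  zsum (fun i => pi (W1 i x) (W2 (n - 1 - i) y)).
Proof.
have tr1 : forall x, upper_zero (fun i => W1 i x) := V_trunc F1 Vl1 V_vec1 mu1 (res1 s).
have tr2 : forall y, upper_zero (fun i => W2 i y) := V_trunc F2 Vl2 V_vec2 mu2 (res2 s).
have zf k u v : zfin (fun i => pi (W1 i u) (W2 (k - 1 - i) v)).
  exact: (zfin_conv k (tr1 u) (tr2 v)).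
have betal k v : lin (fun u => zsum (fun i => pi (W1 i u) (W2 (k - 1 - i) v))).
  move=> c u u'; rewrite -zsumZ // -zsumD //; last exact: zfinZ.
  by apply: eq_zsum => i; rewrite Vl1 (pil _ c).
have betar k u : lin (fun v => zsum (fun i => pi (W1 i u) (W2 (k - 1 - i) v))).
  move=> c v v'; rewrite -zsumZ // -zsumD //; last exact: zfinZ.
  by apply: eq_zsum => i; rewrite Vl2 (pir _ c).
(* The right-hand side is only given on pure tensors; the universal property makes it an
   operator. *)
have Zex k : exists f, lin f /\ forall u v,
    f (pi u v) = zsum (fun i => pi (W1 i u) (W2 (k - 1 - i) v)).
  by have [f fl fE] := pi_univ (betal k) (betar k); exists f.
have [Z hZ] := choice Zex.
pose D k x := V mu s (- k - 1) x - Z k x.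
suff D0 : D n (pi x y) = 0.
  by move: D0; rewrite /D (hZ n).2 => /eqP; rewrite subr_eq0 => /eqP.
pose P E := exists k, E = D k.
have PD : P (D n) by exists n.
move: {x y} PD (pi x y).
apply: (rigidity F) => [E [k ->]|E gam gam' [k ->]|E a p [k ->] p0].
- exact: lin_sub (Vl _ _ _) (hZ k).1.
- rewrite /D (linB (coef_lin F gam' m1)) (coef_V F V_vec) pi_vac (hZ k).2.
  rewrite (zsum_lin (coef_lin F gam' m1) (zf _ _ _)).
  have [n1 E1] := int1 (res1 gam); have [n2 E2] := int2 (res2 gam).
  have -> : pairing g mu (mom gam) = (n1 + n2)%:~R.
    rewrite pairing_split intrD -E1 -E2.
    by congr (_ + _); apply: eq_bigr => a _; rewrite /= ?momE1 ?momE2.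
  rewrite intpartE //.
  (* The first factor has a vacuum coefficient only at exponent [n1], which fixes [i]. *)
  rewrite (@zsum_single _ _ _ (- 1 - n1)) => [|i i1]; last first.
    rewrite pi_coef (coef_V F1 V_vec1) E1 intpartE //.
    by case: eqP => [e1|_]; [lia | rewrite mul0r].
  rewrite pi_coef (coef_V F1 V_vec1) (coef_V F2 V_vec2) E1 E2 !intpartE //.
  rewrite -natrM mulnb; apply/eqP; rewrite subr_eq0; apply/eqP; congr (_ %:R).
  congr nat_of_bool; apply/andP/andP => [[/eqP kn /eqP ->]|[/andP[_ /eqP r1] /andP[/eqP kn /eqP r2]]].
    rewrite resD1 resD2 !eqxx !andbT; split; apply/eqP; lia.
  split; apply/eqP; first lia.
  by apply: res_inj; rewrite ?resD1 ?resD2.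
- exists (g a * mu a), (D (k + p)), 0, (D k).
  split; [by exists (k + p) | by exists k | move=> u]; rewrite scale0r addr0.
  have bl := fs_b_lin F.
  have bZ : b a p (Z k u) = Z k (b a p u) + (g a * mu a) *: Z (k + p) u.
    move: u; apply: (pi_ext (lin_comp (bl _ _) (hZ k).1)
      (lin_add (lin_comp (hZ k).1 (bl _ _)) (lin_scale _ (hZ (k + p)).1))) => u v.
    rewrite !(hZ _).2; case: (f_cover a) => -[a' ->].
      rewrite pi_b1 (hZ k).2 (zsum_lin (bl _ _) (zf _ _ _)).
      rewrite -zsumZ // (zsum_shift p (fun i => _ *: pi (W1 i u) (W2 (k + p - 1 - i) v))).
      rewrite -zsumD //; last first.
        exact: (zfin_shift p (zfinZ _ (zf _ _ _))).
      apply: eq_zsum => i; rewrite pi_b1 (V_b F1 Vl1 V_vec1) //.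
      rewrite (linD (pil _)) (linZ (pil _)) gE1 /=.
      have -> : - i - 1 - p = - (i + p) - 1 :> int by ring.
      by have -> : k - 1 - i = k + p - 1 - (i + p) :> int by ring.
    rewrite pi_b2 (hZ k).2 (zsum_lin (bl _ _) (zf _ _ _)).
    rewrite -zsumZ // -zsumD //; last exact: (zfinZ _ (zf _ _ _)).
    apply: eq_zsum => i; rewrite pi_b2 (V_b F2 Vl2 V_vec2) //.
    rewrite (linD (pir _)) (linZ (pir _)) gE2 /=.
    by have -> : - (k - 1 - i) - 1 - p = - (k + p - 1 - i) - 1 :> int by ring.
  rewrite /D (linB (bl a p)) bZ (V_b F Vl V_vec) // scalerBr.
  have -> : - k - 1 - p = - (k + p) - 1 :> int by ring.
  by rewrite [RHS]addrACA -[- Z k _ - _]opprD.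
Qed.

End VertexSplit.

(** $A(z)=A_1(z)\otimes A_2(z)$: the exponents $-i-1$ and $-i'-1$ add up to $-n-1$ exactly when
    $i'=n-1-i$. *)
Definition split_field (A : int -> X -> X) (A1 : int -> X1 -> X1)
    (A2 : int -> X2 -> X2) :=
  forall n x y, A n (pi x y) = zsum (fun i => pi (A1 i x) (A2 (n - 1 - i) y)).

Lemma upper_zero_field (Z : lmodType K) (A : int -> Z -> Z) x k :
  is_field A -> upper_zero (fun i => A (i + k) x).
Proof.
by move=> /field_trunc /(_ x) [N hN]; exists (N - k) => n nN; apply: hN; lia.
Qed.

Lemma upper_zeroP (Z : lmodType K) (A : int -> Z -> Z) x :
  is_field A -> upper_zero (fun i => A i x).
Proof. by move=> Af; exact: (field_trunc Af x). Qed.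

(** Modes of [b (f1 a)] act on the first factor alone; the point is to exchange the sum over [j] of
    the product with the convolution over [i]. *)
Lemma split_nprod1 r a A A1 A2 : is_field A1 -> is_field A2 ->
  split_field A A1 A2 ->
  split_field (nprod 1 r (b (f1 a)) A) (nprod 1 r (b1 a) A1) A2.
Proof.
move=> Af1 Af2 sA m x y; rewrite /nprod.
pose h (j : nat) (i : int) := nbin K r j *: (b1 a (- (r + j)%N%:Z) (A1 (i + j%:Z) x)
    - (1 * (-1) ^+ r) *: A1 (i - (r + j)%N%:Z) (b1 a j%:Z x)).
have hf i : fin (h ^~ i) := nprod_fin_sub 1 r i x (b_field F1 a) Af1.
have bl1 := fs_b_lin F1.
have zf1 (j : nat) : zfin (fun i : int =>
    pi (b1 a (- (r + j)%N%:Z) (A1 (i + j%:Z) x)) (A2 (m - 1 - i) y)).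
  apply: (zfin_conv m _ (upper_zeroP y Af2)).
  have [N hN] := upper_zero_field x j%:Z Af1.
  by exists N => i /hN ->; exact: (lin0 (bl1 _ _)).
have zf2 (j : nat) : zfin (fun i : int =>
    pi (A1 (i - (r + j)%N%:Z) (b1 a j%:Z x)) (A2 (m - 1 - i) y)).
  exact: (zfin_conv m (upper_zero_field _ _ Af1) (upper_zeroP y Af2)).
transitivity (fsum (fun j => zsum (fun i => pi (h j i) (A2 (m - 1 - i) y)))).
  apply: eq_fsum => j; rewrite sA (zsum_lin (fs_b_lin F _ _)); last first.
    exact: (zfin_conv _ (upper_zeroP x Af1) (upper_zeroP y Af2)).
  rewrite pi_b1 sA.
  have -> : zsum (fun i => b (f1 a) (- (r + j)%N%:Z)
      (pi (A1 i x) (A2 (m + j%:Z - 1 - i) y))) = zsum (fun i : int =>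
      pi (b1 a (- (r + j)%N%:Z) (A1 (i + j%:Z) x)) (A2 (m - 1 - i) y)).
    rewrite (zsum_shift j%:Z); apply: eq_zsum => i; rewrite pi_b1.
    by have -> : m + j%:Z - 1 - (i + j%:Z) = m - 1 - i by ring.
  have -> : zsum (fun i => pi (A1 i (b1 a j%:Z x)) (A2 (m - (r + j)%N%:Z - 1 - i) y))
      = zsum (fun i : int =>
      pi (A1 (i - (r + j)%N%:Z) (b1 a j%:Z x)) (A2 (m - 1 - i) y)).
    rewrite (zsum_shift (- (r + j)%N%:Z)); apply: eq_zsum => i.
    by have -> : m - (r + j)%N%:Z - 1 - (i - (r + j)%N%:Z) = m - 1 - i by ring.
  rewrite -scaleNr -[_ *: zsum (fun i => pi (A1 (i - _) _) _)]zsumZ //.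
  rewrite -zsumD //; last exact: zfinZ.
  rewrite -zsumZ; last first.
    have [J hJ] := zfin2 (zf1 j) (zfinZ (- (1 * (-1) ^+ r)) (zf2 j)).
    by exists J => i /hJ [-> ->]; rewrite addr0.
  apply: eq_zsum => i; rewrite /h (linZ (pil _)) (linB (pil _)) (linZ (pil _)).
  by rewrite scaleNr.
have [N1 hN1] := field_trunc Af1 x.
have [N hN] := field_trunc (b_field F1 a) x.
have [N2 hN2] := field_trunc Af2 y.
(* Where the second factor survives, $i\ge m-N_2$. The bound therefore gives $i+j\ge N_1$, killing
   the first term, and $j\ge N$, killing the second. *)
rewrite (@fsum_zsum _ _ _ (maxn `|N| `|(N1 - (m - N2))%R|)) => [|j i|j].
- apply: eq_zsum => i; exact/esym/(lin_fsum (pil _) (hf i)).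
- rewrite geq_max => /andP[j1 j2].
  have [iN|iN] := leP N2 (m - 1 - i); first by rewrite hN2 // (lin0 (pir _)).
  rewrite /h hN1; last by lia.
  rewrite hN; last by lia.
  rewrite (lin0 (bl1 _ _)) (lin0 (field_lin Af1 _)) !scaler0 subr0 scaler0.
  exact: (lin0 (pil _)).
- have [J hJ] := zfin2 (zf1 j) (zf2 j); exists J => i /hJ [h1 h2].
  by rewrite /h (linZ (pil _)) (linB (pil _)) (linZ (pil _)) h1 h2 scaler0 subr0 scaler0.
Qed.

Lemma split_nprod2 r a A A1 A2 : is_field A1 -> is_field A2 ->
  split_field A A1 A2 ->
  split_field (nprod 1 r (b (f2 a)) A) A1 (nprod 1 r (b2 a) A2).
Proof.
move=> Af1 Af2 sA m x y; rewrite /nprod.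
pose h (j : nat) (n : int) := nbin K r j *: (b2 a (- (r + j)%N%:Z) (A2 (n + j%:Z) y)
    - (1 * (-1) ^+ r) *: A2 (n - (r + j)%N%:Z) (b2 a j%:Z y)).
have hf n : fin (h ^~ n) := nprod_fin_sub 1 r n y (b_field F2 a) Af2.
have bl2 := fs_b_lin F2.
have zf1 (j : nat) : zfin (fun i : int =>
    pi (A1 i x) (b2 a (- (r + j)%N%:Z) (A2 (m - 1 - i + j%:Z) y))).
  apply: (zfin_conv (v := fun n => b2 a (- (r + j)%N%:Z) (A2 (n + j%:Z) y)) m
    (upper_zeroP x Af1)).
  have [N hN] := upper_zero_field y j%:Z Af2.
  by exists N => i /hN ->; exact: (lin0 (bl2 _ _)).
have zf2 (j : nat) : zfin (fun i : int =>
    pi (A1 i x) (A2 (m - 1 - i - (r + j)%N%:Z) (b2 a j%:Z y))).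
  exact: (zfin_conv m (upper_zeroP x Af1) (upper_zero_field _ _ Af2)).
transitivity (fsum (fun j => zsum (fun i => pi (A1 i x) (h j (m - 1 - i))))).
  apply: eq_fsum => j; rewrite sA (zsum_lin (fs_b_lin F _ _)); last first.
    exact: (zfin_conv _ (upper_zeroP x Af1) (upper_zeroP y Af2)).
  rewrite pi_b2 sA.
  have -> : zsum (fun i => b (f2 a) (- (r + j)%N%:Z)
      (pi (A1 i x) (A2 (m + j%:Z - 1 - i) y))) = zsum (fun i : int =>
      pi (A1 i x) (b2 a (- (r + j)%N%:Z) (A2 (m - 1 - i + j%:Z) y))).
    apply: eq_zsum => i; rewrite pi_b2.
    by have -> : m + j%:Z - 1 - i = m - 1 - i + j%:Z by ring.
  have -> : zsum (fun i => pi (A1 i x) (A2 (m - (r + j)%N%:Z - 1 - i) (b2 a j%:Z y)))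
      = zsum (fun i : int =>
      pi (A1 i x) (A2 (m - 1 - i - (r + j)%N%:Z) (b2 a j%:Z y))).
    apply: eq_zsum => i.
    by have -> : m - (r + j)%N%:Z - 1 - i = m - 1 - i - (r + j)%N%:Z by ring.
  rewrite -scaleNr -[_ *: zsum (fun i => pi _ (A2 (_ - _) _))]zsumZ //.
  rewrite -zsumD //; last exact: zfinZ.
  rewrite -zsumZ; last first.
    have [J hJ] := zfin2 (zf1 j) (zfinZ (- (1 * (-1) ^+ r)) (zf2 j)).
    by exists J => i /hJ [-> ->]; rewrite addr0.
  apply: eq_zsum => i; rewrite /h (linZ (pir _)) (linB (pir _)) (linZ (pir _)).
  by rewrite scaleNr.
have [N1 hN1] := field_trunc Af2 y.
have [N hN] := field_trunc (b_field F2 a) y.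
have [N2 hN2] := field_trunc Af1 x.
rewrite (@fsum_zsum _ _ _ (maxn `|N| `|(N1 - (m - N2))%R|)) => [|j i|j].
- apply: eq_zsum => i; exact/esym/(lin_fsum (pir _) (hf (m - 1 - i))).
- rewrite geq_max => /andP[j1 j2].
  have [iN|iN] := leP N2 i; first by rewrite hN2 // (lin0 (pil _)).
  rewrite /h hN1; last by lia.
  rewrite hN; last by lia.
  rewrite (lin0 (bl2 _ _)) (lin0 (field_lin Af2 _)) !scaler0 subr0 scaler0.
  exact: (lin0 (pir _)).
- have [J hJ] := zfin2 (zf1 j) (zf2 j); exists J => i /hJ [h1 h2].
  by rewrite /h (linZ (pir _)) (linB (pir _)) (linZ (pir _)) h1 h2 scaler0 subr0 scaler0.
Qed.

Hypothesis pi_dg : forall c c1 c2, (forall gam, c gam = c1 (res1 gam) * c2 (res2 gam)) ->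
  forall x y, dg c (pi x y) = pi (dg1 c1 x) (dg2 c2 y).

(** The factors of [l] are distributed over [l1] and [l2]. Of these lists only the states they
    create are recorded, which is enough by [sfield_ext]. *)
Lemma split_sfield c c1 c2 s (l : seq (I * nat)) :
  (forall gam, c gam = c1 (res1 gam) * c2 (res2 gam)) ->
  (forall gam, exists n : int, pairing g1 (mom1 (res1 s)) (mom1 gam) = n%:~R) ->
  (forall gam, exists n : int, pairing g2 (mom2 (res2 s)) (mom2 gam) = n%:~R) ->
  exists l1 l2,
    split_field (sfield mom b dg V c s l)
      (sfield mom1 b1 dg1 V1 c1 (res1 s) l1) (sfield mom2 b2 dg2 V2 c2 (res2 s) l2) /\
    vec s (foldr (fun x => mx x.1 x.2) m1 l) =
    pi (vec1 (res1 s) (foldr (fun x => mx1 x.1 x.2) m11 l1))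
       (vec2 (res2 s) (foldr (fun x => mx2 x.1 x.2) m12 l2)).
Proof.
move=> cE int1 int2.
have E1 : mom s \o f1 = mom1 (res1 s) by apply/funext => a; exact: momE1.
have E2 : mom s \o f2 = mom2 (res2 s) by apply/funext => a; exact: momE2.
elim: l => [|[a k] l [l1 [l2 [sp vE]]]].
  exists [::], [::]; split=> [n x y|]; last exact: pi_vac.
  rewrite -E1 in int1; rewrite -E2 in int2.
  by rewrite /= /vfield (pi_dg cE) (split_vert s int1 int2) E1 E2.
have Af1 := sfield_field F1 Vl1 V_vec1 c1 (res1 s) l1.
have Af2 := sfield_field F2 Vl2 V_vec2 c2 (res2 s) l2.
case: (f_cover a) => -[a' ->].
  exists ((a', k) :: l1), l2; split; first exact: split_nprod1.
  by rewrite /= -(fs_neg F) vE pi_b1 (fs_neg F1).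
exists l1, ((a', k) :: l2); split; first exact: split_nprod2.
by rewrite /= -(fs_neg F) vE pi_b2 (fs_neg F2).
Qed.

End Splitting.

(** * Independence of the order of the Heisenberg factors *)

Section StateFields.
Variables (K : fieldType) (I : finType) (g : I -> K) (L : zmodType)
  (mom : L -> I -> K) (M : Type) (m1 : M) (mx : I -> nat -> M -> M)
  (X : lmodType K) (vec : L -> M -> X) (coef : L -> M -> X -> K)
  (b : I -> int -> X -> X) (sh : L -> X -> X) (dg : (L -> K) -> X -> X)
  (V : (I -> K) -> L -> int -> X -> X).
Hypothesis F : fock_space g mom m1 mx vec coef b sh dg.
Hypothesis Vl : forall mu s e, lin (V mu s e).
Hypothesis V_vec : forall mu s e gam m, V mu s e (vec gam m) =
  sh s (dressed b mu (e - intpart (pairing g mu (mom gam))) (vec gam m)).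

Local Notation sf := (sfield mom b dg V).
Local Notation mon l := (foldr (fun x => mx x.1 x.2) m1 l).

Lemma sfield_scale f c s l n x : sf (fun gam => f gam * c gam) s l n x = sf c s l n (dg f x).
Proof.
elim: l n x => [|[a k] l IH] n x.
  by rewrite /= /vfield (dg_dg F); congr (V _ _ _ (dg _ _)); apply/funext => gam; rewrite mulrC.
rewrite /= /nprod; apply: eq_fsum => j; congr (_ *: (b _ _ _ - _ *: _)); first exact: IH.
by rewrite IH (fs_dg_b F).
Qed.

(** The difference of the two fields kills the vacuum: its modes from $-1$ on because the states
    agree, the others by translation covariance in characteristic zero. [uniqueness] concludes. *)
Lemma sfield_ext c s l l' : integral_on g mom c s ->
  (forall gam m, exists e B, [/\ is_field B, local e (sf c s l) B,
    local e (sf c s l') B & creates (vec 0 m1) B (vec gam m)]) ->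
  vec s (mon l) = vec s (mon l') -> forall n x, sf c s l n x = sf c s l' n x.
Proof.
move=> ci hB ll'.
(* Written as a two-term sum so that [field_sum] and [local_sum] apply. *)
pose A n x := \sum_(t <- [:: true; false])
  (if t then 1 else -1) *: sf c s (if t then l else l') n x.
have AE n x : A n x = sf c s l n x - sf c s l' n x.
  by rewrite /A !big_cons big_nil scale1r scaleN1r addr0.
have Af : is_field A by apply: field_sum => t; exact: (sfield_field F Vl V_vec).
have A0 n : A n (vec 0 m1) = 0.
  have pos (k : int) : -1 <= k -> A k (vec 0 m1) = 0.
    by move=> k1; rewrite AE !(sfield_creates F Vl V_vec) // ll' subrr.
  have cov k : transl g b (A k (vec 0 m1)) = - k%:~R *: A (k - 1) (vec 0 m1).
    have sc := sfield_covariant F Vl V_vec _ ci.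
    have tl := transl_lin F.
    rewrite !AE (linB tl) !sc (transl_v0 F) !(lin0 (field_lin (sfield_field F Vl V_vec _ _ _) _)).
    by rewrite !sub0r scaleNr scalerBr opprD.
  have neg (k : nat) : A (- k.+1%:Z) (vec 0 m1) = 0.
    elim: k => [|k IH]; first exact: pos.
    have := cov (- k.+1%:Z); rewrite IH (lin0 (transl_lin F)).
    have -> : - k.+1%:Z - 1 = - k.+2%:Z :> int by lia.
    move=> /esym/eqP; rewrite scaler_eq0 mulrNz opprK (negPf (fs_char F k)).
    by move/eqP.
  by case: n => n; [apply: pos | rewrite NegzE; apply: neg].
move=> n x; apply/eqP; rewrite -subr_eq0 -AE; apply/eqP.
apply: (fs_ext F (f := A n) (h := fun=> 0) (field_lin Af n) (@lin_zero _ _ _)) => gam m.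
have [e [B [Bf l1 l2 Bc]]] := hB gam m.
apply: (uniqueness Af Bf A0 _ Bc).
apply: (@local_sum _ _ bool e [:: true; false] (fun t : bool => if t then 1 else -1) (fun t : bool => sf c s (if t then l else l')) B Bf).
by case=> _.
Qed.

End StateFields.

Lemma state_field_ext (K : fieldType) (I J : finType) (g : I -> K) (lam : J -> I -> K)
    (ltJ : rel J) l r r' :
  (forall n, n.+1%:R != 0 :> K) -> (forall a, g a != 0) ->
  (forall c c', exists n : int, pairing g (lam c) (lam c') = n%:~R) ->
  irreflexive ltJ -> (forall c c', c != c' -> ltJ c c' = ~~ ltJ c' c) ->
  foldr (fun x => fmul x.1 x.2) mone r = foldr (fun x => fmul x.1 x.2) mone r'
    :> {cmonom (I * nat)%type} ->
  let sf r := sfield (momentum lam) (fheis g lam) (@fdiag K I J) (fvert g lam)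
    (cocycle g lam ltJ l) l r in
  forall n x, sf r n x = sf r' n x.
Proof.
move=> char0 g0 intg irr tot rr; have F := lattice_fock lam char0 g0.
have Vl := @fvert_lin K I J g lam; have Vv := fvert_vec lam char0 g0.
refine (sfield_ext F Vl Vv (coc_integral (ltJ := ltJ) char0 intg (l := l)) _ _); last by rewrite rr.
move=> gam m; exists ((-1) ^+ (odd_int (lform g lam l l) && odd_int (lform g lam gam gam))).
eexists; split; last exact: (sf_creates lam ltJ char0 g0 gam m).
- exact: (sfield_field F Vl Vv).
- exact: (sf_local char0 g0 intg irr tot).
- exact: (sf_local char0 g0 intg irr tot).
Qed.

Lemma mcoeff_linext (K : fieldType) (B B' : choiceType) (f : B -> B') b (u : {malg K[B]}) :
  injective f -> (linext (fun b => << f b >> : {malg K[B']}) u)@_(f b) = u@_b.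
Proof.
move=> fi; move: u; apply: (lin_ext (V := K^o)
  (f := fun u : {malg K[B]} => (linext (fun b => << f b >> : {malg K[B']}) u)@_(f b))
  (lin_comp (mcoeff_lin (f b)) (linext_lin _)) (mcoeff_lin b)) => b'.
by rewrite linextU !mcoeffU inj_eq.
Qed.

Lemma linext2_lin (K : fieldType) (B1 B2 : choiceType) (V : lmodType K)
  (f : B1 -> B2 -> V) (u : {malg K[B1]}) :
  lin (fun w : ({malg K[B2]} : lmodType K) => linext (fun b => linext (f b) w) u).
Proof.
apply: (@lin_bigsum _ _ _ _ _ _ (fun b (w : ({malg K[B2]} : lmodType K)) => u@_b *: linext (f b) w)).
by move=> b; apply: lin_scale; exact: linext_lin.
Qed.

Section Tensors.
Variables (K : fieldType) (B1 B2 : choiceType).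
Implicit Types (u : {malg K[B1]}) (w : {malg K[B2]}).

Lemma tensE u w : tens u w = linext (fun b => linext (fun c => << (b, c) >> :
  {malg K[(B1 * B2)%type]}) w) u.
Proof.
rewrite /tens /linext; apply: eq_bigr => b _; rewrite scaler_sumr.
apply: eq_bigr => c _; rewrite scalerA.
by apply/malgP => x; rewrite mcoeffZ !mcoeffU mulr_natr.
Qed.

Lemma tens_linl w : lin (fun u : ({malg K[B1]} : lmodType K) =>
  tens u w : ({malg K[(B1 * B2)%type]} : lmodType K)).
Proof. by move=> c u u'; rewrite !tensE; apply: linext_lin. Qed.

Lemma tens_linr u : lin (fun w : ({malg K[B2]} : lmodType K) =>
  tens u w : ({malg K[(B1 * B2)%type]} : lmodType K)).
Proof.
by move=> c w w'; rewrite !tensE; apply: linext2_lin.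
Qed.

Lemma tensU b c : tens (<< b >> : {malg K[B1]}) (<< c >> : {malg K[B2]}) = << (b, c) >>.
Proof. by rewrite tensE !linextU. Qed.

End Tensors.

Section Gluing.
Variables (I J I' J' : finType) (fI : I' -> I) (fJ : J' -> J).

Lemma restrict_monomE (b : latbasis I J) a k :
  (restrict_basis fI fJ b).2 (a, k) = b.2 (fI a, k).
Proof.
rewrite /= cmE fsfunE /=; case: ifP => // /negbT.
apply: contraNeq; rewrite eq_sym cmE_neq0 => kb.
by apply/imfset2P; exists a; rewrite ?mem_enum //; exists (fI a, k).
Qed.

End Gluing.

(** * Gluing the bases of the two factors *)

Section LatticeSplitting.
Variables (K : fieldType) (I J I1 J1 I2 J2 : finType).
Variables (fI1 : I1 -> I) (fJ1 : J1 -> J) (fI2 : I2 -> I) (fJ2 : J2 -> J).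
Variables (gI : I -> I1 + I2) (gJ : J -> J1 + J2).
Definition sumf (T T1 T2 : Type) (f1 : T1 -> T) (f2 : T2 -> T) (x : T1 + T2) :=
  match x with inl a => f1 a | inr a => f2 a end.
Hypothesis fIK : cancel (sumf fI1 fI2) gI.
Hypothesis gIK : cancel gI (sumf fI1 fI2).
Hypothesis fJK : cancel (sumf fJ1 fJ2) gJ.
Hypothesis gJK : cancel gJ (sumf fJ1 fJ2).

Local Notation X := (latspace K I J).
Local Notation X1 := (latspace K I1 J1).
Local Notation X2 := (latspace K I2 J2).
Local Notation M := {cmonom (I * nat)%type}.
Local Notation M1 := {cmonom (I1 * nat)%type}.
Local Notation M2 := {cmonom (I2 * nat)%type}.
Local Notation rb1 := (restrict_basis fI1 fJ1).
Local Notation rb2 := (restrict_basis fI2 fJ2).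

Definition glue_charge (l1 : {ffun J1 -> int}) (l2 : {ffun J2 -> int}) : {ffun J -> int} :=
  [ffun c => match gJ c with inl c' => l1 c' | inr c' => l2 c' end].

Definition glue_monom (m1 : M1) (m2 : M2) : M :=
  [cmonom match gI x.1 with inl a => m1 (a, x.2) | inr a => m2 (a, x.2) end | x in
    [fset (fI1 y.1, y.2) | y in finsupp m1]%fset `|` [fset (fI2 y.1, y.2) | y in finsupp m2]%fset]%M.

Lemma glue_monomE m1 m2 x : glue_monom m1 m2 x =
  match gI x.1 with inl a => m1 (a, x.2) | inr a => m2 (a, x.2) end.
Proof.
rewrite cmE fsfunE; case: ifP => // /negbT; rewrite in_fsetU negb_or => /andP[h1 h2].
apply/eqP; rewrite eq_sym; case E: (gI x.1) => [a|a].
  apply: contraNT h1; rewrite cmE_neq0 => ax.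
  apply/imfsetP; exists (a, x.2) => //=.
  by rewrite -/(sumf fI1 fI2 (inl a)) -E gIK -surjective_pairing.
apply: contraNT h2; rewrite cmE_neq0 => ax.
apply/imfsetP; exists (a, x.2) => //=.
by rewrite -/(sumf fI1 fI2 (inr a)) -E gIK -surjective_pairing.
Qed.

Definition glue (x : latbasis I1 J1 * latbasis I2 J2) : latbasis I J :=
  (glue_charge x.1.1 x.2.1, glue_monom x.1.2 x.2.2).

Definition restrict2 (b : latbasis I J) := (rb1 b, rb2 b).

Lemma gI1 a : gI (fI1 a) = inl a. Proof. exact: (fIK (inl a)). Qed.
Lemma gI2 a : gI (fI2 a) = inr a. Proof. exact: (fIK (inr a)). Qed.
Lemma gJ1 a : gJ (fJ1 a) = inl a. Proof. exact: (fJK (inl a)). Qed.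
Lemma gJ2 a : gJ (fJ2 a) = inr a. Proof. exact: (fJK (inr a)). Qed.

Lemma glueK : cancel glue restrict2.
Proof.
move=> [[l1 m1] [l2 m2]]; congr ((_, _), (_, _)).
- by apply/ffunP => c; rewrite !ffunE gJ1.
- by apply/eqP/cmP => -[a k]; rewrite (restrict_monomE fI1 fJ1 (glue ((l1, m1), (l2, m2)))) /= glue_monomE gI1.
- by apply/ffunP => c; rewrite !ffunE gJ2.
- by apply/eqP/cmP => -[a k]; rewrite (restrict_monomE fI2 fJ2 (glue ((l1, m1), (l2, m2)))) /= glue_monomE gI2.
Qed.

Lemma restrict1_glue b1 b2 : rb1 (glue (b1, b2)) = b1.
Proof. exact: (congr1 fst (glueK (b1, b2))). Qed.

Lemma restrict2_glue b1 b2 : rb2 (glue (b1, b2)) = b2.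
Proof. exact: (congr1 snd (glueK (b1, b2))). Qed.

Lemma restrict2K : cancel restrict2 glue.
Proof.
move=> [l m]; congr (_, _).
  apply/ffunP => c; rewrite ffunE -{2}[c]gJK.
  by case: (gJ c) => c'; rewrite ffunE.
apply/eqP/cmP => -[a k]; rewrite glue_monomE [LHS]/= -{2}[a]gIK.
case: (gI a) => a'; first by rewrite /= (restrict_monomE fI1 fJ1 (l, m)).
by rewrite /= (restrict_monomE fI2 fJ2 (l, m)).
Qed.

Fact tpi_sig : {tpi : X1 -> X2 -> X | forall x y, tpi x y =
  linext (fun b1 => linext (fun b2 => << glue (b1, b2) >> : X) y) x}.
Proof. by exists (fun x y => linext (fun b1 => linext (fun b2 => << glue (b1, b2) >> : X) y) x). Qed.
Definition tpi := sval tpi_sig.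

Lemma tpiE x y : tpi x y = linext (fun b1 => linext (fun b2 => << glue (b1, b2) >> : X) y) x.
Proof. exact: (svalP tpi_sig). Qed.

Lemma tpil y : lin (tpi^~ y).
Proof. by move=> c x x'; rewrite !tpiE; apply: linext_lin. Qed.

Lemma tpir x : lin (tpi x).
Proof.
by move=> c y y'; rewrite !tpiE; apply: linext2_lin.
Qed.

Lemma tpiU b1 b2 : tpi << b1 >> << b2 >> = << glue (b1, b2) >>.
Proof. by rewrite tpiE !linextU. Qed.

Lemma tpi_vec l1 m1 l2 m2 : tpi (fvec K l1 m1) (fvec K l2 m2) =
  fvec K (glue_charge l1 l2) (glue_monom m1 m2).
Proof. by rewrite !fvecE tpiU. Qed.

Lemma bilinear_ext (Z : lmodType K) (f h : X1 -> X2 -> Z) :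
  (forall y, lin (f^~ y)) -> (forall x, lin (f x)) ->
  (forall y, lin (h^~ y)) -> (forall x, lin (h x)) ->
  (forall l1 m1 l2 m2, f (fvec K l1 m1) (fvec K l2 m2) = h (fvec K l1 m1) (fvec K l2 m2)) ->
  forall x y, f x y = h x y.
Proof.
move=> fl fr hl hr fh x y; move: x; apply: (fext (fl y) (hl y)) => l1 m1.
by apply: (fext (fr _) (hr _)) => l2 m2.
Qed.

Lemma tpi_ext (Z : lmodType K) (f h : X -> Z) : lin f -> lin h ->
  (forall x y, f (tpi x y) = h (tpi x y)) -> forall x, f x = h x.
Proof.
move=> fl hl fh; apply: (lin_ext fl hl) => b.
by rewrite -[b]restrict2K -tpiU.
Qed.

Lemma tpi_univ (Z : lmodType K) (beta : X1 -> X2 -> Z) :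
  (forall y, lin (beta^~ y)) -> (forall x, lin (beta x)) ->
  exists2 f : X -> Z, lin f & forall x y, f (tpi x y) = beta x y.
Proof.
move=> bl br; exists (linext (fun b => beta << rb1 b >> << rb2 b >>)).
  exact: linext_lin.
have ll := @linext_lin K _ Z (fun b => beta << rb1 b >> << rb2 b >>).
apply: bilinear_ext => // [y|x|l1 m1 l2 m2].
- exact: (lin_comp ll (tpil y)).
- exact: (lin_comp ll (tpir x)).
- rewrite !fvecE tpiU linextU.
  by rewrite restrict1_glue restrict2_glue.
Qed.

End LatticeSplitting.

(** * Transport of the axioms along an isomorphism *)

Section Transport.
Variables (K : fieldType) (A B : vertexData K) (f : carrier A -> carrier B).
Hypothesis f_iso : vertex_isomorphism f.
Hypothesis f_hpart : forall p u, f (hpart p u) = hpart p (f u).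

Let fe : vertex_embedding setT setT f := f_iso.1.

Lemma iso_lin : lin (f : carrier A -> carrier B).
Proof. by move=> c u v; apply: (ve_lin fe). Qed.

Lemma iso_homog p u : homog p (f u) -> homog p u.
Proof.
move=> /homog_hpartP fu; apply/homog_hpartP; apply: (ve_inj fe) => //.
by rewrite f_hpart.
Qed.

Lemma iso_prod u n v : vprod (f u) n (f v) = f (vprod u n v).
Proof. by rewrite (ve_prod fe). Qed.

Lemma iso_vtrans u : vtrans (f u) = f (vtrans u).
Proof. by rewrite /vtrans -(ve_vac fe) iso_prod. Qed.

Lemma vsa_transport (U : set (carrier A)) :
  vertex_superalgebra U -> vertex_superalgebra (f @` U)%classic.
Proof.
move=> H; split.
- by exists (vvac A); [exact: (va_vac H) | exact: (ve_vac fe)].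
- move=> c _ _ [u uU <-] [v vU <-]; exists (c *: u + v); last exact: iso_lin.
  exact: (va_lin H).
- by move=> p _ [u uU <-]; exists (hpart p u); [exact: (va_hpart H) | exact: f_hpart].
- by move=> _ n _ [u uU <-] [v vU <-]; rewrite iso_prod; exists (vprod u n v) => //; apply: (va_prod H).
- move=> c _ _ n _ [u uU <-] [u' uU' <-] [v vU <-].
  by rewrite -iso_lin !iso_prod (va_linl H) // iso_lin.
- move=> c _ n _ _ [u uU <-] [v vU <-] [v' vU' <-].
  by rewrite -iso_lin !iso_prod (va_linr H) // iso_lin.
- by rewrite -(ve_vac fe); apply: (ve_par fe) => //; exact: (va_vac_even H).
- move=> p q _ n _ [u uU <-] [v vU <-] hu hv; rewrite iso_prod; apply: (ve_par fe) => //.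
  by apply: (va_par H) => //; apply: iso_homog.
- move=> _ _ [u uU <-] [v vU <-]; have [N hN] := va_trunc H uU vU.
  by exists N => n /hN E; rewrite iso_prod E; exact: (lin0 iso_lin).
- move=> n _ [v vU <-]; rewrite -(ve_vac fe) iso_prod (va_vacl H) //.
  by case: ifP => // _; exact: (lin0 iso_lin).
- by move=> _ [u uU <-]; rewrite -(ve_vac fe) iso_prod (va_vacr H).
- move=> _ n [u uU <-] n0; rewrite -(ve_vac fe) iso_prod (va_create H) //.
  exact: (lin0 iso_lin).
- move=> _ n _ [u uU <-] [v vU <-]; rewrite !(iso_vtrans, iso_prod).
  by rewrite -(linB iso_lin) (va_trans H) // (linZ iso_lin).
- move=> p q _ _ [u uU <-] [v vU <-] hu hv.
  have [N hN] := va_local H uU vU (iso_homog hu) (iso_homog hv).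
  exists N => m n _ [x xU <-].
  rewrite -[RHS](lin0 iso_lin) -(hN m n x xU) (lin_sum iso_lin).
  apply: eq_bigr => j _; rewrite (linZ iso_lin); congr (_ *: _).
  by rewrite /bracket (linB iso_lin) (linZ iso_lin) !iso_prod.
Qed.

End Transport.

(** * Joint kernels in a tensor product *)

Section TensorKernel.
Variables (K : fieldType) (X1 X2 X : lmodType K) (tp : X1 -> X2 -> X).
Hypothesis pil : forall y, lin (tp^~ y).
Hypothesis pir : forall x, lin (tp x).

(** A dependent second component is eliminated at the cost of changing the first ones. Second
    components are discarded but never changed, so that they stay in [U]. *)
Lemma tensor_independent (U : X2 -> Prop) n (x : 'I_n -> X1) (y : 'I_n -> X2) :
  (forall i, U (y i)) -> exists m (x' : 'I_m -> X1) (y' : 'I_m -> X2),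
  [/\ forall i, U (y' i), \sum_i tp (x i) (y i) = \sum_i tp (x' i) (y' i) &
      forall c : 'I_m -> K, \sum_i c i *: y' i = 0 -> forall i, c i = 0].
Proof.
elim: n x y => [|n IH] x y Uy; first by exists 0%N, x, y; split => // c _ [].
have [ind|] := pselect (forall c : 'I_n.+1 -> K, \sum_i c i *: y i = 0 -> forall i, c i = 0).
  by exists n.+1, x, y.
move=> /existsNP [c /not_implyP [c0 /existsNP [i0 /eqP ci0]]].
pose q j := c (lift i0 j) / c i0.
have yE : y i0 = - \sum_j q j *: y (lift i0 j).
  move: c0; rewrite (bigD1_ord i0) //= => /(canRL (addrK _)); rewrite sub0r => c0.
  apply: (scalerI ci0); rewrite c0 scalerN scaler_sumr; congr (- _).
  by apply: eq_bigr => j _; rewrite scalerA mulrCA mulfV // mulr1.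
have [m [x' [y' [Uy' E ind]]]] := IH (fun j => x (lift i0 j) - q j *: x i0)
  (fun j => y (lift i0 j)) (fun j => Uy _).
exists m, x', y'; split=> //; rewrite -E (bigD1_ord i0) //= yE.
rewrite (linN (pir _)) (lin_sum (pir _)) -sumrN -big_split; apply: eq_bigr => j _ /=.
by rewrite (linB (pil _)) (linZ (pir _)) (linZ (pil _)) addrC.
Qed.

Variables (B : choiceType) (sl : B -> X -> X2) (cf : B -> X1 -> K) (ee : B -> X1).
Hypothesis sl_lin : forall b, lin (sl b).
Hypothesis sl_pi : forall b x y, sl b (tp x y) = cf b x *: y.
Hypothesis cf0 : forall x, (forall b, cf b x = 0) -> x = 0.
Hypothesis pi_ext : forall f h : X -> X2, lin f -> lin h ->
  (forall x y, f (tp x y) = h (tp x y)) -> forall x, f x = h x.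

(* The slices of v lie in the kernels on the second factor, and so do the second
   components of a shortest expression of v through them; these being linearly
   independent, the first components lie in the kernels on the first factor. *)
Lemma tensor_kernel (P1 : (X1 -> X1) -> (X -> X) -> Prop)
    (P2 : (X2 -> X2) -> (X -> X) -> Prop) (v : X) (D : seq B) :
  v = \sum_(b <- D) tp (ee b) (sl b v) ->
  (forall a f, P1 a f -> lin f /\ forall x y, f (tp x y) = tp (a x) y) ->
  (forall a f, P2 a f -> [/\ lin a, lin f & forall x y, f (tp x y) = tp x (a y)]) ->
  (forall a f, P1 a f -> f v = 0) -> (forall a f, P2 a f -> f v = 0) ->
  exists n (x : 'I_n -> X1) (y : 'I_n -> X2), v = \sum_i tp (x i) (y i) /\
    forall i, (forall a f, P1 a f -> a (x i) = 0) /\ (forall a f, P2 a f -> a (y i) = 0).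
Proof.
move=> vE h1 h2 v1 v2.
pose U y := forall a f, P2 a f -> a y = 0.
have Usl b : U (sl b v).
  move=> a f Pf; have [al fl fE] := h2 a f Pf.
  have E : forall v, sl b (f v) = a (sl b v).
    apply: (pi_ext (lin_comp (sl_lin b) fl) (lin_comp al (sl_lin b))) => x y.
    by rewrite fE !sl_pi (linZ al).
  by rewrite -E (v2 a f Pf) (lin0 (sl_lin b)).
have [b0|[b0 Db0]] : D = [::] \/ exists b0, b0 \in D.
  by case: D {vE} => [|b r]; [left | right; exists b; rewrite inE eqxx].
  exists 0%N, (fun=> 0), (fun=> 0); split; last by case.
  by rewrite vE b0 big_nil big_ord0.
pose e (i : 'I_(size D)) := nth b0 D i.
have [n [x [y [Uy E ind]]]] := tensor_independent (U := U) (fun i => ee (e i))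
  (y := fun i => sl (e i) v) (fun i => Usl _).
have vE' : v = \sum_i tp (x i) (y i).
  by rewrite -E {1}vE (big_nth b0) big_mkord.
exists n, x, y; split=> // i; split; last exact: Uy.
move=> a f Pf; have [fl fE] := h1 a f Pf.
have fv : \sum_i tp (a (x i)) (y i) = 0.
  apply: etrans (v1 a f Pf); rewrite [in RHS]vE' (lin_sum fl).
  by apply: eq_bigr => j _; rewrite fE.
apply: cf0 => b; apply: (ind (fun i => cf b (a (x i)))).
apply: etrans (lin0 (sl_lin b)); rewrite -[in RHS]fv (lin_sum (sl_lin b)).
by apply: eq_bigr => j _; rewrite sl_pi.
Qed.

End TensorKernel.

(** * The orthogonal splitting of a lattice vertex superalgebra *)

Section SplitFock.
Variables (K : fieldType) (I J I1 J1 I2 J2 : finType).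
Variables (fI1 : I1 -> I) (fJ1 : J1 -> J) (fI2 : I2 -> I) (fJ2 : J2 -> J).
Variables (gI : I -> I1 + I2) (gJ : J -> J1 + J2).
Hypothesis fIK : cancel (sumf fI1 fI2) gI.
Hypothesis gIK : cancel gI (sumf fI1 fI2).
Hypothesis fJK : cancel (sumf fJ1 fJ2) gJ.
Hypothesis gJK : cancel gJ (sumf fJ1 fJ2).
Variables (g : I -> K) (g1 : I1 -> K) (g2 : I2 -> K).
Variables (lam : J -> I -> K) (lam1 : J1 -> I1 -> K) (lam2 : J2 -> I2 -> K).
Variables (ltJ : rel J) (ltJ1 : rel J1) (ltJ2 : rel J2).
Hypothesis char0 : forall n, n.+1%:R != 0 :> K.
Hypothesis g_neq0 : forall a, g a != 0.
Hypothesis gE1 : forall a, g (fI1 a) = g1 a.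
Hypothesis gE2 : forall a, g (fI2 a) = g2 a.
Hypothesis lam11 : forall c a, lam (fJ1 c) (fI1 a) = lam1 c a.
Hypothesis lam12 : forall c a, lam (fJ1 c) (fI2 a) = 0.
Hypothesis lam21 : forall c a, lam (fJ2 c) (fI1 a) = 0.
Hypothesis lam22 : forall c a, lam (fJ2 c) (fI2 a) = lam2 c a.

Local Notation X := (latspace K I J).
Local Notation X1 := (latspace K I1 J1).
Local Notation X2 := (latspace K I2 J2).
Local Notation L := {ffun J -> int}.
Local Notation L1 := {ffun J1 -> int}.
Local Notation L2 := {ffun J2 -> int}.
Local Notation mom := (momentum lam).
Local Notation mom1 := (momentum lam1).
Local Notation mom2 := (momentum lam2).
Local Notation vec := (@fvec K I J).
Local Notation vec1 := (@fvec K I1 J1).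
Local Notation vec2 := (@fvec K I2 J2).
Local Notation pi := (tpi (K := K) fI1 fI2 gI gJ).

Lemma sum_splitI (V : nmodType) (h : I -> V) :
  \sum_a h a = \sum_a h (fI1 a) + \sum_a h (fI2 a).
Proof.
rewrite (reindex (sumf fI1 fI2)) /=; last first.
  by exists gI => a _; [exact: fIK | exact: gIK].
exact: big_sumType.
Qed.

Lemma sum_splitJ (V : nmodType) (h : J -> V) :
  \sum_a h a = \sum_a h (fJ1 a) + \sum_a h (fJ2 a).
Proof.
rewrite (reindex (sumf fJ1 fJ2)) /=; last first.
  by exists gJ => a _; [exact: fJK | exact: gJK].
exact: big_sumType.
Qed.

Definition res1 (l : L) : L1 := [ffun c => l (fJ1 c)].
Definition res2 (l : L) : L2 := [ffun c => l (fJ2 c)].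

Lemma res1D l l' : res1 (l + l') = res1 l + res1 l'.
Proof. by apply/ffunP => c; rewrite !ffunE. Qed.
Lemma res2D l l' : res2 (l + l') = res2 l + res2 l'.
Proof. by apply/ffunP => c; rewrite !ffunE. Qed.

Lemma res_inj l l' : res1 l = res1 l' -> res2 l = res2 l' -> l = l'.
Proof.
move=> /ffunP e1 /ffunP e2; apply/ffunP => c; rewrite -[c]gJK.
case: (gJ c) => c'; first by have := e1 c'; rewrite !ffunE.
by have := e2 c'; rewrite !ffunE.
Qed.

Lemma res1_glue l1 l2 : res1 (glue_charge gJ l1 l2) = l1.
Proof. by apply/ffunP => c; rewrite !ffunE (gJ1 fJK). Qed.
Lemma res2_glue l1 l2 : res2 (glue_charge gJ l1 l2) = l2.
Proof. by apply/ffunP => c; rewrite !ffunE (gJ2 fJK). Qed.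

Lemma glue_res l : glue_charge gJ (res1 l) (res2 l) = l.
Proof. by apply: res_inj; rewrite ?res1_glue ?res2_glue. Qed.

Lemma momE1 l a : mom l (fI1 a) = mom1 (res1 l) a.
Proof.
rewrite /momentum sum_splitJ [X in _ + X]big1 => [|c _]; last by rewrite lam21 mulr0.
by rewrite addr0; apply: eq_bigr => c _; rewrite ffunE lam11.
Qed.

Lemma momE2 l a : mom l (fI2 a) = mom2 (res2 l) a.
Proof.
rewrite /momentum sum_splitJ [X in X + _]big1 => [|c _]; last by rewrite lam12 mulr0.
by rewrite add0r; apply: eq_bigr => c _; rewrite ffunE lam22.
Qed.

Lemma g1_neq0 a : g1 a != 0. Proof. by rewrite -gE1. Qed.
Lemma g2_neq0 a : g2 a != 0. Proof. by rewrite -gE2. Qed.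

Let F := lattice_fock lam char0 g_neq0.
Let F1 := lattice_fock lam1 char0 g1_neq0.
Let F2 := lattice_fock lam2 char0 g2_neq0.

Lemma f_cover a : (exists a1, a = fI1 a1) \/ (exists a2, a = fI2 a2).
Proof.
by rewrite -[a]gIK; case: (gI a) => a'; [left | right]; exists a'.
Qed.

Local Notation gm := (glue_monom fI1 fI2 gI).

Lemma fI1_eq a a' : (fI1 a == fI1 a') = (a == a').
Proof. exact: (inj_eq (can_inj fIK) (inl a) (inl a')). Qed.
Lemma fI2_eq a a' : (fI2 a == fI2 a') = (a == a').
Proof. exact: (inj_eq (can_inj fIK) (inr a) (inr a')). Qed.
Lemma fI12 a a' : (fI1 a == fI2 a') = false.
Proof. exact: (inj_eq (can_inj fIK) (inl a) (inr a')). Qed.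
Lemma fI21 a a' : (fI2 a == fI1 a') = false.
Proof. exact: (inj_eq (can_inj fIK) (inr a) (inl a')). Qed.

Lemma glue_mul1 a k m1 m2 : gm (fmul a k m1) m2 = fmul (fI1 a) k (gm m1 m2).
Proof.
apply/eqP/cmP => -[c j]; rewrite /fmul cmM !(glue_monomE gIK) cmU /= -[c]gIK fIK.
by case: (gI c) => c' /=; rewrite ?cmM ?cmU !xpair_eqE ?fI1_eq ?fI12.
Qed.

Lemma glue_mul2 a k m1 m2 : gm m1 (fmul a k m2) = fmul (fI2 a) k (gm m1 m2).
Proof.
apply/eqP/cmP => -[c j]; rewrite /fmul cmM !(glue_monomE gIK) cmU /= -[c]gIK fIK.
by case: (gI c) => c' /=; rewrite ?cmM ?cmU !xpair_eqE ?fI2_eq ?fI21.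
Qed.

Lemma glue_div1 a k m1 m2 : gm (divcm m1 (ucm (a, k))) m2 = divcm (gm m1 m2) (ucm (fI1 a, k)).
Proof.
apply/eqP/cmP => -[c j]; rewrite divcmE !(glue_monomE gIK) cmU /= -[c]gIK fIK.
by case: (gI c) => c' /=; rewrite ?divcmE ?cmU !xpair_eqE ?fI1_eq ?fI12 ?subn0.
Qed.

Lemma glue_div2 a k m1 m2 : gm m1 (divcm m2 (ucm (a, k))) = divcm (gm m1 m2) (ucm (fI2 a, k)).
Proof.
apply/eqP/cmP => -[c j]; rewrite divcmE !(glue_monomE gIK) cmU /= -[c]gIK fIK.
by case: (gI c) => c' /=; rewrite ?divcmE ?cmU !xpair_eqE ?fI2_eq ?fI21 ?subn0.
Qed.

Lemma glue_one : gm mone mone = mone.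
Proof.
apply/eqP/cmP => -[c j]; rewrite (glue_monomE gIK) cm1.
by case: (gI _) => a; rewrite cm1.
Qed.

Lemma glue_monom1 m1 m2 a k : gm m1 m2 (fI1 a, k) = m1 (a, k).
Proof. by rewrite (glue_monomE gIK) /= (gI1 fIK). Qed.
Lemma glue_monom2 m1 m2 a k : gm m1 m2 (fI2 a, k) = m2 (a, k).
Proof. by rewrite (glue_monomE gIK) /= (gI2 fIK). Qed.

Let pil := @tpil K I J I1 J1 I2 J2 fI1 fI2 gI gJ.
Let pir := @tpir K I J I1 J1 I2 J2 fI1 fI2 gI gJ.

Lemma tpi_b1 a n x y : fheis g lam (fI1 a) n (pi x y) = pi (fheis g1 lam1 a n x) y.
Proof.
have hl := fheis_lin g lam (fI1 a) n; have hl1 := fheis_lin g1 lam1 a n.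
move: x y; apply: bilinear_ext => [y|x|y|x|l1 m1 l2 m2].
- exact: (lin_comp hl (pil y)).
- exact: (lin_comp hl (pir x)).
- exact: (lin_comp (pil y) hl1).
- exact: pir.
rewrite tpi_vec; case: n {hl hl1} => [[|k]|k].
- rewrite !fheis0 (linZ (pil _)) tpi_vec gE1.
  by rewrite momE1 res1_glue.
- by rewrite !fheisP (linZ (pil _)) tpi_vec gE1 glue_monom1 glue_div1.
- by rewrite !fheisN tpi_vec glue_mul1.
Qed.

Lemma tpi_b2 a n x y : fheis g lam (fI2 a) n (pi x y) = pi x (fheis g2 lam2 a n y).
Proof.
have hl := fheis_lin g lam (fI2 a) n; have hl2 := fheis_lin g2 lam2 a n.
move: x y; apply: bilinear_ext => [y|x|y|x|l1 m1 l2 m2].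
- exact: (lin_comp hl (pil y)).
- exact: (lin_comp hl (pir x)).
- exact: pil.
- exact: (lin_comp (pir x) hl2).
rewrite tpi_vec; case: n {hl hl2} => [[|k]|k].
- rewrite !fheis0 (linZ (pir _)) tpi_vec gE2.
  by rewrite momE2 res2_glue.
- by rewrite !fheisP (linZ (pir _)) tpi_vec gE2 glue_monom2 glue_div2.
- by rewrite !fheisN tpi_vec glue_mul2.
Qed.

Lemma tpi_vac l : vec l mone = pi (vec1 (res1 l) mone) (vec2 (res2 l) mone).
Proof. by rewrite tpi_vec glue_res glue_one. Qed.

Lemma gm_eq1 m1 m2 : (gm m1 m2 == mone) = (m1 == mone) && (m2 == mone).
Proof.
apply/eqP/andP => [E|[/eqP-> /eqP->]]; last exact: glue_one.
split; apply/eqP/eqP/cmP => -[a k]; rewrite cm1.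
  by rewrite -(glue_monom1 m1 m2) E cm1.
by rewrite -(glue_monom2 m1 m2) E cm1.
Qed.

Lemma tpi_coef l x y :
  fcoef l mone (pi x y) = fcoef (res1 l) mone x * fcoef (res2 l) mone y.
Proof.
have cl := @fcoef_lin K I J l mone.
move: x y; apply: (bilinear_ext (Z := K^o)) => [y|x|y|x|l1 m1 l2 m2].
- exact: (lin_comp cl (pil y)).
- exact: (lin_comp cl (pir x)).
- by move=> c x x'; rewrite fcoef_lin mulrDl scalerAl.
- by move=> c y y'; rewrite fcoef_lin mulrDr scalerAr.
rewrite tpi_vec !fcoef_vec gm_eq1 -natrM mulnb; congr (nat_of_bool _)%:R.
have -> : (glue_charge gJ l1 l2 == l) = (l1 == res1 l) && (l2 == res2 l).
  by apply/eqP/andP => [<-|[/eqP-> /eqP->]]; rewrite ?res1_glue ?res2_glue ?glue_res.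
by rewrite andbACA.
Qed.

Lemma tpi_dg c c1 c2 : (forall l, c l = c1 (res1 l) * c2 (res2 l)) ->
  forall x y, fdiag c (pi x y) = pi (fdiag c1 x) (fdiag c2 y).
Proof.
move=> cE; apply: bilinear_ext => [y|x|y|x|l1 m1 l2 m2].
- exact: (lin_comp (@fdiag_lin _ _ _ c) (pil y)).
- exact: (lin_comp (@fdiag_lin _ _ _ c) (pir x)).
- exact: (lin_comp (pil _) (@fdiag_lin _ _ _ c1)).
- exact: (lin_comp (pir _) (@fdiag_lin _ _ _ c2)).
rewrite tpi_vec !fdiag_vec (linZ (pil _)) (linZ (pir _)) tpi_vec cE res1_glue res2_glue.
by rewrite scalerA.
Qed.

Hypothesis intg : forall c c', exists n : int, pairing g (lam c) (lam c') = n%:~R.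
Hypothesis ltJ_irr : irreflexive ltJ.
Hypothesis ltJ_total : forall c c', c != c' -> ltJ c c' = ~~ ltJ c' c.
Hypothesis ltJ11 : forall c c', ltJ (fJ1 c) (fJ1 c') = ltJ1 c c'.
Hypothesis ltJ22 : forall c c', ltJ (fJ2 c) (fJ2 c') = ltJ2 c c'.
Hypothesis ltJ12 : forall c c', ltJ (fJ1 c) (fJ2 c') = true.
Hypothesis ltJ21 : forall c c', ltJ (fJ2 c) (fJ1 c') = false.

Lemma fJ1_inj : injective fJ1.
Proof. by move=> c c' E; have := gJ1 fJK c; rewrite E (gJ1 fJK) => -[]. Qed.
Lemma fJ2_inj : injective fJ2.
Proof. by move=> c c' E; have := gJ2 fJK c; rewrite E (gJ2 fJK) => -[]. Qed.

Lemma ltJ1_irr : irreflexive ltJ1.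
Proof. by move=> c; rewrite -ltJ11 ltJ_irr. Qed.
Lemma ltJ2_irr : irreflexive ltJ2.
Proof. by move=> c; rewrite -ltJ22 ltJ_irr. Qed.
Lemma ltJ1_total c c' : c != c' -> ltJ1 c c' = ~~ ltJ1 c' c.
Proof. by move=> cc; rewrite -!ltJ11 ltJ_total // (inj_eq fJ1_inj). Qed.
Lemma ltJ2_total c c' : c != c' -> ltJ2 c c' = ~~ ltJ2 c' c.
Proof. by move=> cc; rewrite -!ltJ22 ltJ_total // (inj_eq fJ2_inj). Qed.

Lemma pairing_sum mu nu : pairing g mu nu =
  pairing g1 (mu \o fI1) (nu \o fI1) + pairing g2 (mu \o fI2) (nu \o fI2).
Proof.
by rewrite /pairing sum_splitI; congr (_ + _); apply: eq_bigr => a _; rewrite ?gE1 ?gE2.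
Qed.

Lemma pairing11 c c' : pairing g (lam (fJ1 c)) (lam (fJ1 c')) = pairing g1 (lam1 c) (lam1 c').
Proof.
rewrite /pairing sum_splitI [X in _ + X]big1 => [|a _]; last by rewrite lam12 !mul0r.
by rewrite addr0; apply: eq_bigr => a _; rewrite !lam11 gE1.
Qed.

Lemma pairing22 c c' : pairing g (lam (fJ2 c)) (lam (fJ2 c')) = pairing g2 (lam2 c) (lam2 c').
Proof.
rewrite /pairing sum_splitI [X in X + _]big1 => [|a _]; last by rewrite lam21 !mul0r.
by rewrite add0r; apply: eq_bigr => a _; rewrite !lam22 gE2.
Qed.

Lemma pairing21 c c' : pairing g (lam (fJ2 c)) (lam (fJ1 c')) = 0.
Proof.
rewrite /pairing sum_splitI !big1 ?addr0 // => a _; first by rewrite lam12 mulr0.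
by rewrite lam21 !mul0r.
Qed.

Lemma intg1 c c' : exists n : int, pairing g1 (lam1 c) (lam1 c') = n%:~R.
Proof. by rewrite -pairing11. Qed.
Lemma intg2 c c' : exists n : int, pairing g2 (lam2 c) (lam2 c') = n%:~R.
Proof. by rewrite -pairing22. Qed.

Local Notation coc := (cocycle g lam ltJ).
Local Notation coc1 := (cocycle g1 lam1 ltJ1).
Local Notation coc2 := (cocycle g2 lam2 ltJ2).
Local Notation par l := (odd_int (lform g lam l l)).
Local Notation par1 l := (odd_int (lform g1 lam1 l l)).
Local Notation par2 l := (odd_int (lform g2 lam2 l l)).

Lemma gram11 c c' : gram g lam (fJ1 c) (fJ1 c') = gram g1 lam1 c c'.
Proof. by rewrite /gram pairing11. Qed.
Lemma gram22 c c' : gram g lam (fJ2 c) (fJ2 c') = gram g2 lam2 c c'.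
Proof. by rewrite /gram pairing22. Qed.
Lemma gram21 c c' : gram g lam (fJ2 c) (fJ1 c') = 0.
Proof. by rewrite /gram pairing21 -[0]/(0%:~R) intpartE. Qed.

Lemma par_split l : par l = par1 (res1 l) (+) par2 (res2 l).
Proof.
rewrite (odd_norm g lam ltJ_irr ltJ_total).
rewrite (odd_norm g1 lam1 ltJ1_irr ltJ1_total) (odd_norm g2 lam2 ltJ2_irr ltJ2_total).
rewrite sum_splitJ; congr (_ + _); apply: eq_bigr => c _; rewrite ffunE.
  by rewrite gram11.
by rewrite gram22.
Qed.

(** [ltJ] puts the first half before the second, so that mixed terms pair [l] in the second half
    with [l'] in the first. Their Gram entries vanish by orthogonality, and the products of norms
    that remain sum up to the Koszul sign. *)
Lemma cocycle_split l l' : coc l l' =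
  ((-1) ^+ (par2 (res2 l) && par1 (res1 l')) * coc1 (res1 l) (res1 l'))
    * coc2 (res2 l) (res2 l').
Proof.
rewrite !cocycleE -!signr_addb; congr (_ ^+ nat_of_bool _).
rewrite /cocycle_exp sum_splitJ.
rewrite [RHS](_ : _ = cocycle_exp g1 lam1 ltJ1 (res1 l) (res1 l') +
  (par2 (res2 l) * par1 (res1 l') + cocycle_exp g2 lam2 ltJ2 (res2 l) (res2 l'))); last first.
  by rewrite addrCA addrA.
congr (_ + _).
  apply: eq_bigr => c _; rewrite big_mkcond sum_splitJ [X in _ + X]big1 => [|c' _].
    rewrite addr0 [RHS]big_mkcond; apply: eq_bigr => c' _.
    by rewrite ltJ11 !ffunE !gram11.
  by rewrite ltJ21.
rewrite (odd_norm g1 lam1 ltJ1_irr ltJ1_total) (odd_norm g2 lam2 ltJ2_irr ltJ2_total).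
rewrite mulr_suml -big_split; apply: eq_bigr => c _ /=.
rewrite big_mkcond sum_splitJ; congr (_ + _).
  rewrite mulr_sumr; apply: eq_bigr => c' _; rewrite ltJ12 !ffunE gram21 gram11 gram22.
  by rewrite add0r mulrACA.
rewrite [RHS]big_mkcond; apply: eq_bigr => c' _.
by rewrite ltJ22 !ffunE !gram22.
Qed.

Let Vl := @fvert_lin K I J g lam.
Let Vv := fvert_vec lam char0 g_neq0.
Let Vl1 := @fvert_lin K I1 J1 g1 lam1.
Let Vv1 := fvert_vec lam1 char0 g1_neq0.
Let Vl2 := @fvert_lin K I2 J2 g2 lam2.
Let Vv2 := fvert_vec lam2 char0 g2_neq0.

Lemma tpiX_ext (f h : X -> X) : lin f -> lin h ->
  (forall x y, f (pi x y) = h (pi x y)) -> forall x, f x = h x.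
Proof. exact: (tpi_ext gIK gJK). Qed.

Lemma tpiX_univ (beta : X1 -> X2 -> X) :
  (forall y, lin (beta^~ y)) -> (forall x, lin (beta x)) ->
  exists2 f : X -> X, lin f & forall x y, f (pi x y) = beta x y.
Proof. exact: (tpi_univ fIK gIK fJK). Qed.

Lemma fvec_inj (T T' : finType) l m l' m' :
  @fvec K T T' l m = fvec K l' m' -> l = l' /\ m = m'.
Proof.
move=> /(congr1 (fcoef l m)); rewrite !fcoef_vec !eqxx /=.
case: andP => [[/eqP-> /eqP->]//|_] /eqP; by rewrite oner_eq0.
Qed.

Local Notation gl := (glue fI1 fI2 gI gJ).

(** The Koszul sign of [cocycle_split] depends on the charge of [x], whence the diagonal operator;
    [sfield_scale] moves it from the weight to the argument. *)
Lemma state_split b1 b2 n x y : state_field g lam ltJ (gl (b1, b2)) n (pi x y) =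
  zsum (fun i => pi
    (state_field g1 lam1 ltJ1 b1 i (fdiag (fun l => (-1) ^+ (par2 b2.1 && par1 l)) x))
    (state_field g2 lam2 ltJ2 b2 (n - 1 - i) y)).
Proof.
case: b1 => l1 m1; case: b2 => l2 m2; rewrite !state_fieldE /=.
set l := glue_charge gJ l1 l2; set m := gm m1 m2.
have int1 l' : exists n : int, pairing g1 (mom1 (res1 l)) (mom1 l') = n%:~R.
  by exists (lform g1 lam1 (res1 l) l'); exact: (pairing_lform char0 intg1).
have int2 l' : exists n : int, pairing g2 (mom2 (res2 l)) (mom2 l') = n%:~R.
  by exists (lform g2 lam2 (res2 l) l'); exact: (pairing_lform char0 intg2).
pose c1 (l' : L1) : K := (-1) ^+ (par2 (res2 l) && par1 l') * coc1 (res1 l) l'.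
have cE l' : coc l l' = c1 (res1 l') * coc2 (res2 l) (res2 l') := cocycle_split l l'.
have [r1 [r2 [sp]]] := split_sfield F Vl Vv F1 Vl1 Vv1 F2 Vl2 Vv2 f_cover
  (@sum_splitI K) gE1 gE2 momE1 momE2 res1D res2D res_inj pil pir tpiX_ext tpiX_univ
  tpi_b1 tpi_b2 tpi_vac tpi_coef tpi_dg (monomial_list m)
  cE int1 int2.
rewrite monomial_listK tpi_vec => /fvec_inj [_ mE].
(* [r1] and [r2] need not be the lists of [monomial_list]; equality of the products suffices for
   [state_field_ext]. *)
have rE1 : foldr (fun x => fmul x.1 x.2) mone r1 = m1.
  by apply/eqP/cmP => -[a k]; rewrite -(glue_monom1 _ (foldr (fun x => fmul x.1 x.2) mone r2))
    -mE glue_monom1.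
have rE2 : foldr (fun x => fmul x.1 x.2) mone r2 = m2.
  by apply/eqP/cmP => -[a k]; rewrite -(glue_monom2 (foldr (fun x => fmul x.1 x.2) mone r1))
    -mE glue_monom2.
rewrite sp; apply: eq_zsum => i; rewrite (sfield_scale _ F1) res1_glue res2_glue.
have m1E := etrans rE1 (esym (monomial_listK m1)).
have m2E := etrans rE2 (esym (monomial_listK m2)).
rewrite (state_field_ext _ char0 g1_neq0 intg1 ltJ1_irr ltJ1_total m1E).
by rewrite (state_field_ext _ char0 g2_neq0 intg2 ltJ2_irr ltJ2_total m2E).
Qed.

Lemma screening_split mu n x y :
  (forall l, exists n : int, pairing g1 (mu \o fI1) (mom1 l) = n%:~R) ->
  (forall l, exists n : int, pairing g2 (mu \o fI2) (mom2 l) = n%:~R) ->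
  fvert g lam mu 0 (- n - 1) (pi x y) = zsum (fun i => pi
    (fvert g1 lam1 (mu \o fI1) 0 (- i - 1) x)
    (fvert g2 lam2 (mu \o fI2) 0 (- (n - 1 - i) - 1) y)).
Proof.
move=> int1 int2.
have res10 : res1 0 = 0 by apply/ffunP => c; rewrite !ffunE.
have res20 : res2 0 = 0 by apply/ffunP => c; rewrite !ffunE.
have := split_vert F Vl Vv F1 Vl1 Vv1 F2 Vl2 Vv2 f_cover
  (@sum_splitI K) gE1 gE2 momE1 momE2 res1D res2D res_inj pil pir tpiX_ext tpiX_univ
  tpi_b1 tpi_b2 tpi_vac tpi_coef 0 int1 int2 n x y.
by rewrite res10 res20.
Qed.

Lemma fshift0 (T T' : finType) x : @fshift K T T' 0 x = x.
Proof.
apply: (fext (@fshift_lin K T T' 0) (@lin_id _ _)) => gam m.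
by rewrite fshift_vec addr0.
Qed.

(** On the second factor the operator has momentum zero and is the identity at exponent 0, which
    leaves the single term with $i=0$. *)
Lemma screening1 mu x y : (forall a, mu (fI2 a) = 0) ->
  (forall l, exists n : int, pairing g1 (mu \o fI1) (mom1 l) = n%:~R) ->
  fvert g lam mu 0 (- 1) (pi x y) = pi (fvert g1 lam1 (mu \o fI1) 0 (- 1) x) y.
Proof.
move=> mu0 int1.
have p0 l : pairing g2 (mu \o fI2) (mom2 l) = 0%:~R.
  by rewrite /pairing big1 // => a _; rewrite /= mu0 !mul0r.
have := screening_split 0 x y int1 (fun l => ex_intro _ 0 (p0 l)).
rewrite oppr0 sub0r => ->; rewrite (@zsum_single _ _ _ 0) => [|i i0].
  by rewrite oppr0 sub0r (V_zero F2 Vl2 Vv2) // fshift0.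
rewrite (V_zero F2 Vl2 Vv2) //; case: eqP => [e|_]; last exact: (lin0 (pir _)).
by move/eqP: i0; case; lia.
Qed.

Lemma screening2 mu x y : (forall a, mu (fI1 a) = 0) ->
  (forall l, exists n : int, pairing g2 (mu \o fI2) (mom2 l) = n%:~R) ->
  fvert g lam mu 0 (- 1) (pi x y) = pi x (fvert g2 lam2 (mu \o fI2) 0 (- 1) y).
Proof.
move=> mu0 int2.
have p0 l : pairing g1 (mu \o fI1) (mom1 l) = 0%:~R.
  by rewrite /pairing big1 // => a _; rewrite /= mu0 !mul0r.
have := screening_split 0 x y (fun l => ex_intro _ 0 (p0 l)) int2.
rewrite oppr0 sub0r => ->; rewrite (@zsum_single _ _ _ (-1)) => [|i i0].
  by rewrite (V_zero F1 Vl1 Vv1) // fshift0.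
rewrite (V_zero F1 Vl1 Vv1) //; case: eqP => [e|_]; last exact: (lin0 (pil _)).
by move/eqP: i0; case; lia.
Qed.

Local Notation A := (latticeVA g lam ltJ).
Local Notation A1 := (latticeVA g1 lam1 ltJ1).
Local Notation A2 := (latticeVA g2 lam2 ltJ2).
Local Notation X12 := ({malg K[(latbasis I1 J1 * latbasis I2 J2)%type]} : lmodType K).
Local Notation Phi := (split_lattice (K := K) fI1 fJ1 fI2 fJ2 : X -> X12).
Local Notation rb := (restrict2 fI1 fJ1 fI2 fJ2).

Lemma Phi_lin : lin Phi.
Proof. exact: linext_lin. Qed.

Lemma PhiU b : Phi << b >> = << rb b >>.
Proof. exact: linextU. Qed.

Lemma Phi_tpi x y : Phi (pi x y) = tens x y.
Proof.
move: x y; apply: (bilinear_ext (Z := X12)) => [y|x|y|x|l1 m1 l2 m2].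
- exact: (lin_comp Phi_lin (pil y)).
- exact: (lin_comp Phi_lin (pir x)).
- exact: tens_linl.
- exact: tens_linr.
by rewrite !fvecE tensU tpiU PhiU (glueK fIK gIK fJK).
Qed.

Lemma Phi_coef b u : (Phi u)@_(rb b) = u@_b.
Proof. exact: (mcoeff_linext _ _ (can_inj (restrict2K gIK gJK))). Qed.

Lemma Phi_inj : injective Phi.
Proof.
by move=> u v E; apply/malgP => b; rewrite -!Phi_coef E.
Qed.

Lemma Phi_bij : bijective Phi.
Proof.
pose h : X12 -> X := linext (fun x => << gl x >> : X).
have hl : lin h by exact: linext_lin.
exists h => x.
  move: x; apply: (lin_ext (lin_comp hl Phi_lin) (@lin_id _ _)) => b.
  by rewrite PhiU /h linextU (restrict2K gIK gJK).
move: x; apply: (lin_ext (lin_comp Phi_lin hl) (@lin_id _ _)) => b.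
by rewrite /h linextU PhiU (glueK fIK gIK fJK).
Qed.

Lemma Phi_par b : vpar (v := vtensor A1 A2) (rb b) = vpar (v := A) b.
Proof.
rewrite -[LHS]/(vpar (v := A1) (rb b).1 (+) vpar (v := A2) (rb b).2).
by rewrite (vparE char0 intg) (vparE char0 intg1) (vparE char0 intg2) par_split.
Qed.

Lemma Phi_hpart p u : Phi (hpart (A := A) p u) = hpart (A := vtensor A1 A2) p (Phi u).
Proof.
have hl : lin (hpart (A := A) p : X -> X) by exact: linext_lin.
have hl' : lin (hpart (A := vtensor A1 A2) p : X12 -> X12) by exact: linext_lin.
move: u; apply: (lin_ext (lin_comp Phi_lin hl) (lin_comp hl' Phi_lin)) => b.
rewrite PhiU /hpart !linextU Phi_par.
by case: ifP => _; [exact: PhiU | exact: (lin0 Phi_lin)].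
Qed.

Lemma Phi_vac : Phi (vvac A) = vvac (vtensor A1 A2).
Proof.
have := tpi_vac 0; rewrite !fvecE => E.
rewrite -[vvac A]/(<< (0, mone) >> : X) E Phi_tpi.
have -> : res1 0 = 0 by apply/ffunP => c; rewrite !ffunE.
by have -> : res2 0 = 0 by apply/ffunP => c; rewrite !ffunE.
Qed.

Lemma Phi_prod u n v : Phi (vprod (v := A) u n v) = vprod (v := vtensor A1 A2) (Phi u) n (Phi v).
Proof.
pose vp : X -> int -> X -> X := vprod (v := A).
pose vp' : X12 -> int -> X12 -> X12 := vprod (v := vtensor A1 A2).
rewrite -/(vp u n v) -[RHS]/(vp' (Phi u) n (Phi v)).
have vl w : lin (fun u => vp u n w) by exact: linext_lin.
have vl' w : lin (fun u => vp' u n w) by exact: linext_lin.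
move: u; apply: (lin_ext (lin_comp Phi_lin (vl v)) (lin_comp (vl' (Phi v)) Phi_lin)) => b.
rewrite PhiU [vp _ _ _]linextU [vp' _ _ _]linextU.
have sl : lin (state_field g lam ltJ b n).
  by rewrite state_fieldE; exact: (field_lin (sfield_field F Vl Vv _ _ _)).
have ll (h : latbasis I1 J1 * latbasis I2 J2 -> X12) : lin (linext h : X12 -> X12).
  exact: linext_lin.
move: v; apply: (lin_ext (lin_comp Phi_lin sl) (lin_comp (ll _) Phi_lin)) => c.
rewrite PhiU linextU (vparE char0 intg1) (vparE char0 intg2).
have sf1f d : is_field (state_field g1 lam1 ltJ1 d).
  by rewrite state_fieldE; exact: (sfield_field F1 Vl1 Vv1).
have sf2f d : is_field (state_field g2 lam2 ltJ2 d).
  by rewrite state_fieldE; exact: (sfield_field F2 Vl2 Vv2).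
have {1}-> : << c >> = pi << (rb c).1 >> << (rb c).2 >> :> X.
  by rewrite tpiU -surjective_pairing (restrict2K gIK gJK).
have {1}-> : b = gl ((rb b).1, (rb b).2).
  by rewrite -surjective_pairing (restrict2K gIK gJK).
rewrite state_split; set sgn := (-1) ^+ _.
have -> : fdiag (fun l => (-1) ^+ (par2 (rb b).2.1 && par1 l)) << (rb c).1 >> =
    sgn *: << (rb c).1 >> :> X1.
  by case: (rb c).1 @sgn => l1 m1 sgn; rewrite -fvecE fdiag_vec.
rewrite (zsum_lin Phi_lin); last first.
  exact: (zfin_conv pil pir n (upper_zeroP _ (sf1f _)) (upper_zeroP _ (sf2f _))).
rewrite -[X in _ = _ *: X]/(zsum _) -zsumZ.
  apply: eq_zsum => i; rewrite Phi_tpi (linZ (field_lin (sf1f _) i)) (linZ (tens_linl _)).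
  rewrite [vprod _ _ _]linextU [vprod _ _ _]linextU.
  by have -> : n - 1 - i = n - i - 1 by ring.
have [N hN] := zfin_conv pil pir n (upper_zeroP << (rb c).1 >> (sf1f (rb b).1))
  (upper_zeroP << (rb c).2 >> (sf2f (rb b).2)).
exists N => i /hN E; rewrite [vprod _ _ _]linextU [vprod _ _ _]linextU -Phi_tpi.
have -> : n - i - 1 = n - 1 - i by ring.
by rewrite E (lin0 Phi_lin).
Qed.

Lemma Phi_iso : vertex_isomorphism (A := A) (B := vtensor A1 A2) Phi.
Proof.
split; last exact: Phi_bij.
split.
- by [].
- by move=> c u v _ _; exact: Phi_lin.
- move=> p u _ hu b'; rewrite -mcoeff_neq0 => bu.
  have bE : b' = rb (gl b') by rewrite (glueK fIK gIK fJK).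
  by rewrite bE Phi_par; apply: hu; rewrite -mcoeff_neq0 -Phi_coef -bE.
- exact: Phi_vac.
- by move=> u n v _ _; exact: Phi_prod.
- by move=> u v _ _; exact: Phi_inj.
Qed.

(** Contraction of the first factor with a coordinate form, for use in [tensor_kernel]. *)
Lemma slice_exists b1 : exists2 sl : X -> X2, lin sl & forall x y, sl (pi x y) = x@_b1 *: y.
Proof.
apply: (tpi_univ fIK gIK fJK (Z := X2) (beta := fun (x : X1) y => x@_b1 *: y)) => [y c x x'|x c y y'].
  by rewrite mcoeffD mcoeffZ scalerDl scalerA.
by rewrite scalerDr !scalerA mulrC.
Qed.

Lemma slice_expansion (sl : latbasis I1 J1 -> X -> X2) v :
  (forall b, lin (sl b) /\ forall x y, sl b (pi x y) = x@_b *: y) ->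
  exists D : seq (latbasis I1 J1), v = \sum_(b <- D) pi << b >> (sl b v).
Proof.
move=> sll; pose D := undup [seq (rb c).1 | c <- msupp v].
exists D.
have vv : v = \sum_(c <- msupp v) v@_c *: << c >> := malg_basis v.
rewrite {1}vv.
have -> : \sum_(b <- D) pi << b >> (sl b v) =
    \sum_(b <- D) \sum_(c <- msupp v) v@_c *: pi << b >> (sl b << c >>).
  apply: eq_bigr => b _; rewrite {1}vv (lin_sum (lin_comp (pir _) (sll b).1)).
  by apply: eq_bigr => c _; rewrite (linZ (sll b).1) (linZ (pir _)).
rewrite exchange_big; apply: eq_big_seq => c cv /=.
rewrite -scaler_sumr; congr (_ *: _).
have cE : << c >> = pi << (rb c).1 >> << (rb c).2 >> :> X.
  by rewrite tpiU -surjective_pairing (restrict2K gIK gJK).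
have cD : (rb c).1 \in D by rewrite mem_undup; apply: (map_f (fun c => (rb c).1)).
have sE b : sl b << c >> = ((rb c).1 == b)%:R *: << (rb c).2 >>.
  apply: (etrans (congr1 (sl b) cE)); apply: (etrans ((sll b).2 _ _)).
  by congr (_ *: _); rewrite mcoeffU.
apply: (etrans cE); rewrite (bigD1_seq _ cD (undup_uniq _)) /=.
rewrite big1 => [|b bc]; last first.
  by rewrite sE eq_sym (negPf bc) scale0r; exact: (lin0 (pir _)).
by rewrite addr0 sE eqxx scale1r.
Qed.

Lemma tpi_kernel (P1 : (X1 -> X1) -> (X -> X) -> Prop) (P2 : (X2 -> X2) -> (X -> X) -> Prop) v :
  (forall a f, P1 a f -> lin f /\ forall x y, f (pi x y) = pi (a x) y) ->
  (forall a f, P2 a f -> [/\ lin a, lin f & forall x y, f (pi x y) = pi x (a y)]) ->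
  (forall a f, P1 a f -> f v = 0) -> (forall a f, P2 a f -> f v = 0) ->
  exists n (x : 'I_n -> X1) (y : 'I_n -> X2), v = \sum_i pi (x i) (y i) /\
    forall i, (forall a f, P1 a f -> a (x i) = 0) /\ (forall a f, P2 a f -> a (y i) = 0).
Proof.
have sl_ex (b : latbasis I1 J1) : exists t : X -> X2,
    lin t /\ forall x y, t (pi x y) = x@_b *: y.
  by have [t tl tE] := slice_exists b; exists t.
have [sl sll] := choice sl_ex.
have [D vE] := slice_expansion v sll.
apply: (tensor_kernel pil pir (fun b => (sll b).1) (fun b => (sll b).2) _ _ vE).
  by move=> x x0; apply/malgP => b; rewrite x0 mcoeff0.
by move=> f h fl hl fh; exact: (tpi_ext gIK gJK fl hl fh).
Qed.

Variables (P1 : (I1 -> K) -> Prop) (P2 : (I2 -> K) -> Prop).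
Hypothesis intP1 : forall mu, P1 mu -> forall c, exists n : int, pairing g1 mu (lam1 c) = n%:~R.
Hypothesis intP2 : forall mu, P2 mu -> forall c, exists n : int, pairing g2 mu (lam2 c) = n%:~R.

Definition extended_charges (mu : I -> K) : Prop :=
  (forall a, mu (fI2 a) = 0) /\ P1 (mu \o fI1) \/ (forall a, mu (fI1 a) = 0) /\ P2 (mu \o fI2).

Local Notation Q mu := (screening (g := g) (lam := lam) (ltJ := ltJ) mu).
Local Notation Q1 mu := (screening (g := g1) (lam := lam1) (ltJ := ltJ1) mu).
Local Notation Q2 mu := (screening (g := g2) (lam := lam2) (ltJ := ltJ2) mu).
Local Notation W := [set v | forall mu, extended_charges mu -> Q mu v = 0]%classic.

(** The tensor product of the kernels is realised as a joint kernel inside the big lattice algebra.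
    Its axioms thus come from the screening theory, and are transported afterwards. *)
Lemma extended_vsa : vertex_superalgebra (A := A) W.
Proof.
apply: (screening_kernel_vsa char0 g_neq0 intg ltJ_irr ltJ_total) => mu.
have zero (T : finType) (h : T -> K) mu' nu : (forall a, mu' a = 0) \/ (forall a, nu a = 0) ->
    pairing h mu' nu = 0%:~R.
  by case=> z; rewrite /pairing big1 // => a _; rewrite z ?mulr0 ?mul0r.
case=> -[mu0 Pmu] c; rewrite pairing_sum -[c]gJK; case: (gJ c) => c' /=.
- have -> : lam (fJ1 c') \o fI1 = lam1 c' by apply/funext => a; exact: lam11.
  by have [n ->] := intP1 Pmu c'; exists n; rewrite zero ?addr0 //; left.
- exists 0; rewrite !zero ?addr0 //; first by left.
  by right=> a; exact: lam21.
- exists 0; rewrite !zero ?addr0 //; first by right=> a; exact: lam12.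
  by left.
- have -> : lam (fJ2 c') \o fI2 = lam2 c' by apply/funext => a; exact: lam22.
  by have [n ->] := intP2 Pmu c'; exists n; rewrite zero ?add0r //; left.
Qed.

Lemma pairing_mom_int (T J' : finType) (h : T -> K) (lam' : J' -> T -> K) mu :
  (forall c, exists n : int, pairing h mu (lam' c) = n%:~R) ->
  forall l, exists n : int, pairing h mu (momentum lam' l) = n%:~R.
Proof. by move=> im l; exists (mu_gram h lam' mu l); exact: pairing_mu. Qed.

(** Pure tensors of kernel vectors are killed because each operator acts on one factor. The converse
    is [tpi_kernel], with each operator on a factor related to its extension to the whole space. *)
Lemma tens_kernel : tens_set (A1 := A1) (A2 := A2)
    [set v | forall mu, P1 mu -> Q1 mu v = 0]%classic
    [set v | forall mu, P2 mu -> Q2 mu v = 0]%classic = (Phi @` W)%classic.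
Proof.
have Q1E mu x y : (forall a, mu (fI2 a) = 0) -> P1 (mu \o fI1) ->
    fvert g lam mu 0 (- 1) (pi x y) = pi (fvert g1 lam1 (mu \o fI1) 0 (- 1) x) y.
  by move=> m0 Pm; apply: screening1 => //; exact: pairing_mom_int (intP1 Pm).
have Q2E mu x y : (forall a, mu (fI1 a) = 0) -> P2 (mu \o fI2) ->
    fvert g lam mu 0 (- 1) (pi x y) = pi x (fvert g2 lam2 (mu \o fI2) 0 (- 1) y).
  by move=> m0 Pm; apply: screening2 => //; exact: pairing_mom_int (intP2 Pm).
apply/seteqP; split=> [_ [s [sP ->]]|_ [v vW <-]].
  exists (\sum_(p <- s) pi p.1 p.2).
    move=> mu Pmu; rewrite /screening -fvertE (lin_sum (Vl _ _ _)).
    apply: big1_seq => p /andP[_ /sP [p1 p2]]; case: Pmu => -[mu0 Pm].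
      have := p1 _ Pm; rewrite /screening -fvertE Q1E // => ->.
      exact: (lin0 (pil _)).
    have := p2 _ Pm; rewrite /screening -fvertE Q2E // => ->.
    exact: (lin0 (pir _)).
  by rewrite (lin_sum Phi_lin); apply: eq_bigr => p _; rewrite Phi_tpi.
pose R1 (a : X1 -> X1) (f : X -> X) := exists mu, [/\ (forall a, mu (fI2 a) = 0), P1 (mu \o fI1),
  a = fvert g1 lam1 (mu \o fI1) 0 (- 1) & f = fvert g lam mu 0 (- 1)].
pose R2 (a : X2 -> X2) (f : X -> X) := exists mu, [/\ (forall a, mu (fI1 a) = 0), P2 (mu \o fI2),
  a = fvert g2 lam2 (mu \o fI2) 0 (- 1) & f = fvert g lam mu 0 (- 1)].
have [|||| n [x [y [vE xy]]]] := @tpi_kernel R1 R2 v.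
- move=> a f [mu [m0 Pm -> ->]]; split; first exact: Vl.
  by move=> x y; exact: Q1E.
- move=> a f [mu [m0 Pm -> ->]]; split; [exact: Vl2 | exact: Vl |].
  by move=> x y; exact: Q2E.
- by move=> a f [mu [m0 Pm _ ->]]; rewrite fvertE; apply: vW; left.
- by move=> a f [mu [m0 Pm _ ->]]; rewrite fvertE; apply: vW; right.
exists [seq (x i, y i) | i <- enum 'I_n]; split.
  move=> _ /mapP [i _ ->] /=; have [xi yi] := xy i; split=> mu Pm.
    (* A charge of one factor is extended by zero to the other. *)
    pose mu' a := if gI a is inl a' then mu a' else 0.
    have E : mu' \o fI1 = mu by apply/funext => a; rewrite /mu' /= (gI1 fIK).
    rewrite /screening -fvertE -E; apply: (xi _ (fvert g lam mu' 0 (- 1))).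
    by exists mu'; rewrite E; split=> // a; rewrite /mu' (gI2 fIK).
  pose mu' a := if gI a is inr a' then mu a' else 0.
  have E : mu' \o fI2 = mu by apply/funext => a; rewrite /mu' /= (gI2 fIK).
  rewrite /screening -fvertE -E; apply: (yi _ (fvert g lam mu' 0 (- 1))).
  by exists mu'; rewrite E; split=> // a; rewrite /mu' (gI1 fIK).
rewrite big_map big_enum vE (lin_sum Phi_lin).
by apply: eq_bigr => i _; rewrite Phi_tpi.
Qed.

Lemma tens_kernel_vsa : vertex_superalgebra (tens_set (A1 := A1) (A2 := A2)
    [set v | forall mu, P1 mu -> Q1 mu v = 0]%classic
    [set v | forall mu, P2 mu -> Q2 mu v = 0]%classic).
Proof.
rewrite tens_kernel; exact: (vsa_transport Phi_iso Phi_hpart extended_vsa).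
Qed.

End SplitFock.

(** * Equivariant weights of toric Calabi-Yau threefolds *)

Section BaseField.
Variable R : realType.
Local Notation K := (baseField R).

Lemma baseField_char0 n : n.+1%:R != 0 :> K.
Proof.
rewrite -[n.+1%:R](rmorph_nat (@tofrac (mpoly 2 R[i]))) tofrac_eq0.
by rewrite -[n.+1%:R](rmorph_nat (@mpolyC 2 R[i])) mpolyC_eq0 pnatr_eq0.
Qed.

Lemma weight_indep (a b : int) : a%:~R * eps R ord0 + b%:~R * eps R ord_max = 0 :> K ->
  a = 0 /\ b = 0.
Proof.
have zC (z : int) : z%:~R = tofrac (mpolyC 2 z%:~R) :> K by rewrite !rmorph_int.
rewrite !zC -!tofracM -tofracD => /eqP; rewrite tofrac_eq0 => /eqP E.
have ev (v : 'I_2 -> R[i]) : a%:~R * v ord0 + b%:~R * v ord_max = 0.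
  have := congr1 (mpoly.meval v) E.
  by rewrite mpoly.mevalD !mpoly.mevalM !mpoly.mevalC !mpoly.mevalXU.
split; apply/eqP.
  have := ev (fun i => (i == ord0)%:R); rewrite eqxx mulr1 mulr0 addr0.
  by move/eqP; rewrite intr_eq0.
have := ev (fun i => (i == ord_max)%:R); rewrite eqxx mulr1 mulr0 add0r.
by move/eqP; rewrite intr_eq0.
Qed.

End BaseField.

(** The two localization terms of a compact curve, with normal and tangent weights [a] and [b] at
    one fixed point, [a + c * b] and [- b] at the other. *)
Lemma wall_identity (K : fieldType) (a b c : K) : a != 0 -> b != 0 -> a + c * b != 0 ->
  a * - (a * b)^-1 * a + (a + c * b) * - ((a + c * b) * - b)^-1 * (a + c * b) = c.
Proof. by move=> a0 b0 ab0; field; rewrite ?oppr_eq0 a0 b0 ab0. Qed.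

(** * Dual bases of the maximal cones and weights of curves *)

Section Characters.
Variables (R : realType) (Y : toricCY3 R).
Local Notation K := (baseField R).
Local Notation S := (surface Y).
Local Notation ray := (@Defs.ray R Y).
Implicit Types (y s : {set S}) (p q r : S) (m v : 'rV[int]_3).

Lemma dotDl m m' v : dot (m + m') v = dot m v + dot m' v.
Proof. by rewrite -big_split; apply: eq_bigr => j _; rewrite mxE mulrDl. Qed.
Lemma dotZl c m v : dot (c *: m) v = c * dot m v.
Proof. by rewrite mulr_sumr; apply: eq_bigr => j _; rewrite mxE mulrA. Qed.
Lemma dot_mulmx n (A : 'M[int]_(n, 3)) m i : (A *m m^T) i 0 = dot m (row i A).
Proof. by rewrite mxE; apply: eq_bigr => j _; rewrite !mxE mulrC. Qed.

Lemma fixedpt_basis y : fixedpt y -> exists f : 'I_3 -> S,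
  [/\ injective f, y = [set f r | r : 'I_3]%SET & (\matrix_r ray (f r)) \in unitmx].
Proof.
move=> /smooth [f yE fu]; exists f; split => // i j ij; apply/eqP/negPn/negP => ne.
have d0 : \det (\matrix_r ray (f r)) = 0.
  by apply: (determinant_alternate ne) => k; rewrite !mxE ij.
by move: fu; rewrite unitmxE d0 unitr0.
Qed.

Lemma fixedpt_card y : fixedpt y -> #|y| = 3.
Proof. by move=> /fixedpt_basis [f [fi -> _]]; rewrite card_imset // card_ord. Qed.

(* The rays of a maximal cone form a basis of the lattice. *)
Lemma dot_inj y m m' : fixedpt y -> (forall q, q \in y -> dot m (ray q) = dot m' (ray q)) -> m = m'.
Proof.
move=> /fixedpt_basis [f [_ -> fu]] h; apply: trmx_inj.
rewrite -[m^T](mulKmx fu) -[m'^T](mulKmx fu); congr (_ *m _).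
apply/matrixP => i j; rewrite (ord1 j) !dot_mulmx !rowK; apply: h.
by apply: imset_f.
Qed.

Lemma coord_charP y p q : fixedpt y -> p \in y -> q \in y ->
  dot (coord_char y p) (ray q) = (p == q)%:R.
Proof.
move=> yf py qy.
suff: [set m | forall q, q \in y -> dot m (ray q) = (p == q)%:R]%classic (coord_char y p) by apply.
apply: xgetPex; have [f [fi yE fu]] := fixedpt_basis yf.
exists ((invmx (\matrix_r ray (f r)) *m \col_i (p == f i)%:R)^T) => q'; rewrite yE => /imsetP [i _ ->].
by rewrite -[ray (f i)](rowK (fun k => ray (f k))) -dot_mulmx trmxK mulKVmx // mxE.
Qed.

Lemma coord_char_unique y p m : fixedpt y -> p \in y ->
  (forall q, q \in y -> dot m (ray q) = (p == q)%:R) -> coord_char y p = m.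
Proof.
by move=> yf py h; apply: (dot_inj yf) => q qy; rewrite coord_charP // h.
Qed.

Lemma decompose_ray y v : fixedpt y -> v = \sum_(q in y) dot (coord_char y q) v *: ray q.
Proof.
move=> yf; have [f [fi yE fu]] := fixedpt_basis yf.
have fy i : f i \in y by rewrite yE imset_f.
pose D : 'M[int]_3 := \matrix_i coord_char y (f i).
have DM : D^T *m (\matrix_i ray (f i)) = 1%:M.
  rewrite -[RHS]trmx1 -[LHS]trmxK trmx_mul trmxK; congr trmx; apply: mulmx1C.
  apply/matrixP => i j; rewrite !mxE -(inj_eq fi) -(coord_charP yf (fy i) (fy j)).
  by apply: eq_bigr => k _; rewrite !mxE.
rewrite -{1}[v]mulmx1 -DM mulmxA mulmx_sum_row yE big_imset /=; last by move=> i j _ _; exact: fi.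
apply: eq_bigr => i _; rewrite rowK -yE; congr (_ *: _).
by rewrite mxE; apply: eq_bigr => j _; rewrite !mxE mulrC.
Qed.

Definition char_weight m : K := \sum_(i < 2) (m 0 (widen_ord (leqnSn 2) i))%:~R * eps R i.

Lemma char_weightD m m' : char_weight (m + m') = char_weight m + char_weight m'.
Proof.
by rewrite -big_split; apply: eq_bigr => i _; rewrite mxE intrD mulrDl.
Qed.

Lemma char_weightZ (c : int) m : char_weight (c *: m) = c%:~R * char_weight m.
Proof.
by rewrite mulr_sumr; apply: eq_bigr => i _; rewrite mxE intrM mulrA.
Qed.

(** A character of weight zero is a multiple of the last coordinate, hence constant on the rays by
    [calabi_yau], whereas this one is 1 on [p] and 0 on the other rays of [y]. *)
Lemma weight_neq0 y p : fixedpt y -> p \in y -> weight y p != 0.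
Proof.
move=> yf py; apply/eqP; rewrite /weight !big_ord_recl big_ord0 addr0 /=.
set m := coord_char y p.
have e1 : lift ord0 ord0 = ord_max :> 'I_2 by apply/val_inj.
rewrite e1 => /weight_indep [m0 m1].
have mE q : dot m (ray q) = m 0 ord_max.
  rewrite /dot !big_ord_recl big_ord0 addr0 /=.
  have -> : ord0 = widen_ord (leqnSn 2) ord0 by apply/val_inj.
  have -> : lift (widen_ord (leqnSn 2) ord0) ord0 = widen_ord (leqnSn 2) ord_max by apply/val_inj.
  have -> : lift (widen_ord (leqnSn 2) ord0) (lift ord0 ord0) = ord_max by apply/val_inj.
  by rewrite m0 m1 !mul0r !add0r (calabi_yau q) mulr1.
have : (0 < #|y :\ p|)%N by have := cardsD1 p y; rewrite py (fixedpt_card yf); lia.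
move=> /card_gt0P [q]; rewrite in_setD1 => /andP[qp qy].
have := mE q; rewrite -(mE p) !coord_charP // eqxx eq_sym (negPf qp).
by [].
Qed.

Definition real_dot m (x : 'rV[R]_3) : R := \sum_j (m 0 j)%:~R * x 0 j.

Lemma real_dot_sum m (A : {set S}) (w : S -> R) :
  real_dot m (\sum_(i in A) w i *: map_mx intr (ray i)) =
  \sum_(i in A) w i * (dot m (ray i))%:~R.
Proof.
rewrite /real_dot; under eq_bigr do rewrite summxE mulr_sumr.
rewrite exchange_big; apply: eq_bigr => i _ /=.
rewrite rmorph_sum mulr_sumr; apply: eq_bigr => j _.
by rewrite !mxE rmorphM mulrCA.
Qed.

Lemma int_mul1 (c z : int) : c * z = 1 -> z = 1 \/ z = -1.
Proof.
move=> /(congr1 absz); rewrite abszM => /eqP; rewrite muln_eq1 => /andP[_ /eqP].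
by lia.
Qed.

(* The two maximal cones lie on opposite sides of their common wall. *)
Lemma wall_opposite s r1 r2 : fixedpt (r1 |: s)%SET -> fixedpt (r2 |: s)%SET ->
  r1 \notin s -> r2 \notin s -> r1 != r2 -> dot (coord_char (r1 |: s)%SET r1) (ray r2) = -1.
Proof.
set y1 := (r1 |: s)%SET; set y2 := (r2 |: s)%SET => f1 f2 n1 n2 r12.
have r1y : r1 \in y1 by rewrite setU11.
have r2y : r2 \in y2 by rewrite setU11.
have sy1 q : q \in s -> q \in y1 by move=> qs; rewrite in_setU1 qs orbT.
have sy2 q : q \in s -> q \in y2 by move=> qs; rewrite in_setU1 qs orbT.
have ne1 q : q \in s -> (r1 == q) = false by move=> qs; apply: contraNF n1 => /eqP->.
have ne2 q : q \in s -> (r2 == q) = false by move=> qs; apply: contraNF n2 => /eqP->.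
set z := dot _ _; pose c := dot (coord_char y2 r2) (ray r1).
have E : coord_char y2 r2 = c *: coord_char y1 r1.
  apply: (dot_inj f1) => q; rewrite in_setU1 dotZl => /orP[/eqP->|qs].
    by rewrite (coord_charP f1 r1y r1y) eqxx mulr1.
  by rewrite (coord_charP f1 r1y (sy1 q qs)) (coord_charP f2 r2y (sy2 q qs)) ne1 // ne2 // mulr0.
have cz : c * z = 1 by rewrite /z -dotZl -E (coord_charP f2 r2y r2y) eqxx.
have [z1|//] := int_mul1 cz.
pose x q := dot (coord_char y1 q) (ray r2).
have rE : ray r2 = ray r1 + \sum_(q in s) x q *: ray q.
  by rewrite {1}(decompose_ray (ray r2) f1) big_setU1 //= -/z z1 scale1r.
(* If $z=1$, adding to [ray r1] the positive parts of [x], or to [ray r2] the negative ones, gives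
   one point of both cones. It is not in the cone of the wall, as the character of [r1] is 1
   there. *)
pose w1 (i : S) : R := if i == r1 then 1 else (Num.max (x i) 0)%:~R.
pose w2 (i : S) : R := if i == r2 then 1 else (Num.max (- x i) 0)%:~R.
pose v := \sum_(i in y1) w1 i *: map_mx intr (ray i).
have vE : v = \sum_(i in y2) w2 i *: map_mx intr (ray i).
  rewrite /v !big_setU1 //= /w1 /w2 !eqxx !scale1r rE map_mxD -addrA; congr (_ + _).
  rewrite raddf_sum -big_split; apply: eq_bigr => q qs /=.
  rewrite ![q == _]eq_sym ne1 // ne2 // map_mxZ -scalerDl -intrD; congr (_%:~R *: _).
  by case: (lerP 0 (x q)); lia.
have ge0 (i : S) : 0 <= w1 i /\ 0 <= w2 i.
  by split; rewrite /w1 /w2; case: ifP => _; rewrite ?ler01 // ler0z le_max lexx orbT.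
have c1 : cone ray y1 v by exists w1 => // i; exact: (ge0 i).1.
have c2 : cone ray y2 v by exists w2 => // i; exact: (ge0 i).2.
have := fan_inter f1 f2; rewrite -/ray => /seteqP [/(_ v (conj c1 c2)) + _].
have -> : (y1 :&: y2)%SET = s.
  apply/setP => q; rewrite !inE; case: (q \in s); rewrite ?orbT // !orbF.
  by case: eqP => // ->; exact: negPf.
case=> w _ vs.
have := congr1 (real_dot (coord_char y1 r1)) vs; rewrite !real_dot_sum.
rewrite big_setU1 //= (coord_charP f1 r1y r1y) eqxx /w1 eqxx mulr1 big1 => [|q qs]; last first.
  by rewrite (coord_charP f1 r1y (sy1 q qs)) ne1 // mulr0.
rewrite big1 => [|q qs]; last by rewrite (coord_charP f1 r1y (sy1 q qs)) ne1 // mulr0.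
by move/eqP; rewrite addr0 oner_eq0.
Qed.

(** The dual basis of the second cone in terms of that of the first: the vector of [r1] changes
    sign, and those of [s] are corrected by multiples of it so as to vanish on [r2]. *)
Lemma wall_weights s r1 r2 : fixedpt (r1 |: s)%SET -> fixedpt (r2 |: s)%SET ->
  r1 \notin s -> r2 \notin s -> r1 != r2 ->
  weight (r2 |: s)%SET r2 = - weight (r1 |: s)%SET r1 /\
  forall q, q \in s -> exists n : int,
    weight (r2 |: s)%SET q = weight (r1 |: s)%SET q + n%:~R * weight (r1 |: s)%SET r1.
Proof.
set y1 := (r1 |: s)%SET; set y2 := (r2 |: s)%SET => f1 f2 n1 n2 r12.
have r1y : r1 \in y1 by rewrite setU11.
have r2y : r2 \in y2 by rewrite setU11.
have sy1 q : q \in s -> q \in y1 by move=> qs; rewrite in_setU1 qs orbT.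
have sy2 q : q \in s -> q \in y2 by move=> qs; rewrite in_setU1 qs orbT.
have ne1 q : q \in s -> (r1 == q) = false by move=> qs; apply: contraNF n1 => /eqP->.
have ne2 q : q \in s -> (r2 == q) = false by move=> qs; apply: contraNF n2 => /eqP->.
have opp := wall_opposite f1 f2 n1 n2 r12.
split.
  rewrite -[weight y1 r1]/(char_weight _) -mulN1r -[-1 in RHS]/((-1)%:~R) -char_weightZ.
  rewrite -[LHS]/(char_weight _); congr char_weight; apply: coord_char_unique => // q.
  rewrite in_setU1 dotZl => /orP[/eqP->|qs]; first by rewrite opp eqxx.
  by rewrite (coord_charP f1 r1y (sy1 q qs)) ne1 // ne2.
move=> q qs; exists (dot (coord_char y1 q) (ray r2)).
rewrite -[weight y1 r1]/(char_weight _) -char_weightZ -[weight y1 q]/(char_weight _).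
rewrite -char_weightD -[LHS]/(char_weight _); congr char_weight.
apply: coord_char_unique => //; first exact: sy2.
move=> q'; rewrite in_setU1 dotDl dotZl => /orP[/eqP->|qs'].
  by rewrite opp mulrN1 subrr eq_sym ne2.
by rewrite (coord_charP f1 (sy1 q qs) (sy1 q' qs')) (coord_charP f1 r1y (sy1 q' qs')) ne1 // mulr0 addr0.
Qed.

(** The contribution of the fixed point [y] to the pairing of the curves [s] and [s'] on the surface
    [p]. *)
Definition local_term s s' y p : K :=
  euler_normal s y p * - (euler_tangent y p)^-1 * euler_normal s' y p.

Lemma card2_set s p : #|s| = 2 -> p \in s -> exists2 q, p != q & s = [set p; q].
Proof.
move=> s2 ps; have /cards1P [q sq] : #|s :\ p| == 1%N.
  by have := cardsD1 p s; rewrite ps s2; lia.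
exists q; last by rewrite -(finset.setD1K ps) sq.
by have : q \in s :\ p; [rewrite sq set11 | rewrite in_setD1 eq_sym => /andP[]].
Qed.

Lemma fixedpt_wall s y : #|s| = 2 -> fixedpt y -> s \subset y ->
  exists2 r, r \notin s & y = (r |: s)%SET.
Proof.
move=> s2 yf sy; have /cards1P [r yr] : #|y :\: s| == 1%N.
  by rewrite cardsD (finset.setIidPr sy) s2 (fixedpt_card yf).
have : r \in y :\: s by rewrite yr set11.
rewrite finset.in_setD => /andP[rs _]; exists r => //.
by rewrite -(finset.setID y s) (finset.setIidPr sy) yr finset.setUC.
Qed.

Lemma euler_normalE s y p q : p != q -> s = [set p; q] -> euler_normal s y p = weight y q.
Proof.
move=> pq ->; rewrite /euler_normal (_ : _ :\ p = [set q])%SET ?big_set1 //.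
by apply/setP => x; rewrite !inE; case: eqVneq => [->|] //=; rewrite (negPf pq).
Qed.

Lemma euler_tangentE p q r : p != q -> p != r -> q != r ->
  euler_tangent [set p; q; r] p = weight [set p; q; r] q * weight [set p; q; r] r.
Proof.
move=> pq pr qr; rewrite /euler_tangent (_ : _ :\ p = q |: [set r])%SET.
  by rewrite big_setU1 ?big_set1 ?inE.
apply/setP => x; rewrite !inE; case: eqVneq => [->|_] //=.
by rewrite (negPf pq) (negPf pr).
Qed.

Lemma distinct_curves_pairing s s' p : #|s| = 2 -> #|s'| = 2 -> p \in s -> p \in s' -> s != s' ->
  exists n : int,
    \sum_(y | [&& fixedpt y, p \in y, s \subset y & s' \subset y]) local_term s s' y p = n%:~R.
Proof.
move=> s2 s2' ps ps' ss'.
have [q pq sE] := card2_set s2 ps; have [q' pq' sE'] := card2_set s2' ps'.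
have qq' : q != q' by apply: contraNneq ss' => qq; rewrite sE sE' qq.
(* A fixed point on both curves has these three rays, hence no others. *)
pose y0 : {set S} := [set p; q; q'].
have yE y : [&& fixedpt y, p \in y, s \subset y & s' \subset y] -> y = y0.
  move=> /and4P [yf py sy sy']; apply/esym/eqP; rewrite eqEcard (fixedpt_card yf).
  have -> : y0 \subset y.
    apply/fintype.subsetP => x; rewrite !inE => /orP[/orP[]|] /eqP -> //.
      by apply: (fintype.subsetP sy); rewrite sE !inE eqxx orbT.
    by apply: (fintype.subsetP sy'); rewrite sE' !inE eqxx orbT.
  by rewrite /y0 finset.setUC cardsU1 cards2 !inE eq_sym (negPf pq') eq_sym (negPf qq') pq.
have [yf|yf] := boolP [&& fixedpt y0, p \in y0, s \subset y0 & s' \subset y0]; last first.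
  by exists 0; rewrite big_pred0 // => y; apply: contraNF yf => yP; rewrite -(yE y).
exists (-1); rewrite (big_pred1 y0) => [|y]; last first.
  by apply/idP/eqP => [/yE//|->].
have f0 := and4P yf; case: f0 => f0 _ _ _.
have wq : weight y0 q != 0 by apply: weight_neq0; rewrite // !inE eqxx orbT.
have wq' : weight y0 q' != 0 by apply: weight_neq0; rewrite // !inE eqxx orbT.
rewrite /local_term (euler_normalE _ pq sE) (euler_normalE _ pq' sE') euler_tangentE // -/y0.
by rewrite mulrN mulNr invfM mulrA mulfV // mul1r mulVf.
Qed.

Lemma compact_self_pairing s p : compact_curve s -> p \in s -> exists n : int,
    \sum_(y | [&& fixedpt y, p \in y, s \subset y & s \subset y]) local_term s s y p = n%:~R.
Proof.
move=> /andP[/andP[/eqP s2 _]] /cards2P [y1 [y2 [y12 yE]]] ps.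
have yP y : fixedpt y && (s \subset y) = (y == y1) || (y == y2).
  by have := congr1 (fun A : {set {set S}} => y \in A) yE; rewrite !inE.
have /andP[f1 sy1] : fixedpt y1 && (s \subset y1) by rewrite yP eqxx.
have /andP[f2 sy2] : fixedpt y2 && (s \subset y2) by rewrite yP eqxx orbT.
rewrite (eq_bigl (mem [set y1; y2])) => [|y]; last first.
  rewrite /= !inE -yP andbb; case: (boolP (s \subset y)) => [sy|]; last by rewrite !andbF.
  by rewrite (fintype.subsetP sy p ps).
rewrite big_setU1 ?inE // big_set1.
have [r1 n1 E1] := fixedpt_wall s2 f1 sy1; have [r2 n2 E2] := fixedpt_wall s2 f2 sy2.
have [q pq sE] := card2_set s2 ps.
have r12 : r1 != r2 by apply: contraNneq y12 => rr; rewrite E1 E2 rr.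
have := wall_weights (s := s) _ _ n1 n2 r12; rewrite -E1 -E2 => /(_ f1 f2) [wr wq].
have qs : q \in s by rewrite sE !inE eqxx orbT.
have [n wqE] := wq q qs; exists n.
have tan r y : r \notin s -> y = (r |: s)%SET -> euler_tangent y p = weight y q * weight y r.
  move=> rs yE'; have rp : p != r by apply: contraNneq rs => <-.
  have rq : q != r by apply: contraNneq rs => <-.
  have -> : y = [set p; q; r] by rewrite yE' sE finset.setUC.
  exact: euler_tangentE.
have w1 : weight y1 r1 != 0 by apply: weight_neq0; rewrite // E1 setU11.
have w1q : weight y1 q != 0 by apply: weight_neq0; rewrite // (fintype.subsetP sy1 q qs).
have w2q : weight y2 q != 0 by apply: weight_neq0; rewrite // (fintype.subsetP sy2 q qs).
rewrite /local_term !(euler_normalE _ pq sE) (tan _ _ n1 E1) (tan _ _ n2 E2).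
rewrite wr; move: w2q; rewrite wqE => w2q.
exact: wall_identity.
Qed.

End Characters.

(** * Integrality of the pairings attached to the divisor *)

Section Divisor.
Variables (R : realType) (Y : toricCY3 R) (N : nat) (d : 'I_N -> surface Y).
Local Notation K := (baseField R).
Local Notation S := (surface Y).
Local Notation lam := (lambda_compact (d := d)).
Local Notation g := (formS (d := d)).

Lemma formS_neq0 (a : fixS d) : g a != 0.
Proof.
have /andP[yf py] := valP a.
rewrite /formS oppr_eq0 invr_eq0; apply/prodf_neq0 => q; rewrite in_setD1 => /andP[_ qy].
exact: weight_neq0.
Qed.

Lemma sum_fixS (h : 'I_N * {set S} -> K) : \sum_(a : fixS d) h (val a) =
  \sum_k \sum_(y | fixedpt y && (d k \in y)) h (k, y).
Proof.
rewrite pair_big_dep /=.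
have -> : \sum_(a : fixS d) h (val a) =
    \sum_(p in (fun a : 'I_N * {set S} => fixedpt a.2 && (d a.1 \in a.2)) : {pred _}) h p.
  exact/esym/(@big_sub _ _ _ _ (fun a : 'I_N * {set S} => fixedpt a.2 && (d a.1 \in a.2)) h).
by apply: eq_bigr => -[].
Qed.

Lemma curve_sum k (s s' : {set S}) :
  \sum_(a : fixS d) (if [&& (val a).1 == k, s \subset (val a).2 & s' \subset (val a).2]
    then local_term s s' (val a).2 (d k) else 0) =
  \sum_(y | [&& fixedpt y, d k \in y, s \subset y & s' \subset y]) local_term s s' y (d k).
Proof.
rewrite (sum_fixS (fun x => if [&& x.1 == k, s \subset x.2 & s' \subset x.2]
    then local_term s s' x.2 (d k) else 0)).
rewrite (bigD1 k) //= [X in _ + X]big1 => [|k' k'k]; last first.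
  by rewrite big1 // => y _; rewrite (negPf k'k).
rewrite addr0 eqxx -big_mkcondr; apply: eq_bigl => y; by rewrite -andbA.
Qed.

Lemma curve_card (s : {set S}) : curve s -> #|s| = 2.
Proof. by move=> /andP[/eqP]. Qed.

Lemma compact_pairing c c' : exists n : int, pairing g (lam c) (lam c') = n%:~R.
Proof.
case: c => -[k s] /= kp; case: c' => -[k' s'] /= kp'.
have /andP[cs ks] := kp; have /andP[cs' ks'] := kp'.
have s2 : #|s| = 2 by case/andP: cs => /curve_card.
have s2' : #|s'| = 2 by case/andP: cs' => /curve_card.
have [kk|kk] := eqVneq k k'; last first.
  exists 0; rewrite /pairing big1 // => a _; rewrite /lambda_compact /=.
  case: eqVneq => [->|] /=; last by rewrite !mul0r.
  by rewrite (negPf kk) mulr0.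
move: kp' ks'; rewrite -kk => kp' ks'.
have -> : pairing g (lam (exist _ (k, s) kp)) (lam (exist _ (k, s') kp')) =
    \sum_(y | [&& fixedpt y, d k \in y, s \subset y & s' \subset y]) local_term s s' y (d k).
  rewrite -curve_sum; apply: eq_bigr => a _; rewrite /lambda_compact /=.
  case: eqVneq => [E|] /=; last by rewrite !mul0r.
  case: ifP => _ /=; last by rewrite !mul0r.
  case: ifP => _ /=; last by rewrite mulr0.
  by rewrite /formS E.
have [ss|ss] := eqVneq s s'; last exact: distinct_curves_pairing.
by rewrite -ss; apply: compact_self_pairing.
Qed.

(** A non-compact curve differs from every compact one, so that at levels [k] and [k'] the pairing
    is that of distinct curves, with opposite sign at [k']. *)
Lemma screen_pairing k k' (s : screen_curve d k k') c :
  exists n : int, pairing g (lambda_screen (d := d) k k' (val s)) (lam c) = n%:~R.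
Proof.
case: s => s /= /and3P [ns ks ks']; case: c => -[k2 s'] /= kp.
have /andP[cs' k2s'] := kp.
have s2 : #|s| = 2 by case/andP: ns => /curve_card.
have s2' : #|s'| = 2 by case/andP: cs' => /curve_card.
have ss : s != s' by apply: contraTneq ns => ->; rewrite /noncompact_curve cs' andbF.
set mu := lam _.
have muE a : mu a = if ((val a).1 == k2) && (s' \subset (val a).2)
    then euler_normal s' (val a).2 (d k2) else 0 by [].
move: mu muE => mu muE {kp}; rewrite /pairing.
have main : d k2 \in s -> exists n : int, \sum_(a : fixS d)
   (if [&& (val a).1 == k2, s \subset (val a).2 & s' \subset (val a).2]
    then local_term s s' (val a).2 (d k2) else 0) = n%:~R :> K.
  by move=> k2s; rewrite curve_sum; apply: distinct_curves_pairing.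
have [k2k|k2k] := eqVneq k2 k.
  move: main muE; rewrite k2k => /(_ ks) [n E] muE; exists n; rewrite -E.
  apply: eq_bigr => a _; rewrite muE /lambda_screen /=.
  case: eqVneq => [aE|] /=; last by rewrite mulr0.
  case: (s \subset _); case: (s' \subset _); rewrite ?mulr0 ?mul0r //.
  by rewrite /formS aE.
have [k2k'|k2k'] := eqVneq k2 k'.
  move: main muE; rewrite k2k' => /(_ ks') [n E] muE; exists (- n).
  rewrite rmorphN /= -E -sumrN; apply: eq_bigr => a _.
  rewrite muE /lambda_screen /=; rewrite k2k' in k2k.
  case: (eqVneq (val a).1 k') => [aE|] /=; last by rewrite mulr0 oppr0.
  rewrite aE (negPf k2k).
  case: (s \subset _); case: (s' \subset _); rewrite ?mulr0 ?mul0r ?oppr0 //=.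
  by rewrite /formS aE /local_term !mulNr.
exists 0; rewrite big1 // => a _; rewrite muE /lambda_screen /=.
case: (eqVneq (val a).1 k2) => [->|] /=; last by rewrite mulr0.
by rewrite (negPf k2k) (negPf k2k') if_same mul0r mul0r.
Qed.

Lemma lt_curveS_irr : irreflexive (lt_curveS (d := d)).
Proof. by move=> c; rewrite /lt_curveS !ltnn andbF. Qed.

Lemma lt_curveS_total (c c' : curveS d) : c != c' -> lt_curveS c c' = ~~ lt_curveS c' c.
Proof.
move=> cc; rewrite /lt_curveS; have [e|ne] := eqVneq (val c).1 (val c').1.
  rewrite e !ltnn /= -leqNgt ltn_neqAle.
  case: eqP => // /val_inj /enum_rank_inj e'.
  case/eqP: cc; apply: val_inj.
  by rewrite [val c]surjective_pairing [val c']surjective_pairing e e'.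
by rewrite /= !orbF -leqNgt ltn_neqAle ne.
Qed.

End Divisor.

(** * Restriction of the filtration *)

(** Evaluates the preimage chosen in [Q_tensor]. *)
Lemma xget_fibre (T : choiceType) (T' : Type) (f : T -> T') (x0 v : T) : injective f ->
  xget x0 [set u | f u = f v]%classic = v.
Proof.
by move=> fi; apply: fi; exact: (xgetPex (P := [set u | f u = f v]%classic) x0 (ex_intro _ v erefl)).
Qed.

Lemma sumf_inverse (T T1 T2 : finType) (f1 : T1 -> T) (f2 : T2 -> T) :
  injective f1 -> injective f2 -> (forall x y, f1 x != f2 y) ->
  (forall z, (exists x, z = f1 x) \/ (exists y, z = f2 y)) ->
  exists h, cancel (sumf f1 f2) h /\ cancel h (sumf f1 f2).
Proof.
move=> i1 i2 i12 cov.
have ex z : exists x, sumf f1 f2 x = z.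
  by case: (cov z) => -[x ->]; [exists (inl x) | exists (inr x)].
have [h hK] := choice ex; exists h; split=> // x.
have := hK (sumf f1 f2 x); move: (h _) => y; case: y => y; case: x => x /=.
- by move=> /i1 ->.
- by move/eqP; rewrite (negPf (i12 _ _)).
- by move/esym/eqP; rewrite (negPf (i12 _ _)).
- by move=> /i2 ->.
Qed.

(** Serves both the fixed points and the compact curves, which are split by their level only. *)
Lemma shift_inverse (a b : nat) (T : finType) (p : pred ('I_(a + b) * T))
    (f1 : {x : 'I_a * T | p (lshift b x.1, x.2)} -> {x | p x})
    (f2 : {x : 'I_b * T | p (rshift a x.1, x.2)} -> {x | p x}) :
  (forall x, val (f1 x) = (lshift b (val x).1, (val x).2)) ->
  (forall x, val (f2 x) = (rshift a (val x).1, (val x).2)) ->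
  exists h, cancel (sumf f1 f2) h /\ cancel h (sumf f1 f2).
Proof.
move=> f1E f2E; apply: sumf_inverse.
- move=> x y /(congr1 val); rewrite !f1E => -[/val_inj e1 e2]; apply: val_inj.
  by rewrite [val x]surjective_pairing [val y]surjective_pairing e1 e2.
- move=> x y /(congr1 val); rewrite !f2E => -[/addnI /val_inj e1 e2]; apply: val_inj.
  by rewrite [val x]surjective_pairing [val y]surjective_pairing e1 e2.
- move=> x y; apply/eqP => /(congr1 val); rewrite f1E f2E => -[e _].
  by have := ltn_ord (val x).1; rewrite e ltnNge leq_addr.
- move=> [[k y] H]; case: (splitP k) => j E.
    have kE : k = lshift b j by apply: val_inj.
    by subst k; left; exists (exist _ (j, y) H); apply: val_inj; rewrite f1E.
  have kE : k = rshift a j by apply: val_inj.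
  by subst k; right; exists (exist _ (j, y) H); apply: val_inj; rewrite f2E.
Qed.

Section Canonical.
Variables (R : realType) (Y : toricCY3 R) (a b : nat) (d : 'I_(a + b) -> surface Y).
Local Notation fs := (fix_sub (d := d)).
Local Notation fq := (fix_quo (d := d)).
Local Notation cs := (curve_sub (d := d)).
Local Notation cq := (curve_quo (d := d)).

Lemma fix_inverse : exists h, cancel (sumf fs fq) h /\ cancel h (sumf fs fq).
Proof. exact: shift_inverse. Qed.

Lemma curve_inverse : exists h, cancel (sumf cs cq) h /\ cancel h (sumf cs cq).
Proof. exact: shift_inverse. Qed.

Lemma formS_sub x : formS (fs x) = formS x. Proof. by []. Qed.
Lemma formS_quo x : formS (fq x) = formS x. Proof. by []. Qed.

Lemma lambda_sub_sub c x : lambda_compact (cs c) (fs x) = lambda_compact c x.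
Proof. by rewrite /lambda_compact /= eq_lshift. Qed.
Lemma lambda_sub_quo c x : lambda_compact (cs c) (fq x) = 0.
Proof. by rewrite /lambda_compact /= eq_rlshift. Qed.
Lemma lambda_quo_sub c x : lambda_compact (cq c) (fs x) = 0.
Proof. by rewrite /lambda_compact /= eq_lrshift. Qed.
Lemma lambda_quo_quo c x : lambda_compact (cq c) (fq x) = lambda_compact c x.
Proof. by rewrite /lambda_compact /= eq_rshift. Qed.

Lemma lt_sub_sub c c' : lt_curveS (cs c) (cs c') = lt_curveS c c'.
Proof. by rewrite /lt_curveS /= eq_lshift. Qed.
Lemma lt_quo_quo c c' : lt_curveS (cq c) (cq c') = lt_curveS c c'.
Proof. by rewrite /lt_curveS /= eq_rshift ltn_add2l. Qed.
Lemma lt_sub_quo c c' : lt_curveS (cs c) (cq c') = true.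
Proof. by rewrite /lt_curveS /= ltn_addr. Qed.
Lemma lt_quo_sub c c' : lt_curveS (cq c) (cs c') = false.
Proof. by rewrite /lt_curveS /= eq_rlshift orbF ltnNge ltnW // ltn_addr. Qed.

End Canonical.

(** Only the momentum of a screening operator is kept, so that [VY] takes the form of the joint
    kernels above. *)
Definition screening_charge (R : realType) (Y : toricCY3 R) N (d : 'I_N -> surface Y)
    (mu : fixS d -> baseField R) : Prop :=
  exists k k' (s : screen_curve d k k'), k' = k.+1 :> nat /\ mu = lambda_screen k k' (val s).

Section Screenings.
Variables (R : realType) (Y : toricCY3 R) (N : nat) (d : 'I_N -> surface Y).

Lemma VY_charges : VY (d := d) = [set v | forall mu, screening_charge mu ->
  screening (g := formS (d := d)) (lam := lambda_compact (d := d))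
    (ltJ := lt_curveS (d := d)) mu v = 0]%classic.
Proof.
apply/seteqP; split=> [v vV mu [k [k' [s [kk ->]]]]|v vV k k' s kk].
  exact: vV.
by apply: vV; exists k, k', s.
Qed.

Lemma screening_charge_int mu : screening_charge mu -> forall c : curveS d,
  exists n : int, pairing (formS (d := d)) mu (lambda_compact c) = n%:~R.
Proof. by move=> [k [k' [s [_ ->]]]] c; exact: screen_pairing. Qed.

Lemma VY_vsa : vertex_superalgebra (VY (d := d)).
Proof.
rewrite VY_charges; apply: screening_kernel_vsa.
- exact: baseField_char0.
- exact: formS_neq0.
- exact: compact_pairing.
- exact: lt_curveS_irr.
- exact: lt_curveS_total.
- exact: screening_charge_int.
Qed.

End Screenings.

Section Extension.
Variables (R : realType) (Y : toricCY3 R) (a b : nat) (d : 'I_(a.+1 + b.+1) -> surface Y).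
Local Notation fs := (fix_sub (d := d)).
Local Notation fq := (fix_quo (d := d)).
Local Notation ext := (extended_charges fs fq (screening_charge (d := d_sub d))
  (screening_charge (d := d_quo d))).

Lemma fix_cover (x : fixS d) : (exists y, x = fs y) \/ (exists y, x = fq y).
Proof.
have [h [_ hK]] := fix_inverse d; rewrite -[x]hK.
by case: (h x) => y; [left | right]; exists y.
Qed.

Lemma extended_screening mu : ext mu -> screening_charge mu.
Proof.
case=> -[mu0 [k [k' [s [kk E]]]]].
  exists (lshift b.+1 k), (lshift b.+1 k'), (exist _ (val s) (valP s)); split=> //.
  apply/funext => x; case: (fix_cover x) => -[y ->].
    by rewrite -[mu _]/((mu \o fs) y) E /lambda_screen /= !eq_lshift.
  by rewrite mu0 /lambda_screen /= !eq_rlshift if_same.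
exists (rshift a.+1 k), (rshift a.+1 k'), (exist _ (val s) (valP s)).
split; first by rewrite /= kk addnS.
apply/funext => x; case: (fix_cover x) => -[y ->].
  by rewrite mu0 /lambda_screen /= !eq_lrshift if_same.
by rewrite -[mu _]/((mu \o fq) y) E /lambda_screen /= !eq_rshift.
Qed.

(** Two consecutive levels lie in one block, or are the last of the first block and the first of the
    second; the latter pairs are the new screenings. *)
Lemma screening_extended mu : screening_charge mu -> ext mu \/
  exists s : screen_curve d (lshift b.+1 ord_max) (rshift a.+1 ord0),
    mu = lambda_screen (lshift b.+1 ord_max) (rshift a.+1 ord0) (val s).
Proof.
move=> [k [k' [s [kk ->]]]]; move: s.
case: (splitP k) => j jE; case: (splitP k') => j' jE'.
- have kE : k = lshift b.+1 j by apply: val_inj.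
  have kE' : k' = lshift b.+1 j' by apply: val_inj.
  subst k k' => s; left; left; split.
    by move=> y; rewrite /lambda_screen /= !eq_rlshift if_same.
  exists j, j', (exist _ (val s) (valP s)); split; first by move: kk => /=; lia.
  by apply/funext => y; rewrite /lambda_screen /= !eq_lshift.
- have j0 : j = ord_max.
    by apply: val_inj => /=; have := ltn_ord j; move: kk; rewrite jE jE'; lia.
  have j0' : j' = ord0.
    by apply: val_inj => /=; have := ltn_ord j; move: kk; rewrite jE jE'; lia.
  have kE : k = lshift b.+1 ord_max by apply: val_inj; rewrite /= jE j0.
  have kE' : k' = rshift a.+1 ord0 by apply: val_inj; rewrite /= jE' j0'.
  by subst k k' => s; right; exists s.
- by move: kk; rewrite jE jE'; have := ltn_ord j'; lia.
- have kE : k = rshift a.+1 j by apply: val_inj.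
  have kE' : k' = rshift a.+1 j' by apply: val_inj.
  subst k k' => s; left; right; split.
    by move=> y; rewrite /lambda_screen /= !eq_lrshift if_same.
  exists j, j', (exist _ (val s) (valP s)); split; first by move: kk => /=; lia.
  by apply/funext => y; rewrite /lambda_screen /= !eq_rshift.
Qed.

End Extension.

Local Close Scope ring_scope.
Local Open Scope classical_set_scope.

(* N = a + b + 2 and k_0 = a + 1. *)
Theorem proposition3p3 (R : realType) (Y : toricCY3 R) (S : surface Y -> nat)
    (a b : nat) (d : 'I_(a.+1 + b.+1) -> surface Y) (F : filtration S d) :
  let VS := VY (d := d) in
  let VR := VY (d := d_sub d) in
  let VT := VY (d := d_quo d) in
  let VRT := tens_set VR VT in
  let Phi := canonical_iso (d := d) in
  [/\ vertex_superalgebra VS,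
      vertex_superalgebra VR /\ vertex_superalgebra VT,
      vertex_superalgebra VRT,
      vertex_isomorphism Phi &
      vertex_embedding VS VRT Phi /\
      Phi @` VS = [set x | VRT x /\ Q_tensor x = (fun=> 0%R)]].
Proof.
move=> VS VR VT VRT Phi.
have [gI [fIK gIK]] := fix_inverse d; have [gJ [fJK gJK]] := curve_inverse d.
have VRTE : VRT = tens_set
    [set v | forall mu, screening_charge mu -> screening (g := formS (d := d_sub d))
      (lam := lambda_compact (d := d_sub d)) (ltJ := lt_curveS (d := d_sub d)) mu v = 0%R]
    [set v | forall mu, screening_charge mu -> screening (g := formS (d := d_quo d))
      (lam := lambda_compact (d := d_quo d)) (ltJ := lt_curveS (d := d_quo d)) mu v = 0%R].
  by rewrite /VRT /VR /VT !VY_charges.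
have VRT_vsa : vertex_superalgebra VRT.
  rewrite VRTE.
  exact: (tens_kernel_vsa fIK gIK fJK gJK (@baseField_char0 R) (@formS_neq0 _ _ _ d)
    (@formS_sub _ _ _ _ d) (@formS_quo _ _ _ _ d) (@lambda_sub_sub _ _ _ _ d)
    (@lambda_sub_quo _ _ _ _ d) (@lambda_quo_sub _ _ _ _ d) (@lambda_quo_quo _ _ _ _ d)
    (@compact_pairing _ _ _ d) (@lt_curveS_irr _ _ _ d) (@lt_curveS_total _ _ _ d)
    (@lt_sub_sub _ _ _ _ d) (@lt_quo_quo _ _ _ _ d) (@lt_sub_quo _ _ _ _ d)
    (@lt_quo_sub _ _ _ _ d) (@screening_charge_int _ _ _ (d_sub d))
    (@screening_charge_int _ _ _ (d_quo d))).
have Phi_is : vertex_isomorphism Phi.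
  exact: (Phi_iso fIK gIK fJK gJK (@baseField_char0 R) (@formS_neq0 _ _ _ d)
    (@formS_sub _ _ _ _ d) (@formS_quo _ _ _ _ d) (@lambda_sub_sub _ _ _ _ d)
    (@lambda_sub_quo _ _ _ _ d) (@lambda_quo_sub _ _ _ _ d) (@lambda_quo_quo _ _ _ _ d)
    (@compact_pairing _ _ _ d) (@lt_curveS_irr _ _ _ d) (@lt_curveS_total _ _ _ d)
    (@lt_sub_sub _ _ _ _ d) (@lt_quo_quo _ _ _ _ d) (@lt_sub_quo _ _ _ _ d)
    (@lt_quo_sub _ _ _ _ d)).
(* The counterpart in [Pi d] of the tensor product of the two kernels; the remaining screenings cut
   [VS] out of it. *)
pose W := [set v : carrier (Pi d) | forall mu, extended_charges (fix_sub (d := d)) (fix_quo (d := d))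
  (screening_charge (d := d_sub d)) (screening_charge (d := d_quo d)) mu ->
  screening (g := formS (d := d)) (lam := lambda_compact (d := d))
    (ltJ := lt_curveS (d := d)) mu v = 0%R].
have VRTW : VRT = Phi @` W.
  rewrite VRTE.
  exact: (tens_kernel fIK gIK fJK gJK _ _ _ (@baseField_char0 R) (@formS_neq0 _ _ _ d)
    (@formS_sub _ _ _ _ d) (@formS_quo _ _ _ _ d) (@lambda_sub_sub _ _ _ _ d)
    (@lambda_sub_quo _ _ _ _ d) (@lambda_quo_sub _ _ _ _ d) (@lambda_quo_quo _ _ _ _ d)
    (@screening_charge_int _ _ _ (d_sub d)) (@screening_charge_int _ _ _ (d_quo d))).
have Phi_i : injective Phi by move=> u v; apply: (ve_inj Phi_is.1).
have VSW : VS `<=` W.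
  by rewrite /VS VY_charges => v vV mu /extended_screening; exact: vV.
(* [Q_tensor] is evaluated on a chosen preimage, which is [v] by injectivity. *)
have QT v : Q_tensor (Phi v) = Qsum v.
  by rewrite /Q_tensor (xget_fibre _ v Phi_i).
split; [exact: VY_vsa | by split; exact: VY_vsa | exact: VRT_vsa | exact: Phi_is | split].
  split.
  - by move=> u uV; rewrite VRTW; exists u => //; exact: VSW.
  - by move=> c u v _ _; apply: (ve_lin Phi_is.1).
  - by move=> p u _; apply: (ve_par Phi_is.1).
  - exact: (ve_vac Phi_is.1).
  - by move=> u n v _ _; apply: (ve_prod Phi_is.1).
  - by move=> u v _ _; exact: Phi_i.
apply/seteqP; split=> [x [v vV vE]|x [+ Q0]].
  rewrite -vE; split; first by rewrite VRTW; exists v => //; exact: VSW.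
  rewrite QT; apply/functional_extensionality_dep => s.
  by apply: vV; rewrite /= addn0.
rewrite VRTW => -[v vW vE]; exists v => //; rewrite /VS VY_charges => mu.
case/screening_extended => [/vW//|[s ->]].
have := congr1 (fun f => f s) Q0; by rewrite -vE QT.
Qed.
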